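(* Let $0<d<\pi/2$, $\mathscr{D}_d=\{\zeta\in\mathbb{C}:|\Im\zeta|<d\}$, and let $i\in\{2,3\}$, with $\psi_2(t)=e^t$, $\psi_3(t)=\operatorname{arcsinh}(e^t)$, $E_2(z;\alpha,\beta)=z^{\alpha-1}(1+z^2)^{-(\alpha+\beta)/2}$, $E_3(z;\alpha,\beta)=\left(\frac{z}{1+z}\right)^{\alpha-1}e^{-\beta z}$. Assume $f$ is analytic on $\psi_i(\mathscr{D}_d)$ and there are constants $K,\alpha,\beta>0$ with $|f(z)|\le K|E_i(z;\alpha,\beta)|$ for all $z\in\psi_i(\mathscr{D}_d)$. Let $\mu=\min\{\alpha,\beta\}$, let $n$ be a positive integer, $h=\sqrt{2\pi d/(\mu n)}$, and let $M=n$, $N=\lceil\alpha n/\beta\rceil$ if $\mu=\alpha$, and $N=n$, $M=\lceil\beta n/\alpha\rceil$ if $\mu=\beta$. Then \[ \left|\int_{0}^{\infty} f(t)\,dt-h\sum_{k=-M}^{N} f(\psi_i(kh))\psi_i'(kh)\right|\le C_i\,e^{-\sqrt{2\pi d\mu n}}, \] where \[ C_2=\frac{2K}{\mu}\left\{\frac{2}{(1-e^{-\sqrt{2\pi d\mu}})(\cos d)^{(\alpha+\beta)/2}}+1\right\},\quad C_3=\frac{2K}{\mu}\left\{\frac{2^{1+\beta/2}c_{\alpha,d}}{(1-e^{-\sqrt{2\pi d\mu}})(\cos d)^{(\alpha+\beta)/2}}+2^{(1-\alpha+|1-\alpha|)/2}\right\}, \] and $c_{\alpha,d}=\{2(1+1/\cos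 d)\}^{(1-\alpha)/2}$ if $0<\alpha<1$, $c_{\alpha,d}=2^{(\alpha-1)/2}$ if $\alpha\ge 1$.
   Context: $\psi_i(\mathscr{D}_d)$ is the image of the strip under $\psi_i$. Complex powers use principal branches. *)

(* Defs.v *)
From Stdlib Require Import Reals ZArith.
From Coquelicot Require Import Coquelicot.
Open Scope R_scope.

(* Principal argument in (-PI, PI]. *)
Definition Carg (z : C) : R :=
  let x := fst z in let y := snd z in
  if Rlt_dec 0 x then atan (y / x)
  else if Rlt_dec x 0 then
    (if Rle_dec 0 y then atan (y / x) + PI else atan (y / x) - PI)
  else if Rlt_dec 0 y then PI / 2
  else if Rlt_dec y 0 then - (PI / 2) else 0.

(* Principal logarithm (Log 0 := arbitrary, never used). *)
Definition Clog (z : C) : C := (ln (Cmod z), Carg z).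

Definition Cexp (z : C) : C :=
  (exp (fst z) * cos (snd z), exp (fst z) * sin (snd z)).

Definition Cpow (z a : C) : C :=
  if Ceq_dec z 0 then 0 else Cexp (a * Clog z).

Definition Csqrt (z : C) : C := Cpow z (RtoC (1/2)).
Definition Casinh (w : C) : C := Clog (w + Csqrt (w * w + 1)).

Definition psiC (i : nat) (zeta : C) : C :=
  if Nat.eqb i 2 then Cexp zeta else Casinh (Cexp zeta).
Definition psiR (i : nat) (t : R) : R :=
  if Nat.eqb i 2 then exp t else ln (exp t + sqrt (exp t * exp t + 1)).

Definition strip (d : R) (zeta : C) : Prop := Rabs (snd zeta) < d.
Definition psi_image (i : nat) (d : R) (z : C) : Prop :=
  exists zeta, strip d zeta /\ z = psiC i zeta.

Definition E_fun (i : nat) (al be : R) (z : C) : C :=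
  if Nat.eqb i 2 then
    Cpow z (RtoC (al - 1)) * Cpow (1 + z * z) (RtoC (- (al + be) / 2))
  else
    Cpow (z / (1 + z)) (RtoC (al - 1)) * Cexp (RtoC (- be) * z).

(* Ceiling of a real number: ceil x = - floor(-x), floor y = up y - 1. *)
Definition ceilZ (x : R) : Z := (1 - up (- x))%Z.

Definition MN (al be : R) (n : nat) : nat * nat :=
  if Rle_dec al be then (n, Z.to_nat (ceilZ (al * INR n / be)))
  else (Z.to_nat (ceilZ (be * INR n / al)), n).

Definition sinc_sum (i : nat) (f : C -> C) (h : R) (M N : nat) : C :=
  Cmult (RtoC h) (sum_n (fun j : nat =>
     let k := INR j - INR M in
     Cmult (f (RtoC (psiR i (k * h)))) (RtoC (Derive (psiR i) (k * h)))) (M + N)).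

Definition c_ad (al d : R) : R :=
  if Rlt_dec al 1 then Rpower (2 * (1 + 1 / cos d)) ((1 - al) / 2)
  else Rpower 2 ((al - 1) / 2).

Definition C_const (i : nat) (K al be d : R) : R :=
  let mu := Rmin al be in
  if Nat.eqb i 2 then
    2 * K / mu * (2 / ((1 - exp (- sqrt (2 * PI * d * mu)))
                       * Rpower (cos d) ((al + be) / 2)) + 1)
  else
    2 * K / mu * (Rpower 2 (1 + be / 2) * c_ad al d
                    / ((1 - exp (- sqrt (2 * PI * d * mu)))
                       * Rpower (cos d) ((al + be) / 2))
                  + Rpower 2 ((1 - al + Rabs (1 - al)) / 2)).

(* Main.v *)
Require Import Defs.
From Stdlib Require Import Reals ZArith Lra Lia Psatz.
From Coquelicot Require Import Coquelicot.
Open Scope R_scope.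

(** The substitution t = psi(x) turns the integral into one over the real line of
    F = (f o psi) psi', which is holomorphic on the strip |Im| < d and decays like
    exp(-mu |x|) there.  Sampling F at the points kh amounts, on each period, to integrating it
    against the Dirichlet kernel 1 + sum_m (q^m + q^-m), q = exp(2 pi i x / h), in the limit
    m -> oo (Riemann-Lebesgue).  Hence the discretization error is the limit of the integrals of
    F against the truncated series of q^m and q^-m; these have no poles, so Goursat's theorem on
    rectangles moves the former to Im = d' and the latter to Im = -d', where the kernels are at
    most Q / (1 - Q) with Q = exp(-2 pi d' / h).  The rectangles are cut at the half-integer
    points x = +-(L + 1/2) h, where q is negative and the truncated series is bounded by 1, so
    the vertical sides vanish as L -> oo; finally d' -> d.  The truncation error is a geometric
    sum.  For psi = arcsinh o exp, write z = a + ib = psi(x + iy), so that exp(x + iy) = sinh z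
    and sqrt(1 + exp(2(x + iy))) = cosh z, and the decay of F reduces to real inequalities
    in a and b. *)

(** The classical cotangent kernel has poles at the nodes and would call for residues; truncated
    kernels are entire, so Goursat suffices. Every contour bound is uniform in the number of terms,
    so no limit is taken inside a contour integral: for each tolerance one large truncation is
    fixed. Two majorants of [F] are kept apart. [A], valid on the strip, carries the power of
    [cos d] and governs the discretization error: each half plane contributes the mass [2 * A / mu]
    of [A * exp (- (mu * Rabs x))], whence [4 * A / mu]. [B], valid on the real line, is sharper
    because [z] is real there, and governs the truncation error: the two tails cost at most
    [2 * B / mu]. These are the two terms inside the braces of the constant. The step [h] makes
    [2 * PI * d / h] equal to [mu * n * h], so both errors decay at the same rate, and [n >= 1]
    bounds the geometric denominator by its value at [n = 1]. The integral is improper at both ends,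
    so its existence is established together with the bound, from explicit tail estimates. *)

Ltac Cring := match goal with |- ?a = ?b => change (@eq C a b) end; ring.

Notation ccontinuous := (continuous (T := C_UniformSpace) (U := C_UniformSpace)).

(** * Modulus and continuity of complex-valued maps *)

Lemma Cmod_norm_R (z : C) : norm (K := R_AbsRing) (V := C_R_NormedModule) z = Cmod z.
Proof. symmetry. apply Cmod_norm. Qed.

Lemma Cmod_sub_comm (z w : C) : Cmod (z - w) = Cmod (w - z).
Proof. rewrite <- Cmod_opp. f_equal. ring. Qed.

Lemma Csub_neq_0 (z w : C) : z <> w -> (z - w)%C <> 0.
Proof. intros n E. apply n. replace z with (z - w + w)%C by ring. rewrite E. ring. Qed.

Lemma Cmod_le_abs (z : C) : Cmod z <= Rabs (fst z) + Rabs (snd z).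
Proof.
  unfold Cmod. rewrite <- (sqrt_pow2 (Rabs (fst z) + Rabs (snd z))).
  - apply sqrt_le_1_alt. rewrite <- (pow2_abs (fst z)), <- (pow2_abs (snd z)).
    pose proof (Rabs_pos (fst z)); pose proof (Rabs_pos (snd z)). nra.
  - pose proof (Rabs_pos (fst z)); pose proof (Rabs_pos (snd z)). lra.
Qed.

Lemma Rabs_fst_le (z : C) : Rabs (fst z) <= Cmod z.
Proof. eapply Rle_trans; [|apply Rmax_Cmod]. apply Rmax_l. Qed.

Lemma Rabs_snd_le (z : C) : Rabs (snd z) <= Cmod z.
Proof. eapply Rle_trans; [|apply Rmax_Cmod]. apply Rmax_r. Qed.

Lemma Cmod_sqr (z : C) : Cmod z ^ 2 = fst z ^ 2 + snd z ^ 2.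
Proof. rewrite Cmod2_alt. reflexivity. Qed.

Lemma ball_Cmod (z w : C) (eps : posreal) :
  Cmod (w - z) < eps -> ball (M := C_UniformSpace) z eps w.
Proof. intros H. apply C_NormedModule_mixin_compat1. exact H. Qed.

(** Balls of [C_UniformSpace] are squares, so the modulus is controlled only up to [sqrt 2], rounded
    up to 2 here. *)
Lemma Cmod_ball (z w : C) (eps : posreal) :
  ball (M := C_UniformSpace) z eps w -> Cmod (w - z) < 2 * eps.
Proof.
  intros H. apply C_NormedModule_mixin_compat2 in H.
  apply Rlt_le_trans with (1 := H).
  apply Rmult_le_compat_r; [apply Rlt_le, cond_pos|].
  pose proof (sqrt_sqrt 2 ltac:(lra)). pose proof (sqrt_pos 2). nra.
Qed.

Lemma locally_Cmod (z : C) (P : C -> Prop) :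
  locally (T := C_UniformSpace) z P <->
  exists del, 0 < del /\ forall w, Cmod (w - z) < del -> P w.
Proof.
  split.
  - intros [e H]. exists e. split; [apply cond_pos|].
    intros w Hw. apply H, ball_Cmod, Hw.
  - intros [del [Hd H]].
    assert (Hd2 : 0 < del / 2) by lra.
    exists (mkposreal _ Hd2). intros w Hw. apply H.
    apply Cmod_ball in Hw. simpl in Hw. lra.
Qed.

Section ContinuousToC.
Context {U : UniformSpace}.
Implicit Types f g : U -> C.

Lemma continuous_C_eps f (x : U) :
  continuous (U := C_UniformSpace) f x <->
  forall eps, 0 < eps -> locally x (fun y => Cmod (f y - f x) < eps).
Proof.
  split.
  - intros H eps He.
    apply (H (fun w => Cmod (w - f x) < eps)).
    apply locally_Cmod. exists eps. split; auto.
  - intros H. apply filterlim_locally. intros eps.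
    generalize (H eps (cond_pos eps)). apply filter_imp. intros y Hy. now apply ball_Cmod.
Qed.

Lemma continuous_C_pair f (x : U) :
  continuous (fun y => fst (f y)) x -> continuous (fun y => snd (f y)) x ->
  continuous (U := C_UniformSpace) f x.
Proof.
  intros H1 H2. apply filterlim_locally. intros eps.
  generalize (filter_and _ _ (proj1 (filterlim_locally _ _) H1 eps)
    (proj1 (filterlim_locally _ _) H2 eps)).
  apply filter_imp. intros y [A B]. split; assumption.
Qed.

Lemma continuous_C_fst f (x : U) :
  continuous (U := C_UniformSpace) f x -> continuous (fun y => fst (f y)) x.
Proof.
  intros H. apply filterlim_locally. intros eps.
  generalize (proj1 (filterlim_locally _ _) H eps).
  apply filter_imp. intros y [A B]. exact A.
Qed.

Lemma continuous_C_snd f (x : U) :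
  continuous (U := C_UniformSpace) f x -> continuous (fun y => snd (f y)) x.
Proof.
  intros H. apply filterlim_locally. intros eps.
  generalize (proj1 (filterlim_locally _ _) H eps).
  apply filter_imp. intros y [A B]. exact B.
Qed.

Lemma continuous_Cplus f g (x : U) :
  continuous (U := C_UniformSpace) f x -> continuous (U := C_UniformSpace) g x ->
  continuous (U := C_UniformSpace) (fun y => (f y + g y)%C) x.
Proof.
  intros Hf Hg. apply continuous_C_pair; simpl;
  apply (continuous_plus (V := R_NormedModule)).
  all: auto using continuous_C_fst, continuous_C_snd.
Qed.

Lemma continuous_Copp f (x : U) :
  continuous (U := C_UniformSpace) f x ->
  continuous (U := C_UniformSpace) (fun y => (- f y)%C) x.
Proof.
  intros Hf. apply continuous_C_pair; simpl;
  apply (continuous_opp (V := R_NormedModule)).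
  all: auto using continuous_C_fst, continuous_C_snd.
Qed.

Lemma continuous_Cminus f g (x : U) :
  continuous (U := C_UniformSpace) f x -> continuous (U := C_UniformSpace) g x ->
  continuous (U := C_UniformSpace) (fun y => (f y - g y)%C) x.
Proof. intros Hf Hg. apply continuous_Cplus; auto. now apply continuous_Copp. Qed.

Lemma continuous_Cmult f g (x : U) :
  continuous (U := C_UniformSpace) f x -> continuous (U := C_UniformSpace) g x ->
  continuous (U := C_UniformSpace) (fun y => (f y * g y)%C) x.
Proof.
  intros Hf Hg. apply continuous_C_pair; simpl.
  - apply (continuous_minus (V := R_NormedModule)); apply (continuous_mult (K := R_AbsRing));
    auto using continuous_C_fst, continuous_C_snd.
  - apply (continuous_plus (V := R_NormedModule)); apply (continuous_mult (K := R_AbsRing));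
    auto using continuous_C_fst, continuous_C_snd.
Qed.

Lemma continuous_Cmod f (x : U) :
  continuous (U := C_UniformSpace) f x -> continuous (fun y => Cmod (f y)) x.
Proof.
  intros Hf. apply (continuous_comp _ sqrt).
  - apply (continuous_plus (V := R_NormedModule)); apply (continuous_comp _ (fun t => t ^ 2));
      auto using continuous_C_fst, continuous_C_snd;
      apply continuity_pt_filterlim, derivable_continuous_pt, derivable_pt_pow.
  - apply continuous_sqrt.
Qed.

Lemma continuous_Cinv f (x : U) : f x <> 0 ->
  continuous (U := C_UniformSpace) f x ->
  continuous (U := C_UniformSpace) (fun y => (/ f y)%C) x.
Proof.
  intros Hx Hf. apply continuous_C_eps. intros eps He.
  pose proof (proj1 (Cmod_gt_0 _) Hx) as Hm. set (m := Cmod (f x)) in *.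
  (* The first bound keeps [Cmod (f y)] above [m / 2]; the second then makes the quotient
     [Cmod (f y - f x) / (Cmod (f y) * m)] smaller than [eps]. *)
  assert (Hk : 0 < Rmin (m / 2) (eps * m * m / 2)).
  { apply Rmin_glb_lt; [lra|]. repeat apply Rmult_lt_0_compat; lra. }
  generalize (proj1 (continuous_C_eps f x) Hf _ Hk). apply filter_imp. intros y Hy.
  pose proof (Rlt_le_trans _ _ _ Hy (Rmin_l _ _)) as H1.
  pose proof (Rlt_le_trans _ _ _ Hy (Rmin_r _ _)) as H2.
  assert (H3 : m / 2 < Cmod (f y)).
  { assert (m <= Cmod (f y) + Cmod (f y - f x)).
    { rewrite (Cmod_sub_comm (f y)). unfold m.
      replace (f x) with (f y + (f x - f y))%C at 1 by ring. apply Cmod_triangle. }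
    lra. }
  assert (Hy0 : f y <> 0) by (apply Cmod_gt_0; lra).
  replace (/ f y - / f x)%C with (- (f y - f x) / (f y * f x))%C by (field; auto).
  rewrite Cmod_div by (apply Cmult_neq_0; auto).
  rewrite Cmod_opp, Cmod_mult. fold m.
  apply Rmult_lt_reg_r with (Cmod (f y) * m); [nra|].
  unfold Rdiv. rewrite Rmult_assoc, Rinv_l by nra. rewrite Rmult_1_r.
  apply Rlt_trans with (1 := H2).
  assert (0 < eps * m) by nra. nra.
Qed.

End ContinuousToC.

(** * Algebra of the complex exponential *)

Lemma Cexp_0 : Cexp 0 = 1.
Proof. unfold Cexp; simpl. now rewrite exp_0, cos_0, sin_0, Rmult_0_r, Rmult_1_r. Qed.

Lemma Cexp_plus (z w : C) : Cexp (z + w) = (Cexp z * Cexp w)%C.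
Proof.
  unfold Cexp, Cmult; simpl. rewrite exp_plus, cos_plus, sin_plus. f_equal; ring.
Qed.

Lemma Cmod_Cexp (z : C) : Cmod (Cexp z) = exp (fst z).
Proof.
  unfold Cmod, Cexp; simpl.
  transitivity (sqrt (exp (fst z) ^ 2)); [|apply sqrt_pow2, Rlt_le, exp_pos].
  f_equal. pose proof (sin2_cos2 (snd z)) as H. unfold Rsqr in H. simpl. nra.
Qed.

Lemma Cexp_neq_0 (z : C) : Cexp z <> 0.
Proof. apply Cmod_gt_0. rewrite Cmod_Cexp. apply exp_pos. Qed.

Lemma Cexp_RtoC (x : R) : Cexp (RtoC x) = RtoC (exp x).
Proof. unfold Cexp, RtoC; simpl. now rewrite cos_0, sin_0, Rmult_0_r, Rmult_1_r. Qed.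

Lemma Cexp_opp (z : C) : (Cexp z * Cexp (- z))%C = 1.
Proof. rewrite <- Cexp_plus, <- Cexp_0. f_equal. ring. Qed.

(** * Complex differentiability *)

(* Caratheodory's form of complex differentiability. *)
Definition cdiff (f : C -> C) (z : C) : Prop :=
  exists phi : C -> C, ccontinuous phi z /\
  forall w, f w = (f z + phi w * (w - z))%C.

Lemma cdiff_continuous (f : C -> C) (z : C) : cdiff f z -> ccontinuous f z.
Proof.
  intros [phi [Hc He]].
  apply continuous_ext with (fun w => (f z + phi w * (w - z))%C); [intros; now rewrite <- He|].
  apply continuous_Cplus; [apply continuous_const|].
  apply continuous_Cmult; auto. apply continuous_Cminus; [apply continuous_id|apply continuous_const].
Qed.

Lemma cdiff_const (c z : C) : cdiff (fun _ => c) z.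
Proof. exists (fun _ => RtoC 0). split; [apply continuous_const|]. intros w. ring. Qed.

Lemma cdiff_id (z : C) : cdiff (fun w => w) z.
Proof. exists (fun _ => RtoC 1). split; [apply continuous_const|]. intros w. ring. Qed.

Lemma cdiff_plus (f g : C -> C) (z : C) :
  cdiff f z -> cdiff g z -> cdiff (fun w => (f w + g w)%C) z.
Proof.
  intros [p [Hp Ep]] [q [Hq Eq]]. exists (fun w => (p w + q w)%C).
  split; [now apply continuous_Cplus|]. intros w. rewrite (Ep w), (Eq w). ring.
Qed.

Lemma cdiff_mult (f g : C -> C) (z : C) :
  cdiff f z -> cdiff g z -> cdiff (fun w => (f w * g w)%C) z.
Proof.
  intros Hf [q [Hq Eq]]. generalize Hf. intros [p [Hp Ep]].
  exists (fun w => (f w * q w + p w * g z)%C). split.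
  - apply continuous_Cplus; apply continuous_Cmult; auto using continuous_const.
    now apply cdiff_continuous.
  - intros w. rewrite (Eq w), (Ep w). ring.
Qed.

Lemma cdiff_comp (f g : C -> C) (z : C) :
  cdiff f (g z) -> cdiff g z -> cdiff (fun w => f (g w)) z.
Proof.
  intros [p [Hp Ep]] Hg. generalize Hg. intros [q [Hq Eq]].
  exists (fun w => (p (g w) * q w)%C). split.
  - apply continuous_Cmult; auto. apply (continuous_comp g p); auto. now apply cdiff_continuous.
  - intros w. rewrite (Ep (g w)), (Eq w). ring.
Qed.

Lemma cdiff_ext (f g : C -> C) (z : C) : (forall w, f w = g w) -> cdiff f z -> cdiff g z.
Proof.
  intros E [p [Hp Ep]]. exists p. split; auto. intros w. rewrite <- !E. apply Ep.
Qed.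

(** The difference quotient, completed by [l] at [z], is the slope. The value [phi z = l] is
    recorded because inverting a function needs a nonzero slope at the point. *)
Lemma cdiff_intro (f : C -> C) (z l : C) :
  (forall eps, 0 < eps -> exists del, 0 < del /\ forall w, Cmod (w - z) < del ->
     Cmod (f w - f z - l * (w - z)) <= eps * Cmod (w - z)) ->
  exists phi : C -> C, ccontinuous phi z /\ phi z = l /\
    forall w, f w = (f z + phi w * (w - z))%C.
Proof.
  intros H.
  exists (fun w => if Ceq_dec w z then l else ((f w - f z) / (w - z))%C). split; [|split].
  - apply continuous_C_eps. intros eps He. apply locally_Cmod.
    destruct (H (eps / 2)) as [del [Hd HH]]; [lra|].
    exists del. split; auto. intros w Hw. specialize (HH w Hw).
    destruct (Ceq_dec z z) as [_|]; [|congruence].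
    destruct (Ceq_dec w z) as [->|n].
    + replace (l - l)%C with (RtoC 0) by ring. rewrite Cmod_0. lra.
    + assert (Hn : (w - z)%C <> 0) by now apply Csub_neq_0.
      pose proof (proj1 (Cmod_gt_0 _) Hn).
      replace ((f w - f z) / (w - z) - l)%C with ((f w - f z - l * (w - z)) / (w - z))%C by (field; auto).
      rewrite Cmod_div by auto. apply Rle_lt_trans with (eps / 2); [|lra].
      apply Rmult_le_reg_r with (Cmod (w - z)); auto.
      unfold Rdiv at 1. rewrite Rmult_assoc, Rinv_l by lra. lra.
  - destruct (Ceq_dec z z); congruence.
  - intros w. destruct (Ceq_dec w z) as [->|n]; [ring|].
    field. now apply Csub_neq_0.
Qed.

Lemma cdiff_eps (f : C -> C) (z : C) : cdiff f z -> exists l,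
  forall eps, 0 < eps -> exists del, 0 < del /\ forall w, Cmod (w - z) < del ->
     Cmod (f w - f z - l * (w - z)) <= eps * Cmod (w - z).
Proof.
  intros [p [Hp Ep]]. exists (p z). intros eps He.
  destruct (proj1 (locally_Cmod _ _) (proj1 (continuous_C_eps p z) Hp _ He)) as [del [Hd H]].
  exists del. split; auto. intros w Hw. rewrite (Ep w).
  replace (f z + p w * (w - z) - f z - p z * (w - z))%C with ((p w - p z) * (w - z))%C by ring.
  rewrite Cmod_mult. apply Rmult_le_compat_r; [apply Cmod_ge_0|]. apply Rlt_le, H, Hw.
Qed.

Lemma ex_derive_cdiff (f : C -> C) (z : C) :
  ex_derive (K := C_AbsRing) (V := C_NormedModule) f z -> cdiff f z.
Proof.
  intros [l [_ H]].
  destruct (cdiff_intro f z l) as [phi [A [_ B]]]; [|now exists phi].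
  intros eps He.
  specialize (H z (fun P HP => HP) (mkposreal eps He)). destruct H as [del H].
  exists del. split; [apply cond_pos|]. intros w Hw. specialize (H w Hw).
  rewrite (Cmult_comm l). exact H.
Qed.

(** Inverse function rule for a continuous branch [g] of the inverse of [phi], composed with [k]:
    comparing the slopes of [k] and of [phi] gives the slope of [g] as their quotient. It serves for
    the square root ([phi] squaring) and for arcsinh ([phi] the exponential). *)
Lemma cdiff_inverse (phi g k : C -> C) (z : C) :
  ccontinuous g z -> cdiff k z -> (forall w, phi (g w) = k w) ->
  (exists Phi : C -> C, ccontinuous Phi (g z) /\ Phi (g z) <> 0 /\
     forall u, phi u = (phi (g z) + Phi u * (u - g z))%C) ->
  cdiff g z.
Proof.
  intros Hg [q [Hq Eq]] E [P [HP [Pn EP]]].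
  set (ga := fun w => (q w / P (g w))%C).
  (* The slope identity is required at every [w], so where [P (g w)] vanishes, which does not happen
     near [z], the raw difference quotient is used. *)
  exists (fun w => if Ceq_dec (P (g w)) 0 then ((g w - g z) / (w - z))%C else ga w).
  assert (Hc : ccontinuous (fun w => P (g w)) z) by now apply (continuous_comp g P).
  split.
  - apply continuous_ext_loc with ga.
    + pose proof (proj1 (Cmod_gt_0 _) Pn) as Hm.
      generalize (proj1 (continuous_C_eps _ _) Hc _ Hm). apply filter_imp. intros y Hy.
      destruct (Ceq_dec (P (g y)) 0) as [E0|]; auto. exfalso. rewrite E0 in Hy.
      rewrite Cmod_sub_comm in Hy.
      replace (P (g z) - 0)%C with (P (g z)) in Hy by ring. lra.
    + apply continuous_Cmult; auto. now apply continuous_Cinv.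
  - intros w. destruct (Ceq_dec (P (g w)) 0) as [E0|n0].
    + destruct (Ceq_dec w z) as [->|n]; [ring|].
      field. now apply Csub_neq_0.
    + unfold ga. pose proof (EP (g w)) as H1. rewrite !E, (Eq w) in H1.
      assert (H2 : (q w * (w - z))%C = (P (g w) * (g w - g z))%C).
      { replace (q w * (w - z))%C with (k z + q w * (w - z) - k z)%C by ring. rewrite H1. ring. }
      replace (q w / P (g w) * (w - z))%C with (q w * (w - z) / P (g w))%C by (field; auto).
      rewrite H2. field. auto.
Qed.

Lemma cdiff_inv (g : C -> C) (z : C) : g z <> 0 -> cdiff g z -> cdiff (fun w => (/ g w)%C) z.
Proof.
  intros Hz Hg. generalize Hg. intros [q [Hq Eq]].
  exists (fun w => if Ceq_dec (g w) 0 then ((/ g w - / g z) / (w - z))%C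
                   else (- q w / (g w * g z))%C).
  assert (Hc := cdiff_continuous g z Hg). split.
  - apply continuous_ext_loc with (fun w => (- q w / (g w * g z))%C).
    + pose proof (proj1 (Cmod_gt_0 _) Hz) as Hm.
      generalize (proj1 (continuous_C_eps _ _) Hc _ Hm). apply filter_imp. intros y Hy.
      destruct (Ceq_dec (g y) 0) as [E0|]; auto. exfalso. rewrite E0 in Hy.
      rewrite Cmod_sub_comm in Hy.
      replace (g z - 0)%C with (g z) in Hy by ring. lra.
    + apply continuous_Cmult; [now apply continuous_Copp|].
      apply continuous_Cinv; [now apply Cmult_neq_0|].
      apply continuous_Cmult; auto using continuous_const.
  - intros w. destruct (Ceq_dec (g w) 0) as [E0|n0].
    + destruct (Ceq_dec w z) as [->|n]; [ring|].
      (* Here [g w = 0] and its inverse is an arbitrary value; abstracting both inverses keeps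
         [field] from asking for [g w <> 0]. *)
      generalize (/ g w)%C (/ g z)%C. intros u v. field. now apply Csub_neq_0.
    + replace (- q w / (g w * g z) * (w - z))%C with (- (g z + q w * (w - z) - g z) / (g w * g z))%C by (field; auto).
      rewrite <- Eq. field. auto.
Qed.

Lemma derive_eps (f : R -> R) (x l eps : R) : 0 < eps -> is_derive f x l ->
  exists del, 0 < del /\ forall t, Rabs t < del -> Rabs (f (x + t) - f x - l * t) <= eps * Rabs t.
Proof.
  intros He [_ H]. specialize (H x (fun P HP => HP) (mkposreal eps He)).
  destruct H as [del H]. exists del. split; [apply cond_pos|]. intros t Ht.
  specialize (H (x + t)). unfold ball in H; simpl in H. unfold AbsRing_ball, minus, plus, opp, abs, scal, norm in H. simpl in H.
  unfold mult in H; simpl in H. unfold abs in H; simpl in H.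
  replace (x + t + - x) with t in H by ring.
  replace (f (x + t) - f x - l * t) with (f (x + t) + - f x + - (t * l)) by ring.
  apply H, Ht.
Qed.

(** At 0 the slope comes from the real derivatives of exp, cos and sin; the functional equation
    transports it to [z]. Its value is recorded for later use: it is nonzero, and it is 1 at the
    origin. *)
Lemma Cexp_slope (z : C) : exists Phi : C -> C, ccontinuous Phi z /\ Phi z = Cexp z /\
  forall w, Cexp w = (Cexp z + Phi w * (w - z))%C.
Proof.
  assert (H0 : exists p : C -> C, ccontinuous p (RtoC 0) /\ p (RtoC 0) = RtoC 1 /\ forall u, Cexp u = (Cexp 0 + p u * (u - 0))%C).
  { apply cdiff_intro. intros eps He.
    (* Each real remainder is at most [e * m], which makes the real and the imaginary part of the
       error at most [4 * (e * m)] each, hence the 8; the cap [1 / 8] keeps the factors [1 + x] and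
       [1 + b] below 2. *)
    pose (e := Rmin (eps / 8) (1 / 8)).
    assert (He' : 0 < e) by (apply Rmin_glb_lt; lra).
    assert (e <= eps / 8) by apply Rmin_l. assert (e <= 1 / 8) by apply Rmin_r. clearbody e.
    destruct (derive_eps exp 0 1 e He') as [d1 [Hd1 H1]].
    { auto_derive; auto. rewrite exp_0; ring. }
    destruct (derive_eps cos 0 0 e He') as [d2 [Hd2 H2]].
    { auto_derive; auto. rewrite sin_0; ring. }
    destruct (derive_eps sin 0 1 e He') as [d3 [Hd3 H3]].
    { auto_derive; auto. rewrite cos_0; ring. }
    exists (Rmin (Rmin d1 d2) (Rmin d3 e)). split; [now repeat (apply Rmin_pos)|].
    intros w Hw. replace (w - 0)%C with w in * by ring.
    assert (Hw1 : Cmod w < d1) by (eapply Rlt_le_trans; [exact Hw|]; eapply Rle_trans; [apply Rmin_l|apply Rmin_l]).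
    assert (Hw2 : Cmod w < d2) by (eapply Rlt_le_trans; [exact Hw|]; eapply Rle_trans; [apply Rmin_l|apply Rmin_r]).
    assert (Hw3 : Cmod w < d3) by (eapply Rlt_le_trans; [exact Hw|]; eapply Rle_trans; [apply Rmin_r|apply Rmin_l]).
    assert (Hw4 : Cmod w < e) by (eapply Rlt_le_trans; [exact Hw|]; eapply Rle_trans; [apply Rmin_r|apply Rmin_r]).
    destruct w as [x y].
    pose proof (Rabs_fst_le (x, y)) as Hx. pose proof (Rabs_snd_le (x, y)) as Hy. simpl in Hx, Hy.
    rewrite Cexp_0.
    specialize (H1 x ltac:(lra)). specialize (H2 y ltac:(lra)). specialize (H3 y ltac:(lra)).
    rewrite !Rplus_0_l in *. rewrite exp_0 in H1. rewrite cos_0 in H2. rewrite sin_0 in H3.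
    set (m := Cmod (x, y)) in *.
    eapply Rle_trans; [apply Cmod_le_abs|]. simpl.
    set (a := exp x - 1 - 1 * x) in *. set (b := cos y - 1 - 0 * y) in *. set (c := sin y - 0 - 1 * y) in *.
    replace (exp x * cos y + - (1) + - (1 * x - 0 * y)) with (a * (1 + b) + (1 + x) * b) by (unfold a, b; ring).
    replace (exp x * sin y + -0 + - (1 * y + 0 * x)) with (c + (a + x) * (c + y)) by (unfold a, b, c; ring).
    assert (Ha : Rabs a <= e * m) by nra. assert (Hb : Rabs b <= e * m) by nra. assert (Hc : Rabs c <= e * m) by nra.
    assert (0 <= m) by apply Cmod_ge_0.
    assert (e * m <= e) by nra.
    assert (T1 : Rabs (a * (1 + b) + (1 + x) * b) <= 4 * (e * m)).
    { eapply Rle_trans; [apply Rabs_triang|]. rewrite !Rabs_mult.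
      assert (Rabs (1 + b) <= 2). { eapply Rle_trans; [apply Rabs_triang|]. rewrite Rabs_R1. lra. }
      assert (Rabs (1 + x) <= 2). { eapply Rle_trans; [apply Rabs_triang|]. rewrite Rabs_R1. lra. }
      pose proof (Rabs_pos a); pose proof (Rabs_pos b). nra. }
    assert (T2 : Rabs (c + (a + x) * (c + y)) <= 4 * (e * m)).
    { eapply Rle_trans; [apply Rabs_triang|]. rewrite !Rabs_mult.
      assert (Rabs (a + x) <= 3 / 2 * e). { eapply Rle_trans; [apply Rabs_triang|]. nra. }
      assert (Rabs (c + y) <= 2 * m). { eapply Rle_trans; [apply Rabs_triang|]. nra. }
      pose proof (Rabs_pos (a + x)); pose proof (Rabs_pos (c + y)). nra. }
    nra. }
  destruct H0 as [p [Hp [Ep H]]].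
  exists (fun w => (Cexp z * p (w - z))%C). split; [|split].
  - apply continuous_Cmult; [apply continuous_const|].
    apply (continuous_comp (fun w => (w - z)%C) p).
    + apply continuous_Cminus; [apply continuous_id|apply continuous_const].
    + replace (z - z)%C with (RtoC 0) by ring. exact Hp.
  - replace (z - z)%C with (RtoC 0) by ring. rewrite Ep. ring.
  - intros w. replace w with (z + (w - z))%C at 1 by ring. rewrite Cexp_plus, (H (w - z)%C), Cexp_0.
    ring.
Qed.

Lemma cdiff_Cexp (z : C) : cdiff Cexp z.
Proof. destruct (Cexp_slope z) as [P [A [_ B]]]. now exists P. Qed.

(** * Cauchy-Goursat theorem for rectangles *)

Notation is_CInt := (is_RInt (V := C_R_CompleteNormedModule)).
Notation ex_CInt := (ex_RInt (V := C_R_CompleteNormedModule)).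
Notation CInt := (RInt (V := C_R_CompleteNormedModule)).
Notation Ccontinuous := (continuous (T := R_UniformSpace) (U := C_UniformSpace)).

Lemma ex_CInt_continuous (f : R -> C) (a b : R) : a <= b ->
  (forall x, a <= x <= b -> Ccontinuous f x) -> ex_CInt f a b.
Proof.
  intros Hab H. apply (ex_RInt_continuous (V := C_R_CompleteNormedModule)).
  rewrite Rmin_left, Rmax_right by auto. exact H.
Qed.

Lemma CInt_correct (f : R -> C) (a b : R) : a <= b ->
  (forall x, a <= x <= b -> Ccontinuous f x) -> is_CInt f a b (CInt f a b).
Proof. intros. now apply (RInt_correct (V := C_R_CompleteNormedModule)), ex_CInt_continuous. Qed.

(** The integral lives in a module over the reals, so a complex factor has to be handled component
    by component. *)
Lemma is_CInt_mult (f : R -> C) (c l : C) (a b : R) :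
  is_CInt f a b l -> is_CInt (fun x => (c * f x)%C) a b (c * l)%C.
Proof.
  intros H.
  pose proof (is_RInt_fct_extend_fst (U := R_NormedModule) (V := R_NormedModule) f a b l H) as H1.
  pose proof (is_RInt_fct_extend_snd (U := R_NormedModule) (V := R_NormedModule) f a b l H) as H2.
  apply (is_RInt_fct_extend_pair (U := R_NormedModule) (V := R_NormedModule)); simpl.
  - apply (is_RInt_minus (V := R_NormedModule)); apply (is_RInt_scal (V := R_NormedModule)); auto.
  - apply (is_RInt_plus (V := R_NormedModule)); apply (is_RInt_scal (V := R_NormedModule)); auto.
Qed.

Lemma is_CInt_plus (f g : R -> C) (k l : C) (a b : R) :
  is_CInt f a b k -> is_CInt g a b l -> is_CInt (fun x => (f x + g x)%C) a b (k + l)%C.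
Proof. apply (is_RInt_plus (V := C_R_CompleteNormedModule)). Qed.

Lemma is_CInt_minus (f g : R -> C) (k l : C) (a b : R) :
  is_CInt f a b k -> is_CInt g a b l -> is_CInt (fun x => (f x - g x)%C) a b (k - l)%C.
Proof. apply (is_RInt_minus (V := C_R_CompleteNormedModule)). Qed.

Lemma CInt_unique (f : R -> C) (a b : R) (l : C) : is_CInt f a b l -> CInt f a b = l.
Proof. apply (is_RInt_unique (V := C_R_CompleteNormedModule)). Qed.

Lemma is_CInt_const (c : C) (a b : R) : is_CInt (fun _ => c) a b (RtoC (b - a) * c)%C.
Proof.
  replace (RtoC (b - a) * c)%C with (scal (V := C_R_CompleteNormedModule) (b - a) c).
  - apply (is_RInt_const (V := C_R_CompleteNormedModule)).
  - unfold scal; simpl; unfold prod_scal, scal; simpl; unfold mult; simpl.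
    unfold Cmult, RtoC; simpl. apply injective_projections; simpl; ring.
Qed.

Lemma CInt_Chasles (f : R -> C) (a b c : R) : a <= b <= c ->
  (forall x, a <= x <= c -> Ccontinuous f x) ->
  CInt f a c = (CInt f a b + CInt f b c)%C.
Proof.
  intros H Hf. symmetry. apply (RInt_Chasles (V := C_R_CompleteNormedModule)).
  - apply ex_CInt_continuous; [lra|]. intros; apply Hf; lra.
  - apply ex_CInt_continuous; [lra|]. intros; apply Hf; lra.
Qed.

Lemma Cmod_CInt_le (f : R -> C) (g : R -> R) (a b lg : R) (l : C) : a <= b ->
  (forall x, a <= x <= b -> Cmod (f x) <= g x) ->
  is_CInt f a b l -> is_RInt g a b lg -> Cmod l <= lg.
Proof.
  intros Hab H Hf Hg. rewrite <- Cmod_norm_R.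
  apply (norm_RInt_le (V := C_R_NormedModule) f g a b l lg Hab); auto.
  intros x Hx. rewrite Cmod_norm_R. auto.
Qed.

Lemma Cmod_CInt_le_const (f : R -> C) (a b m : R) : a <= b ->
  (forall x, a <= x <= b -> Ccontinuous f x) ->
  (forall x, a <= x <= b -> Cmod (f x) <= m) -> Cmod (CInt f a b) <= (b - a) * m.
Proof.
  intros Hab Hf H. apply (Cmod_CInt_le f (fun _ => m) a b); auto.
  - now apply CInt_correct.
  - apply (is_RInt_const (V := R_NormedModule)).
Qed.

(** The counterclockwise contour integral over the boundary of the rectangle: [dz] is [dx] on the
    horizontal sides and [Ci * dy] on the vertical ones. *)
Definition rect_int (G : C -> C) (a b c d : R) : C :=
  (CInt (fun x => G (x, c)) a b - CInt (fun x => G (x, d)) a b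
   + Ci * (CInt (fun y => G (b, y)) c d - CInt (fun y => G (a, y)) c d))%C.

Definition cont_rect (G : C -> C) (a b c d : R) : Prop :=
  forall x y, a <= x <= b -> c <= y <= d -> ccontinuous G (x, y).

Lemma continuous_horizontal (G : C -> C) (x c : R) :
  ccontinuous G (x, c) -> Ccontinuous (fun t => G (t, c)) x.
Proof.
  intros H. apply (continuous_comp (fun t : R => (t, c) : C_UniformSpace) G); auto.
  apply continuous_C_pair; simpl; [apply continuous_id|apply continuous_const].
Qed.

Lemma continuous_vertical (G : C -> C) (a y : R) :
  ccontinuous G (a, y) -> Ccontinuous (fun t => G (a, t)) y.
Proof.
  intros H. apply (continuous_comp (fun t : R => (a, t) : C_UniformSpace) G); auto.
  apply continuous_C_pair; simpl; [apply continuous_const|apply continuous_id].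
Qed.

Lemma rect_int_split_x (G : C -> C) (a m b c d : R) : a <= m <= b -> c <= d ->
  cont_rect G a b c d -> rect_int G a b c d = (rect_int G a m c d + rect_int G m b c d)%C.
Proof.
  intros Hm Hcd H. unfold rect_int.
  rewrite (CInt_Chasles (fun x => G (x, c)) a m b), (CInt_Chasles (fun x => G (x, d)) a m b); auto;
    try (intros; apply continuous_horizontal, H; lra).
  ring.
Qed.

Lemma rect_int_split_y (G : C -> C) (a b c m d : R) : a <= b -> c <= m <= d ->
  cont_rect G a b c d -> rect_int G a b c d = (rect_int G a b c m + rect_int G a b m d)%C.
Proof.
  intros Hab Hm H. unfold rect_int.
  rewrite (CInt_Chasles (fun y => G (a, y)) c m d), (CInt_Chasles (fun y => G (b, y)) c m d); auto;
    try (intros; apply continuous_vertical, H; lra).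
  ring.
Qed.

Lemma rect_int_split4 (G : C -> C) (a b c d w v : R) : 0 <= w -> 0 <= v ->
  b = a + 2 * w -> d = c + 2 * v -> cont_rect G a b c d ->
  rect_int G a b c d =
   (rect_int G a (a + w) c (c + v) + rect_int G (a + w) (a + w + w) c (c + v)
    + (rect_int G a (a + w) (c + v) (c + v + v) + rect_int G (a + w) (a + w + w) (c + v) (c + v + v)))%C.
Proof.
  intros Hw Hv -> -> H.
  replace (a + 2 * w) with (a + w + w) in * by ring. replace (c + 2 * v) with (c + v + v) in * by ring.
  rewrite (rect_int_split_y G a (a + w + w) c (c + v)) by (auto; lra).
  rewrite (rect_int_split_x G a (a + w) (a + w + w) c (c + v)), (rect_int_split_x G a (a + w) (a + w + w) (c + v)); auto; try lra.
  all: intros x y Hx Hy; apply H; lra.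
Qed.

(** This disposes of the first-order part in Goursat's argument. The four sides are integrated
    explicitly, with no appeal to primitives. *)
Lemma rect_int_affine (p l : C) (a b c d : R) :
  rect_int (fun z => (p + l * z)%C) a b c d = 0.
Proof.
  assert (Hq : forall u v, is_RInt (fun x : R => x) u v (v ^ 2 / 2 - u ^ 2 / 2)).
  { intros u v. apply (is_RInt_derive (V := R_CompleteNormedModule) (fun x => x ^ 2 / 2)).
    - intros x _. auto_derive; auto. field.
    - intros x _. apply continuous_id. }
  assert (Hh : forall u v e, CInt (fun x => (p + l * (x, e))%C) u v
     = (RtoC (v - u) * p + l * (v ^ 2 / 2 - u ^ 2 / 2, (v - u) * e)%R)%C).
  { intros u v e. apply CInt_unique, is_CInt_plus; [apply is_CInt_const|].
    apply is_CInt_mult. apply (is_RInt_fct_extend_pair (U := R_NormedModule) (V := R_NormedModule)); simpl; auto.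
    apply (is_RInt_const (V := R_NormedModule)). }
  assert (Hv : forall u v e, CInt (fun x => (p + l * (e, x))%C) u v
     = (RtoC (v - u) * p + l * ((v - u) * e, v ^ 2 / 2 - u ^ 2 / 2)%R)%C).
  { intros u v e. apply CInt_unique, is_CInt_plus; [apply is_CInt_const|].
    apply is_CInt_mult. apply (is_RInt_fct_extend_pair (U := R_NormedModule) (V := R_NormedModule)); simpl; auto.
    apply (is_RInt_const (V := R_NormedModule)). }
  unfold rect_int. rewrite !Hh, !Hv.
  destruct p as [p1 p2], l as [l1 l2]. unfold RtoC, Cmult, Cminus, Cplus, Copp, Ci; simpl.
  apply injective_projections; simpl; field.
Qed.

Lemma rect_int_plus (G H : C -> C) (a b c d : R) : a <= b -> c <= d ->
  cont_rect G a b c d -> cont_rect H a b c d ->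
  rect_int (fun z => (G z + H z)%C) a b c d = (rect_int G a b c d + rect_int H a b c d)%C.
Proof.
  intros Hab Hcd HG HH. unfold rect_int.
  assert (E : forall (f g : R -> C) u v, u <= v ->
    (forall x, u <= x <= v -> Ccontinuous f x) -> (forall x, u <= x <= v -> Ccontinuous g x) ->
    CInt (fun x => (f x + g x)%C) u v = (CInt f u v + CInt g u v)%C).
  { intros f g u v Huv Hf Hg. apply CInt_unique, is_CInt_plus; now apply CInt_correct. }
  rewrite !E; auto; try (intros; (apply continuous_vertical || apply continuous_horizontal); (apply HG || apply HH); lra).
  ring.
Qed.

Lemma rect_int_ext (G H : C -> C) (a b c d : R) : (forall z, G z = H z) ->
  rect_int G a b c d = rect_int H a b c d.
Proof.
  intros E. unfold rect_int.
  f_equal; [f_equal|f_equal; f_equal]; apply (RInt_ext (V := C_R_CompleteNormedModule)); auto.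
Qed.

Lemma Cmod_rect_int_le (G : C -> C) (a b c d m : R) : a <= b -> c <= d ->
  cont_rect G a b c d ->
  (forall x y, a <= x <= b -> c <= y <= d -> Cmod (G (x, y)) <= m) ->
  Cmod (rect_int G a b c d) <= 2 * (b - a + (d - c)) * m.
Proof.
  intros Hab Hcd HG Hm. unfold rect_int.
  eapply Rle_trans; [apply Cmod_triangle|]. rewrite Cmod_mult, Cmod_Ci.
  unfold Cminus.
  pose proof (Cmod_triangle (CInt (fun x => G (x, c)) a b) (- CInt (fun x => G (x, d)) a b)) as H1.
  pose proof (Cmod_triangle (CInt (fun x => G (b, x)) c d) (- CInt (fun x => G (a, x)) c d)) as H2.
  rewrite Cmod_opp in H1, H2.
  assert (Cmod (CInt (fun x => G (x, c)) a b) <= (b - a) * m).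
  { apply Cmod_CInt_le_const; auto; intros; [apply continuous_horizontal, HG|apply Hm]; lra. }
  assert (Cmod (CInt (fun x => G (x, d)) a b) <= (b - a) * m).
  { apply Cmod_CInt_le_const; auto; intros; [apply continuous_horizontal, HG|apply Hm]; lra. }
  assert (Cmod (CInt (fun x => G (a, x)) c d) <= (d - c) * m).
  { apply Cmod_CInt_le_const; auto; intros; [apply continuous_vertical, HG|apply Hm]; lra. }
  assert (Cmod (CInt (fun x => G (b, x)) c d) <= (d - c) * m).
  { apply Cmod_CInt_le_const; auto; intros; [apply continuous_vertical, HG|apply Hm]; lra. }
  lra.
Qed.

(** The intervals [[u n, u n + s n]] are nested: their left ends increase and stay below every right
    end, so the limit of the left ends lies in all of them. *)
Lemma nested_limit (u s : nat -> R) : (forall n, 0 <= s n) ->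
  (forall n, u n <= u (S n)) -> (forall n, u (S n) + s (S n) <= u n + s n) ->
  exists l, forall n, u n <= l <= u n + s n.
Proof.
  intros Hs Hu Hd.
  assert (Hinc : forall n k, u n <= u (n + k)%nat).
  { intros n. induction k; [rewrite Nat.add_0_r; lra|].
    rewrite Nat.add_succ_r. specialize (Hu (n + k)%nat). lra. }
  assert (Hdec : forall n k, u (n + k)%nat + s (n + k)%nat <= u n + s n).
  { intros n. induction k; [rewrite Nat.add_0_r; lra|].
    rewrite Nat.add_succ_r. specialize (Hd (n + k)%nat). lra. }
  assert (Hb : forall n k, u k <= u n + s n).
  { intros n k. destruct (Nat.le_ge_cases n k) as [Hl|Hl].
    - replace k with (n + (k - n))%nat by lia.
      specialize (Hdec n (k - n)%nat). specialize (Hs (n + (k - n))%nat). lra.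
    - specialize (Hinc k (n - k)%nat). replace (k + (n - k))%nat with n in Hinc by lia.
      specialize (Hs n). lra. }
  destruct (ex_finite_lim_seq_incr u (u 0%nat + s 0%nat) Hu (Hb 0%nat)) as [l Hl].
  exists l. intros n. split.
  - exact (is_lim_seq_incr_compare u l Hl Hu n).
  - apply (is_lim_seq_le u (fun _ => u n + s n) l (u n + s n) (Hb n) Hl). apply is_lim_seq_const.
Qed.

Section Goursat.
Variables (G : C -> C) (A B D E : R).
Hypotheses (HAB : A <= B) (HDE : D <= E).
Hypothesis HG : forall x y, A <= x <= B -> D <= y <= E -> cdiff G (x, y).

Let W n := (B - A) / 2 ^ n.
Let V n := (E - D) / 2 ^ n.
Let J (x y w v : R) := Cmod (rect_int G x (x + w) y (y + v)).

(* Lower left corner of a quadrant that carries at least a quarter of the integral. *)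
Let choose n (p : R * R) : R * R :=
  let (x, y) := p in let w := W (S n) in let v := V (S n) in
  let t := J x y (W n) (V n) / 4 in
  if Rle_dec t (J x y w v) then (x, y)
  else if Rle_dec t (J (x + w) y w v) then (x + w, y)
  else if Rle_dec t (J x (y + v) w v) then (x, y + v) else (x + w, y + v).

Fixpoint corner n := match n with O => (A, D) | S n => choose n (corner n) end.

Let W_S n : W n = 2 * W (S n).
Proof. unfold W; simpl. field. apply pow_nonzero. lra. Qed.
Let V_S n : V n = 2 * V (S n).
Proof. unfold V; simpl. field. apply pow_nonzero. lra. Qed.
Let W_pos n : 0 <= W n.
Proof. apply Rmult_le_pos; [lra|]. apply Rlt_le, Rinv_0_lt_compat, pow_lt. lra. Qed.
Let V_pos n : 0 <= V n.
Proof. apply Rmult_le_pos; [lra|]. apply Rlt_le, Rinv_0_lt_compat, pow_lt. lra. Qed.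

Let inside n := let (x, y) := corner n in
  A <= x /\ x + W n <= B /\ D <= y /\ y + V n <= E.

Lemma corner_inside n : inside n.
Proof.
  unfold inside. induction n as [|n IH].
  - simpl. unfold W, V; simpl. lra.
  - simpl. destruct (corner n) as [x y].
    pose proof (W_S n); pose proof (V_S n); pose proof (W_pos (S n)); pose proof (V_pos (S n)).
    unfold choose. repeat destruct Rle_dec; lra.
Qed.

Lemma corner_large n : let (x, y) := corner n in
  J A D (W 0) (V 0) / 4 ^ n <= J x y (W n) (V n).
Proof.
  induction n as [|n IH].
  - simpl. lra.
  - pose proof (corner_inside n) as Hi. unfold inside in Hi. simpl. destruct (corner n) as [x y].
    pose proof (W_S n); pose proof (V_S n); pose proof (W_pos (S n)); pose proof (V_pos (S n)).
    assert (HJ : J A D (W 0) (V 0) / (4 * 4 ^ n) <= J x y (W n) (V n) / 4).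
    { replace (J A D (W 0) (V 0) / (4 * 4 ^ n)) with (J A D (W 0) (V 0) / 4 ^ n / 4)
        by (field; apply pow_nonzero; lra). lra. }
    unfold choose. repeat destruct Rle_dec; try (eapply Rle_trans; [exact HJ|assumption]).
    (* Only the fourth quadrant is left: the other three carry less than a quarter each, so by the
       triangle inequality it carries at least a quarter. *)
    apply Rle_trans with (1 := HJ).
    assert (HJ4 : J x y (W n) (V n) <= J x y (W (S n)) (V (S n)) + J (x + W (S n)) y (W (S n)) (V (S n))
      + (J x (y + V (S n)) (W (S n)) (V (S n)) + J (x + W (S n)) (y + V (S n)) (W (S n)) (V (S n)))).
    { unfold J at 1. rewrite (rect_int_split4 G x (x + W n) y (y + V n) (W (S n)) (V (S n))); auto; try lra.
      - eapply Rle_trans; [apply Cmod_triangle|]. apply Rplus_le_compat; apply Cmod_triangle.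
      - intros t s Ht Hs. apply cdiff_continuous, HG; lra. }
    lra.
Qed.

(** On the [n]-th rectangle around the limit point, [G] is affine up to [eps] times the size, and
    the affine part integrates to zero. The perimeter and the remainder each scale like [2 ^ - n],
    which exactly offsets the factor [4 ^ n] lost in the subdivision. *)
Lemma goursat : rect_int G A B D E = 0.
Proof.
  destruct (nested_limit (fun n => fst (corner n)) W) as [lx Hx]; auto.
  { intros n. simpl. destruct (corner n) as [x y]. pose proof (W_pos (S n)).
    unfold choose. repeat destruct Rle_dec; simpl; lra. }
  { intros n. simpl. destruct (corner n) as [x y]. pose proof (W_pos (S n)). pose proof (W_S n).
    unfold choose. repeat destruct Rle_dec; simpl; lra. }
  destruct (nested_limit (fun n => snd (corner n)) V) as [ly Hy]; auto.
  { intros n. simpl. destruct (corner n) as [x y]. pose proof (V_pos (S n)).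
    unfold choose. repeat destruct Rle_dec; simpl; lra. }
  { intros n. simpl. destruct (corner n) as [x y]. pose proof (V_pos (S n)). pose proof (V_S n).
    unfold choose. repeat destruct Rle_dec; simpl; lra. }
  assert (Hin : A <= lx <= B /\ D <= ly <= E).
  { specialize (Hx 0%nat). specialize (Hy 0%nat). unfold W, V in Hx, Hy; simpl in Hx, Hy. lra. }
  destruct (cdiff_eps G (lx, ly)) as [l Hl]; [apply HG; lra|].
  set (S := B - A + (E - D)).
  assert (HS : 0 <= S) by (unfold S; lra).
  assert (Hbound : forall eps, 0 < eps -> J A D (W 0) (V 0) <= 2 * S ^ 2 * eps).
  { intros eps He. destruct (Hl eps He) as [del [Hd Hdel]].
    assert (exists n, S / 2 ^ n < del) as [n Hn].
    { destruct (Pow_x_infinity 2 ltac:(rewrite Rabs_pos_eq; lra) (S / del + 1)) as [n Hn].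
      exists n. specialize (Hn n (le_n n)).
      assert (H2 : 0 < 2 ^ n) by (apply pow_lt; lra).
      rewrite Rabs_pos_eq in Hn by lra.
      apply Rmult_lt_reg_r with (2 ^ n); auto. unfold Rdiv. rewrite Rmult_assoc, Rinv_l by lra.
      assert (S / del * del = S) by (field; lra). nra. }
    pose proof (corner_large n) as Hlarge. pose proof (corner_inside n) as Hi. unfold inside in Hi.
    specialize (Hx n). specialize (Hy n). destruct (corner n) as [x y]. simpl in Hx, Hy.
    assert (HSn : W n + V n = S / 2 ^ n) by (unfold W, V, S, Rdiv; ring).
    set (z0 := (lx, ly) : C) in *.
    set (Rem := fun z => (G z - G z0 - l * (z - z0))%C).
    set (Aff := fun z => (G z0 - l * z0 + l * z)%C).
    pose proof (W_pos n); pose proof (V_pos n).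
    assert (HcA : cont_rect Aff x (x + W n) y (y + V n)).
    { intros s t _ _. apply continuous_Cplus; [apply continuous_const|].
      apply continuous_Cmult; [apply continuous_const|apply continuous_id]. }
    assert (HcG : cont_rect G x (x + W n) y (y + V n)).
    { intros s t Hs Ht. apply cdiff_continuous, HG; lra. }
    assert (HcR : cont_rect Rem x (x + W n) y (y + V n)).
    { intros s t Hs Ht. apply continuous_Cminus; [apply continuous_Cminus|].
      - now apply HcG. - apply continuous_const.
      - apply continuous_Cmult; [apply continuous_const|].
        apply continuous_Cminus; [apply continuous_id|apply continuous_const]. }
    assert (HJ : J x y (W n) (V n) <= 2 * (S / 2 ^ n) * (eps * (S / 2 ^ n))).
    { unfold J. rewrite (rect_int_ext G (fun z => (Rem z + Aff z)%C)) by (intros; unfold Rem, Aff; ring).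
      rewrite rect_int_plus by (auto; lra). unfold Aff. rewrite rect_int_affine, Cplus_0_r.
      eapply Rle_trans; [apply (Cmod_rect_int_le _ _ _ _ _ (eps * (S / 2 ^ n))); auto; try lra|].
      - intros s t Hs Ht.
        assert (Hst : Cmod ((s, t) - z0) <= S / 2 ^ n).
        { eapply Rle_trans; [apply Cmod_le_abs|]. simpl. rewrite <- HSn.
          apply Rplus_le_compat; apply Rabs_le; lra. }
        apply Rle_trans with (eps * Cmod ((s, t) - z0)); [apply Hdel; lra|nra].
      - apply Req_le. rewrite <- HSn. ring. }
    assert (H4 : 4 ^ n = 2 ^ n * 2 ^ n) by (rewrite <- Rpow_mult_distr; f_equal; ring).
    assert (H2 : 0 < 2 ^ n) by (apply pow_lt; lra).
    rewrite H4 in Hlarge.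
    assert (Hf : J A D (W 0) (V 0) / (2 ^ n * 2 ^ n) * (2 ^ n * 2 ^ n)
       <= 2 * (S / 2 ^ n) * (eps * (S / 2 ^ n)) * (2 ^ n * 2 ^ n)).
    { apply Rmult_le_compat_r; [nra|]. lra. }
    replace (J A D (W 0) (V 0) / (2 ^ n * 2 ^ n) * (2 ^ n * 2 ^ n)) with (J A D (W 0) (V 0)) in Hf by (field; lra).
    replace (2 * (S / 2 ^ n) * (eps * (S / 2 ^ n)) * (2 ^ n * 2 ^ n)) with (2 * S ^ 2 * eps) in Hf by (field; lra).
    exact Hf. }
  assert (HJ0 : J A D (W 0) (V 0) = Cmod (rect_int G A B D E)).
  { unfold J, W, V; simpl. f_equal. f_equal; field. }
  apply Cmod_eq_0. apply Rle_antisym; [|apply Cmod_ge_0]. rewrite <- HJ0.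
  apply le_epsilon. intros eps He.
  (* The added 1 keeps the divisor positive for a degenerate rectangle, where [S = 0]. *)
  assert (Hk : 0 < 2 * S ^ 2 + 1) by nra.
  apply Rle_trans with (1 := Hbound (eps / (2 * S ^ 2 + 1)) ltac:(apply Rdiv_lt_0_compat; auto)).
  rewrite Rplus_0_l. apply Rmult_le_reg_r with (2 * S ^ 2 + 1); auto.
  replace (2 * S ^ 2 * (eps / (2 * S ^ 2 + 1)) * (2 * S ^ 2 + 1)) with (2 * S ^ 2 * eps) by (field; lra).
  nra.
Qed.

End Goursat.

(** * Truncated geometric kernels *)

(** The sum [q + q ^ 2 + ... + q ^ M] in Horner form. Bounds uniform in [M] then reduce to finding a
    set that contains 0 and is stable under [t -> q * (1 + t)]. *)
Fixpoint geo (q : C) (M : nat) : C :=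
  match M with O => 0 | S m => (q * (1 + geo q m))%C end.

Lemma geo_closed (q : C) (M : nat) : (geo q M * (1 - q))%C = (q - q ^ S M)%C.
Proof.
  induction M as [|M IH]; [simpl; ring|].
  change (geo q (S M)) with (q * (1 + geo q M))%C.
  replace (q * (1 + geo q M) * (1 - q))%C with (q * ((1 - q) + geo q M * (1 - q)))%C by ring.
  rewrite IH. simpl. ring.
Qed.

Lemma geo_succ (q : C) (M : nat) : geo q (S M) = (geo q M + q ^ S M)%C.
Proof.
  induction M as [|M IH]; [simpl; ring|].
  change (geo q (S (S M))) with (q * (1 + geo q (S M)))%C. rewrite IH at 1.
  change (geo q (S M)) with (q * (1 + geo q M))%C. simpl. ring.
Qed.

(** [Q / (1 - Q)] is the fixed point of [t -> Q * (1 + t)], so the induction closes with a bound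
    independent of [M]. *)
Lemma Cmod_geo_le (q : C) (Q : R) (M : nat) : Cmod q <= Q -> Q < 1 ->
  Cmod (geo q M) <= Q / (1 - Q).
Proof.
  intros Hq HQ. pose proof (Cmod_ge_0 q) as H0.
  assert (HQ' : Q / (1 - Q) = Q * (1 + Q / (1 - Q))) by (field; lra).
  induction M as [|M IH].
  - simpl. rewrite Cmod_0. apply Rmult_le_pos; [lra|]. apply Rlt_le, Rinv_0_lt_compat. lra.
  - simpl. rewrite Cmod_mult. rewrite HQ'. apply Rmult_le_compat; auto using Cmod_ge_0.
    eapply Rle_trans; [apply Cmod_triangle|]. rewrite Cmod_1. lra.
Qed.

(** The interval [[-1, 0]] is stable under [g -> - r * (1 + g)]. The case [r = 1] matters: it occurs
    where a vertical side meets the real axis, and there the geometric bound blows up. *)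
Lemma Cmod_geo_neg_le (r : R) (M : nat) : 0 <= r <= 1 -> Cmod (geo (RtoC (- r)) M) <= 1.
Proof.
  intros Hr.
  assert (H : exists g, -1 <= g <= 0 /\ geo (RtoC (- r)) M = RtoC g).
  { induction M as [|M [g [Hg E]]].
    - exists 0. split; [lra|reflexivity].
    - exists (- r * (1 + g)). split; [nra|]. simpl. rewrite E.
      now rewrite <- RtoC_plus, <- RtoC_mult. }
  destruct H as [g [Hg ->]]. rewrite Cmod_R. apply Rabs_le. lra.
Qed.

Lemma continuous_geo {U : UniformSpace} (q : U -> C) (x : U) (M : nat) :
  continuous (U := C_UniformSpace) q x ->
  continuous (U := C_UniformSpace) (fun y => geo (q y) M) x.
Proof.
  intros Hq. induction M as [|M IH]; simpl; [apply continuous_const|].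
  apply continuous_Cmult; auto. apply continuous_Cplus; auto. apply continuous_const.
Qed.

Lemma cdiff_geo (q : C -> C) (z : C) (M : nat) :
  cdiff q z -> cdiff (fun w => geo (q w) M) z.
Proof.
  intros Hq. induction M as [|M IH]; simpl; [apply cdiff_const|].
  apply cdiff_mult; auto. apply cdiff_plus; auto. apply cdiff_const.
Qed.

(** * Characters of the circle *)

Definition cis (t : R) : C := (cos t, sin t).

Lemma cis_plus (s t : R) : cis (s + t) = (cis s * cis t)%C.
Proof. unfold cis, Cmult; simpl. rewrite cos_plus, sin_plus. f_equal. ring. Qed.

Lemma cis_0 : cis 0 = 1.
Proof. unfold cis. now rewrite cos_0, sin_0. Qed.

Lemma cis_opp (t : R) : (cis t * cis (- t))%C = 1.
Proof. rewrite <- cis_plus, Rplus_opp_r. apply cis_0. Qed.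

Lemma cis_pow (t : R) (n : nat) : (cis t ^ n)%C = cis (INR n * t).
Proof.
  induction n as [|n IH]; [simpl; now rewrite Rmult_0_l, cis_0|].
  change (cis t ^ S n)%C with (cis t * cis t ^ n)%C. rewrite IH, <- cis_plus. f_equal.
  rewrite S_INR. ring.
Qed.

Lemma Cmod_cis (t : R) : Cmod (cis t) = 1.
Proof.
  unfold Cmod, cis; simpl. transitivity (sqrt 1); [|apply sqrt_1]. f_equal.
  pose proof (sin2_cos2 t) as H. unfold Rsqr in H. lra.
Qed.

Lemma Cexp_cis (x y : R) : Cexp (x, y) = (RtoC (exp x) * cis y)%C.
Proof. unfold Cexp, cis, RtoC, Cmult; simpl. f_equal; ring. Qed.

Lemma cis_Cexp (t : R) : cis t = Cexp (0, t).
Proof. rewrite Cexp_cis, exp_0. ring. Qed.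

Lemma continuous_cis (f : R -> R) (x : R) : continuous f x -> Ccontinuous (fun t => cis (f t)) x.
Proof.
  intros Hf. apply continuous_C_pair; simpl.
  - apply (continuous_comp f cos); auto. apply continuous_cos.
  - apply (continuous_comp f sin); auto. apply continuous_sin.
Qed.

Lemma continuous_scale (l x : R) : continuous (fun t => l * t) x.
Proof. apply (continuous_scal_r l (fun t : R => t)), continuous_id. Qed.

Lemma sin_mult_PI (n : nat) : sin (INR n * PI) = 0.
Proof. apply sin_eq_0_1. exists (Z.of_nat n). now rewrite INR_IZR_INZ. Qed.

Lemma cis_2PI_Z (k : Z) : cis (IZR k * (2 * PI)) = 1.
Proof.
  assert (H : forall n, cis (INR n * (2 * PI)) = 1).
  { intros n. rewrite <- cis_pow. unfold cis. rewrite cos_2PI, sin_2PI.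
    induction n; [reflexivity|]. change ((1, 0)%R : C) with (RtoC 1) in *. simpl. rewrite IHn. ring. }
  destruct (Z_le_gt_dec 0 k) as [Hk|Hk].
  - rewrite <- (Z2Nat.id k) by lia. rewrite <- INR_IZR_INZ. apply H.
  - pose proof (cis_opp (IZR k * (2 * PI))) as E.
    replace (- (IZR k * (2 * PI))) with (INR (Z.to_nat (- k)) * (2 * PI)) in E.
    + rewrite H in E. rewrite <- E. ring.
    + rewrite INR_IZR_INZ, Z2Nat.id by lia. rewrite opp_IZR. ring.
Qed.

Lemma is_CInt_cis_pow (p : R) (n : nat) : 0 < p ->
  is_CInt (fun x : R => (cis (PI / p * x) ^ S n)%C) (- p) p (RtoC 0).
Proof.
  intros Hp. pose proof PI_RGT_0.
  set (l := INR (S n) * (PI / p)).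
  assert (Hl : 0 < l).
  { apply Rmult_lt_0_compat; [apply lt_0_INR; lia|]. now apply Rdiv_lt_0_compat. }
  apply (is_RInt_ext (V := C_R_CompleteNormedModule) (fun x : R => cis (l * x))).
  { intros x _. rewrite cis_pow. f_equal. unfold l. ring. }
  assert (Hlp : l * p = INR (S n) * PI) by (unfold l; field; lra).
  apply (is_RInt_fct_extend_pair (U := R_NormedModule) (V := R_NormedModule)
     (fun x : R => cis (l * x)) (- p) p 0 0); simpl.
  - replace 0 with (minus (G := R_AbelianGroup) (sin (l * p) / l) (sin (l * - p) / l)).
    + apply (is_RInt_derive (V := R_CompleteNormedModule) (fun x : R => sin (l * x) / l)).
      * intros x _. auto_derive; auto. field. lra.
      * intros x _. apply (continuous_comp (fun t => l * t) cos); [apply continuous_scale|apply continuous_cos].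
    + unfold minus, plus, opp; simpl. replace (l * - p) with (- (l * p)) by ring.
      rewrite sin_neg, Hlp, sin_mult_PI. field. lra.
  - replace 0 with (minus (G := R_AbelianGroup) (- cos (l * p) / l) (- cos (l * - p) / l)).
    + apply (is_RInt_derive (V := R_CompleteNormedModule) (fun x : R => - cos (l * x) / l)).
      * intros x _. auto_derive; auto. field. lra.
      * intros x _. apply (continuous_comp (fun t => l * t) sin); [apply continuous_scale|apply continuous_sin].
    + unfold minus, plus, opp; simpl. replace (l * - p) with (- (l * p)) by ring.
      rewrite cos_neg. ring.
Qed.

(** * The Riemann-Lebesgue lemma *)

Lemma CInt_shift (f : R -> C) (v a b : R) : (forall x : R, Ccontinuous f x) ->
  CInt (fun x : R => f (x + v)) a b = CInt f (a + v) (b + v).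
Proof.
  intros Hf.
  assert (He : ex_CInt f (1 * a + v) (1 * b + v)).
  { apply (ex_RInt_continuous (V := C_R_CompleteNormedModule)). intros; apply Hf. }
  pose proof (RInt_comp_lin (V := C_R_CompleteNormedModule) f 1 v a b He) as H.
  rewrite !Rmult_1_l in H. rewrite <- H.
  apply (RInt_ext (V := C_R_CompleteNormedModule)). intros x _.
  rewrite Rmult_1_l. symmetry. apply (scal_one (V := C_R_NormedModule)).
Qed.

Lemma CInt_reflect (f : R -> C) (a : R) : 0 <= a -> (forall x : R, Ccontinuous f x) ->
  CInt (fun x : R => f (- x)) (- a) a = CInt f (- a) a.
Proof.
  intros Ha Hf.
  assert (He : forall u v, ex_CInt f u v).
  { intros. apply (ex_RInt_continuous (V := C_R_CompleteNormedModule)). intros; apply Hf. }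
  pose proof (RInt_correct (V := C_R_CompleteNormedModule) _ _ _ (He a (- a))) as H.
  replace a with (- - a) in H at 1 by ring.
  pose proof (is_RInt_comp_opp (V := C_R_CompleteNormedModule) f (- a) a _ H) as H1.
  apply CInt_unique.
  rewrite <- (opp_opp (G := C_R_CompleteNormedModule) (CInt f (- a) a)).
  apply (is_RInt_ext (V := C_R_CompleteNormedModule) (fun x : R => opp (opp (f (- x))))).
  { intros x _. apply (opp_opp (G := C_R_CompleteNormedModule)). }
  apply (is_RInt_opp (V := C_R_CompleteNormedModule)).
  rewrite (opp_RInt_swap (V := C_R_CompleteNormedModule)); auto.
Qed.

Lemma Cmod_CInt_le_abs (f : R -> C) (a b m : R) : (forall x : R, Ccontinuous f x) ->
  (forall x, Rmin a b <= x <= Rmax a b -> Cmod (f x) <= m) ->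
  Cmod (CInt f a b) <= Rabs (b - a) * m.
Proof.
  intros Hf H. destruct (Rle_dec a b) as [Hab|Hab].
  - rewrite Rmin_left, Rmax_right in H by auto. rewrite Rabs_pos_eq by lra.
    apply Cmod_CInt_le_const; auto.
  - rewrite Rmin_right, Rmax_left in H by lra. rewrite Rabs_left by lra.
    rewrite <- (opp_RInt_swap (V := C_R_CompleteNormedModule)) by (apply ex_CInt_continuous; auto; lra).
    replace (- (b - a)) with (a - b) by ring.
    change (Cmod (- CInt f b a) <= (a - b) * m). rewrite Cmod_opp.
    apply Cmod_CInt_le_const; auto. lra.
Qed.

(* Shifting [x] by [PI / l] changes the sign of [cis (l * x)], so twice the integral is that of
   [T x - T (x + PI / l)] up to two short boundary pieces. *)
Lemma riemann_lebesgue (T : R -> C) (a b eps : R) : a < b -> (forall x : R, Ccontinuous T x) ->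
  0 < eps -> exists Lam, 0 < Lam /\ forall l, Lam <= Rabs l ->
    Cmod (CInt (fun x : R => (T x * cis (l * x))%C) a b) <= eps.
Proof.
  intros Hab HT He. pose proof PI_RGT_0 as HPI.
  assert (HTm : forall x : R, continuous (fun x : R => Cmod (T x)) x) by (intros; now apply continuous_Cmod).
  (* The interval is enlarged because the points [x + d] and the boundary pieces leave [[a, b]];
     [Rabs d < 1] will keep them inside. *)
  destruct (continuity_ab_maj (fun x : R => Cmod (T x)) (a - 2) (b + 2)) as [xM [HM _]].
  { lra. } { intros; apply continuity_pt_filterlim, HTm. }
  set (K := Cmod (T xM)) in *. assert (HK : 0 <= K) by apply Cmod_ge_0.
  assert (He1 : 0 < eps / (b - a)) by (apply Rdiv_lt_0_compat; lra).
  destruct (unifcont_normed_1d (K := R_AbsRing) (V := C_R_NormedModule) T (a - 2) (b + 2)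
     (fun x _ => HT x) (mkposreal _ He1)) as [del Hdel].
  (* Three demands on the shift: uniform continuity of [T], staying in the enlarged interval, and
     boundary pieces of length [Rabs d] costing at most [eps / 2] each. *)
  pose (del' := Rmin (Rmin del 1) (eps / (2 * (K + 1)))).
  assert (Hd : 0 < del').
  { apply Rmin_pos; [apply Rmin_pos; [apply cond_pos|lra]|apply Rdiv_lt_0_compat; lra]. }
  exists (2 * PI / del'). split; [apply Rdiv_lt_0_compat; lra|].
  intros l Hl.
  assert (Hl0 : 0 < Rabs l).
  { eapply Rlt_le_trans; [|exact Hl]. apply Rdiv_lt_0_compat; lra. }
  assert (Hln : l <> 0) by (intros ->; rewrite Rabs_R0 in Hl0; lra).
  set (d := PI / l).
  assert (Hdd : Rabs d < del').
  { unfold d. unfold Rdiv. rewrite Rabs_mult, Rabs_inv, (Rabs_pos_eq PI) by lra.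
    apply Rmult_lt_reg_r with (Rabs l); auto. rewrite Rmult_assoc, Rinv_l by lra.
    apply Rmult_le_compat_r with (r := del') in Hl; [|lra].
    unfold Rdiv in Hl. rewrite Rmult_assoc, Rinv_l in Hl by lra. lra. }
  assert (Hd1 : Rabs d < del) by (eapply Rlt_le_trans; [exact Hdd|]; eapply Rle_trans; [apply Rmin_l|apply Rmin_l]).
  assert (Hd2 : Rabs d < 1) by (eapply Rlt_le_trans; [exact Hdd|]; eapply Rle_trans; [apply Rmin_l|apply Rmin_r]).
  assert (Hd3 : Rabs d < eps / (2 * (K + 1))) by (eapply Rlt_le_trans; [exact Hdd|]; apply Rmin_r).
  assert (Hd4 : Rabs d * K <= eps / 2).
  { apply Rle_trans with (eps / (2 * (K + 1)) * K); [apply Rmult_le_compat_r; lra|].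
    apply Rmult_le_reg_r with (2 * (K + 1)); [lra|].
    replace (eps / (2 * (K + 1)) * K * (2 * (K + 1))) with (eps * K) by (field; lra). nra. }
  assert (Hdb : - 1 <= d <= 1) by (apply Rabs_le_between; lra).
  set (e := fun x : R => cis (l * x)).
  assert (Hec : forall x : R, Ccontinuous e x) by (intros; apply continuous_cis, continuous_scale).
  assert (Hed : forall x : R, e (x + d) = (- e x)%C).
  { intros x. unfold e. replace (l * (x + d)) with (l * x + PI) by (unfold d; field; auto).
    rewrite cis_plus. unfold cis at 2. rewrite cos_PI, sin_PI.
    replace ((-1, 0)%R : C) with (RtoC (-1)) by reflexivity. ring. }
  assert (HTd : forall x : R, Ccontinuous (fun x : R => T (x + d)) x).
  { intros x. apply (continuous_comp (fun t => t + d) T); auto.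
    apply (continuous_plus (V := R_NormedModule)); [apply continuous_id|apply continuous_const]. }
  set (g := fun x : R => (T (x + d)%R * e x)%C).
  assert (Hgc : forall x : R, Ccontinuous g x) by (intros; now apply continuous_Cmult).
  set (f := fun x : R => (T x * e x)%C).
  assert (Hfc : forall x : R, Ccontinuous f x) by (intros; now apply continuous_Cmult).
  assert (Eshift : CInt f a b = (- CInt g (a - d) (b - d))%C).
  { replace (CInt f a b) with (CInt f (a - d + d) (b - d + d)) by (f_equal; ring).
    rewrite <- CInt_shift by auto. symmetry in Hed.
    change (- CInt g (a - d) (b - d))%C with (opp (G := C_R_CompleteNormedModule) (CInt g (a - d) (b - d))).
    rewrite <- (RInt_opp (V := C_R_CompleteNormedModule)).
    - apply (RInt_ext (V := C_R_CompleteNormedModule)). intros x _.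
      unfold f, g. rewrite <- Hed. change (T (x + d)%R * - e x = - (T (x + d)%R * e x))%C. ring.
    - apply (ex_RInt_continuous (V := C_R_CompleteNormedModule)). auto. }
  assert (Hch : forall u v w, CInt g u w = (CInt g u v + CInt g v w)%C).
  { intros u v w. symmetry. apply (RInt_Chasles (V := C_R_CompleteNormedModule));
    apply (ex_RInt_continuous (V := C_R_CompleteNormedModule)); auto. }
  assert (E2 : (2 * CInt f a b)%C = (CInt (fun x : R => (f x - g x)%C) a b - CInt g (a - d) a + CInt g (b - d) b)%C).
  { rewrite (CInt_unique (fun x : R => (f x - g x)%C) a b (CInt f a b - CInt g a b)).
    2:{ apply is_CInt_minus; apply CInt_correct; auto; lra. }
    replace (2 * CInt f a b)%C with (CInt f a b + CInt f a b)%C by ring. rewrite Eshift at 2.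
    rewrite (Hch (a - d) a (b - d)), (Hch a b (b - d)).
    replace (CInt g b (b - d)) with (- CInt g (b - d) b)%C; [ring|].
    apply (opp_RInt_swap (V := C_R_CompleteNormedModule)).
    apply (ex_RInt_continuous (V := C_R_CompleteNormedModule)); auto. }
  assert (Hce : forall x : R, Cmod (e x) = 1) by (intros; apply Cmod_cis).
  assert (B1 : Cmod (CInt (fun x : R => (f x - g x)%C) a b) <= eps).
  { eapply Rle_trans; [apply (Cmod_CInt_le_const _ _ _ (eps / (b - a)))|].
    - lra. - intros; now apply continuous_Cminus.
    - intros x Hx. unfold f, g.
      replace (T x * e x - T (x + d)%R * e x)%C with ((T x - T (x + d)%R) * e x)%C by ring.
      rewrite Cmod_mult, Hce, Rmult_1_r.
      assert (Hb : ball x del (x + d)).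
      { unfold ball; simpl; unfold AbsRing_ball, minus, plus, opp, abs; simpl.
        replace (x + d + - x) with d by ring. exact Hd1. }
      pose proof (Hdel x (x + d) ltac:(lra) ltac:(lra) Hb) as H. simpl in H.
      unfold ball_norm in H. rewrite Cmod_norm_R in H.
      change (Cmod (T (x + d) - T x) < eps / (b - a)) in H. rewrite Cmod_sub_comm. lra.
    - apply Req_le. field. lra. }
  assert (B2 : forall u, a <= u <= b -> Cmod (CInt g (u - d) u) <= eps / 2).
  { intros u Hu. eapply Rle_trans; [apply (Cmod_CInt_le_abs _ _ _ K); auto|].
    - intros x Hx. unfold g. rewrite Cmod_mult, Hce, Rmult_1_r. apply HM.
      assert (u - 1 <= x <= u + 1).
      { destruct (Rle_dec (u - d) u);
        [rewrite Rmin_left, Rmax_right in Hx by lra|rewrite Rmin_right, Rmax_left in Hx by lra]; lra. }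
      lra.
    - replace (u - (u - d)) with d by ring. exact Hd4. }
  assert (H2 : Cmod (2 * CInt f a b) <= 2 * eps).
  { rewrite E2. unfold Cminus. eapply Rle_trans; [apply Cmod_triangle|].
    pose proof (Cmod_triangle (CInt (fun x : R => (f x + - g x)%C) a b) (- CInt g (a - d) a)) as H3.
    rewrite Cmod_opp in H3. unfold Cminus in B1.
    pose proof (B2 a ltac:(lra)). pose proof (B2 b ltac:(lra)). lra. }
  rewrite Cmod_mult, Cmod_R, Rabs_pos_eq in H2 by lra. change (Cmod (CInt f a b) <= eps). lra.
Qed.

Lemma exp_le_compat (x y : R) : x <= y -> exp x <= exp y.
Proof. intros [H| ->]; [now apply Rlt_le, exp_increasing|lra]. Qed.

(** * The Dirichlet kernel samples a function on one period *)

(** The positive and the negative frequencies are kept as separate sums because they are later moved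
    into opposite half planes. *)
Definition dirichlet (om : R) (M : nat) (x : R) : C :=
  (1 + geo (cis (om * x)) M + geo (cis (- (om * x))) M)%C.

Lemma continuous_dirichlet (om : R) (M : nat) (x : R) : Ccontinuous (dirichlet om M) x.
Proof.
  unfold dirichlet. apply continuous_Cplus; [apply continuous_Cplus; [apply continuous_const|]|];
    apply continuous_geo, continuous_cis.
  - apply continuous_scale.
  - apply (continuous_opp (V := R_NormedModule)), continuous_scale.
Qed.

(** Both geometric sums telescope against [1 - q], leaving two pure frequencies of order [M], the
    form to which the Riemann-Lebesgue lemma applies. *)
Lemma dirichlet_closed (om : R) (M : nat) (x : R) :
  ((1 - cis (om * x)) * dirichlet om M x)%C = (cis (- (om * x)) ^ M - cis (om * x) ^ S M)%C.
Proof.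
  unfold dirichlet. set (q := cis (om * x)). set (r := cis (- (om * x))).
  assert (Hqr : (q * r)%C = 1) by apply cis_opp.
  pose proof (geo_closed q M) as H1. pose proof (geo_closed r M) as H2.
  replace ((1 - q) * (1 + geo q M + geo r M))%C
    with (1 - q + geo q M * (1 - q) + (geo r M - q * geo r M))%C by ring.
  assert (H3 : (geo r M - q * geo r M)%C = (- q * (geo r M * (1 - r)))%C).
  { replace (- q * (geo r M * (1 - r)))%C with (geo r M * (q * r) - q * geo r M)%C by ring.
    rewrite Hqr. ring. }
  rewrite H3, H1, H2. change (r ^ S M)%C with (r * r ^ M)%C.
  replace (- q * (r - r * r ^ M))%C with ((q * r) * (r ^ M - 1))%C by ring. rewrite Hqr. ring.
Qed.

(** Every nonconstant frequency integrates to zero over a period. The mass that remains becomes the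
    weight [h] of a node. *)
Lemma CInt_dirichlet (p : R) (M : nat) : 0 < p ->
  is_CInt (dirichlet (PI / p) M) (- p) p (RtoC (2 * p)).
Proof.
  intros Hp.
  assert (H1 : is_CInt (fun x : R => geo (cis (PI / p * x)) M) (- p) p (RtoC 0)).
  { induction M as [|M IH].
    - pose proof (is_CInt_const 0 (- p) p) as H. now rewrite Cmult_0_r in H.
    - apply (is_RInt_ext (V := C_R_CompleteNormedModule)
        (fun x : R => geo (cis (PI / p * x)) M + cis (PI / p * x) ^ S M)%C).
      { intros x _. now rewrite geo_succ. }
      replace (RtoC 0) with (0 + 0)%C by ring. apply is_CInt_plus; auto.
      now apply is_CInt_cis_pow. }
  assert (Hc : forall x : R, Ccontinuous (fun x : R => geo (cis (PI / p * x)) M) x).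
  { intros x. apply continuous_geo, continuous_cis, continuous_scale. }
  assert (H2 : is_CInt (fun x : R => geo (cis (- (PI / p * x))) M) (- p) p (RtoC 0)).
  { apply (is_RInt_ext (V := C_R_CompleteNormedModule) (fun x : R => geo (cis (PI / p * - x)) M)).
    { intros x _. f_equal. f_equal. ring. }
    pose proof (CInt_reflect _ p ltac:(lra) Hc) as E.
    rewrite (CInt_unique _ _ _ _ H1) in E. rewrite <- E. apply CInt_correct; [lra|].
    intros x _. apply (continuous_comp (fun t : R => - t) (fun x : R => geo (cis (PI / p * x)) M)); auto.
    apply (continuous_opp (V := R_NormedModule)), continuous_id. }
  replace (RtoC (2 * p)) with (RtoC (p - - p) * 1 + 0 + 0)%C.
  - apply is_CInt_plus; auto. apply is_CInt_plus; auto. apply is_CInt_const.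
  - rewrite !Cplus_0_r, Cmult_1_r. f_equal. ring.
Qed.

(** From [1 - cos s = 2 * sin (s / 2) ^ 2], with [s / 2] in [(0, PI / 2]]. Thus [1 - q] vanishes
    only at the node within its period. *)
Lemma cis_neq_1 (t : R) : t <> 0 -> Rabs t <= PI -> (1 - cis t)%C <> 0.
Proof.
  intros Ht Hp E. apply (f_equal fst) in E. simpl in E.
  assert (Ec : cos (Rabs t) = 1).
  { unfold Rabs. destruct (Rcase_abs t); [rewrite cos_neg|]; lra. }
  pose proof (Rabs_pos_lt t Ht). set (s := Rabs t) in *.
  pose proof (sin_gt_0 (s / 2) ltac:(lra) ltac:(lra)) as Hs.
  replace s with (2 * (s / 2)) in Ec by field. rewrite cos_2a_sin in Ec. nra.
Qed.

(** The nearest-point projection onto [[-p, p]], written with absolute values so that its continuity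
    is immediate. *)
Definition clamp (p x : R) : R := (Rabs (x + p) - Rabs (x - p)) / 2.

Lemma clamp_id (p x : R) : - p <= x <= p -> clamp p x = x.
Proof. intros H. unfold clamp. rewrite Rabs_pos_eq, Rabs_left1 by lra. field. Qed.

Lemma clamp_bound (p x : R) : 0 < p -> - p <= clamp p x <= p.
Proof. intros H. unfold clamp, Rabs. repeat destruct Rcase_abs; lra. Qed.

Lemma continuous_clamp (p x : R) : continuous (clamp p) x.
Proof.
  unfold clamp. apply (continuous_scal_l (fun x : R => Rabs (x + p) - Rabs (x - p)) (/ 2)).
  apply (continuous_minus (V := R_NormedModule));
    apply (continuous_comp _ Rabs); try apply continuous_Rabs.
  - apply (continuous_plus (V := R_NormedModule)); [apply continuous_id|apply continuous_const].
  - apply (continuous_minus (V := R_NormedModule)); [apply continuous_id|apply continuous_const].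
Qed.

(* [T = (F - F 0) / (1 - q)] is continuous on the period, and by [dirichlet_closed] its product with
   [1 - q] and the kernel consists of two Riemann-Lebesgue integrands; [clamp] extends [T] to the line. *)
Lemma dirichlet_sampling_0 (F phi : R -> C) (p eps : R) : 0 < p ->
  (forall x : R, Ccontinuous F x) -> Ccontinuous phi 0 ->
  (forall x : R, F x = (F 0%R + phi x * x)%C) -> 0 < eps ->
  exists M0, forall M, (M0 <= M)%nat ->
    Cmod (CInt (fun x : R => (F x * dirichlet (PI / p) M x)%C) (- p) p - RtoC (2 * p) * F 0%R) <= eps.
Proof.
  intros Hp HF Hphi Eq He. pose proof PI_RGT_0 as HPI.
  set (om := PI / p). assert (Hom : 0 < om) by now apply Rdiv_lt_0_compat.
  assert (Homp : om * p = PI) by (unfold om; field; lra).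
  destruct (Cexp_slope 0) as [Psi [HPsi [EPsi1 EPsi]]].
  set (q := fun x : R => cis (om * x)).
  assert (Hq : forall x : R, Ccontinuous q x) by (intros; apply continuous_cis, continuous_scale).
  set (u := fun x : R => (Ci * (om * x)%R)%C).
  assert (Eq1 : forall x : R, (1 - q x)%C = (- Psi (u x) * (Ci * om * x))%C).
  { intros x. unfold q. rewrite cis_Cexp.
    replace ((0, om * x) : C) with (u x).
    - rewrite (EPsi (u x)), Cexp_0. unfold u. rewrite RtoC_mult. ring.
    - apply injective_projections; simpl; ring. }
  assert (HCi : Ci <> 0) by (intros E; apply (f_equal snd) in E; simpl in E; lra).
  assert (Homn : RtoC om <> 0) by (intros E; apply RtoC_inj in E; lra).
  (* The quotient [(F x - F 0) / (1 - q x)] with the common factor [x] cancelled: [phi] is the slope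
     of [F], and [Psi], equal to 1 at the origin, that of the exponential. *)
  set (S0 := fun x : R => (phi x / (- Psi (u x) * (Ci * om)))%C).
  set (T := fun x : R => if Req_EM_T x 0 then S0 0 else ((F x - F 0%R) / (1 - q x))%C).
  assert (Huc : Ccontinuous u 0).
  { apply continuous_C_pair; simpl.
    - apply continuous_ext with (fun _ => 0); [intros t; change (0 = 0 * (om * t) - 1 * 0); ring|apply continuous_const].
    - apply continuous_ext with (fun x => om * x); [intros t; change (om * t = 0 * 0 + 1 * (om * t)); ring|apply continuous_scale]. }
  assert (Hu0 : u 0 = RtoC 0) by (unfold u; rewrite Rmult_0_r; ring).
  assert (HPu : Ccontinuous (fun x => Psi (u x)) 0).
  { apply (continuous_comp u Psi); auto. rewrite Hu0. exact HPsi. }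
  assert (HPu0 : Psi (u 0) = RtoC 1) by (rewrite Hu0, EPsi1; apply Cexp_0).
  assert (HTc : forall x : R, - p <= x <= p -> Ccontinuous T x).
  { intros x Hx. destruct (Req_EM_T x 0) as [->|Hx0].
    - apply continuous_ext_loc with S0.
      + assert (H1 : 0 < 1) by lra.
        generalize (proj1 (continuous_C_eps _ _) HPu _ H1). apply filter_imp. intros y Hy.
        unfold T. destruct (Req_EM_T y 0) as [->|Hy0]; auto.
        assert (Hn : Psi (u y) <> 0).
        { intros E. rewrite E, HPu0 in Hy. replace (0 - 1)%C with (- (1))%C in Hy by ring.
          rewrite Cmod_opp, Cmod_1 in Hy. lra. }
        unfold S0. rewrite Eq1, (Eq y).
          match goal with |- ?a = ?b => change (@eq C a b) end. field. repeat split; auto.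
        intros E; apply RtoC_inj in E; lra.
      + apply continuous_Cmult; auto. apply continuous_Cinv.
        * rewrite HPu0. repeat apply Cmult_neq_0; auto.
          intros E. apply (f_equal fst) in E. simpl in E. lra.
        * apply continuous_Cmult; [now apply continuous_Copp|apply continuous_const].
    - apply continuous_ext_loc with (fun y : R => ((F y - F 0%R) / (1 - q y))%C).
      + exists (mkposreal _ (Rabs_pos_lt x Hx0)). intros y Hy. unfold T.
        destruct (Req_EM_T y 0) as [->|]; auto. exfalso.
        unfold ball in Hy; simpl in Hy; unfold AbsRing_ball, minus, plus, opp, abs in Hy; simpl in Hy.
        rewrite Rplus_0_l, Rabs_Ropp in Hy. lra.
      + apply continuous_Cmult.
        * apply continuous_Cminus; auto. apply continuous_const.
        * apply continuous_Cinv.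
          { apply cis_neq_1.
            - intros E. apply Rmult_integral in E. lra.
            - rewrite Rabs_mult, (Rabs_pos_eq om), <- Homp by lra.
              apply Rmult_le_compat_l; [lra|]. apply Rabs_le. lra. }
          apply continuous_Cminus; auto. apply continuous_const. }
  assert (ET : forall x, - p <= x <= p -> (T x * (1 - q x))%C = (F x - F 0%R)%C).
  { intros x Hx. unfold T. destruct (Req_EM_T x 0) as [->|Hx0].
    - unfold q. rewrite Rmult_0_r, cis_0. ring.
    - field. apply cis_neq_1.
      + intros E. apply Rmult_integral in E. lra.
      + rewrite Rabs_mult, (Rabs_pos_eq om), <- Homp by lra.
        apply Rmult_le_compat_l; [lra|]. apply Rabs_le. lra. }
  set (Tc := fun x : R => T (clamp p x)).
  assert (HTcc : forall x : R, Ccontinuous Tc x).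
  { intros x. apply (continuous_comp (clamp p) T); [apply continuous_clamp|].
    apply HTc, clamp_bound, Hp. }
  destruct (riemann_lebesgue Tc (- p) p (eps / 2) ltac:(lra) HTcc ltac:(lra)) as [Lam [HL HRL]].
  (* Beyond this index both frequencies, [INR M * om] and [INR (S M) * om], exceed the
     Riemann-Lebesgue threshold. *)
  destruct (INR_unbounded (Lam / om)) as [M0 HM0].
  exists M0. intros M HM.
  assert (HMom : Lam <= INR M * om).
  { apply le_INR in HM. apply Rmult_le_reg_r with (/ om); [now apply Rinv_0_lt_compat|].
    rewrite Rmult_assoc, Rinv_r by lra. unfold Rdiv in HM0. lra. }
  assert (Ec : CInt (fun x : R => (F x * dirichlet om M x)%C) (- p) p
     = (CInt (fun x : R => Tc x * cis (- (INR M * om) * x))%C (- p) p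
        - CInt (fun x : R => Tc x * cis (INR (S M) * om * x))%C (- p) p + F 0%R * RtoC (2 * p))%C).
  { apply CInt_unique.
    apply (is_RInt_ext (V := C_R_CompleteNormedModule)
      (fun x : R => (Tc x * cis (- (INR M * om) * x) - Tc x * cis (INR (S M) * om * x)
         + F 0%R * dirichlet om M x)%C)).
    { rewrite Rmin_left, Rmax_right by lra. intros x Hx.
      unfold Tc. rewrite clamp_id by lra.
      replace (F x) with (F 0%R + T x * (1 - q x))%C by (rewrite ET by lra; ring).
      rewrite Cmult_plus_distr_r, <- Cmult_assoc. unfold q. rewrite dirichlet_closed, !cis_pow.
      replace (- (INR M * om) * x) with (INR M * - (om * x)) by ring.
      replace (INR (S M) * om * x) with (INR (S M) * (om * x)) by ring. Cring. }
    apply is_CInt_plus; [apply is_CInt_minus|].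
    - apply CInt_correct; [lra|]. intros; apply continuous_Cmult; auto. apply continuous_cis, continuous_scale.
    - apply CInt_correct; [lra|]. intros; apply continuous_Cmult; auto. apply continuous_cis, continuous_scale.
    - apply is_CInt_mult. now apply CInt_dirichlet. }
  fold om in Ec. rewrite Ec.
  replace (CInt (fun x : R => Tc x * cis (- (INR M * om) * x))%C (- p) p
        - CInt (fun x : R => Tc x * cis (INR (S M) * om * x))%C (- p) p + F 0%R * RtoC (2 * p)
        - RtoC (2 * p) * F 0%R)%C with
   (CInt (fun x : R => Tc x * cis (- (INR M * om) * x))%C (- p) p
        + - CInt (fun x : R => Tc x * cis (INR (S M) * om * x))%C (- p) p)%C by ring.
  eapply Rle_trans; [apply Cmod_triangle|]. rewrite Cmod_opp.
  assert (HMom0 : 0 <= INR M * om) by (apply Rmult_le_pos; [apply pos_INR|lra]).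
  pose proof (HRL (- (INR M * om)) ltac:(rewrite Rabs_Ropp, Rabs_pos_eq; lra)).
  assert (HSM : INR (S M) * om = INR M * om + om) by (rewrite S_INR; ring).
  pose proof (HRL (INR (S M) * om) ltac:(rewrite HSM, Rabs_pos_eq; lra)).
  lra.
Qed.

(** The condition on [c] says that it is a multiple of the period [2 * p], so translation by [c]
    leaves the kernel unchanged. *)
Lemma dirichlet_sampling (F phi : R -> C) (p c eps : R) : 0 < p -> cis (PI / p * c) = 1 ->
  (forall x : R, Ccontinuous F x) -> Ccontinuous phi c ->
  (forall x : R, F x = (F c + phi x * (x - c)%R)%C) -> 0 < eps ->
  exists M0, forall M, (M0 <= M)%nat ->
    Cmod (CInt (fun x : R => (F x * dirichlet (PI / p) M x)%C) (c - p) (c + p) - RtoC (2 * p) * F c) <= eps.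
Proof.
  intros Hp Hc HF Hphi Eq He.
  assert (Hs : forall x : R, continuous (fun t => t + c) x).
  { intros x. apply (continuous_plus (V := R_NormedModule)); [apply continuous_id|apply continuous_const]. }
  destruct (dirichlet_sampling_0 (fun x : R => F (x + c)) (fun x : R => phi (x + c)) p eps) as [M0 HM0]; auto.
  - intros x. now apply (continuous_comp (fun t : R => t + c) F).
  - apply (continuous_comp (fun t : R => t + c) phi); auto. now rewrite Rplus_0_l.
  - intros x. rewrite Rplus_0_l, (Eq (x + c)). now replace (x + c - c) with x by ring.
  - exists M0. intros M HM. specialize (HM0 M HM). cbv beta in HM0. rewrite Rplus_0_l in HM0.
    replace (CInt (fun x : R => (F x * dirichlet (PI / p) M x)%C) (c - p) (c + p))
      with (CInt (fun x : R => (F (x + c)%R * dirichlet (PI / p) M x)%C) (- p) p); auto.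
    replace (c - p) with (- p + c) by ring. rewrite (Rplus_comm c p).
    rewrite <- CInt_shift.
    + apply (RInt_ext (V := C_R_CompleteNormedModule)). intros x _.
      change (F (x + c)%R * dirichlet (PI / p) M x = F (x + c)%R * dirichlet (PI / p) M (x + c)%R)%C.
      f_equal. unfold dirichlet. rewrite Rmult_plus_distr_l, Ropp_plus_distr, !cis_plus, Hc.
      replace (cis (- (PI / p * c))) with (RtoC 1) by (rewrite <- (cis_opp (PI / p * c)), Hc; ring).
      now rewrite !Cmult_1_r.
    + intros x. apply continuous_Cmult; auto. apply continuous_dirichlet.
Qed.

Lemma dirichlet_sampling_sum (F : R -> C) (p c eps : R) (n : nat) : 0 < p ->
  cis (PI / p * c) = 1 -> (forall x : R, Ccontinuous F x) ->
  (forall a : R, exists phi : R -> C, Ccontinuous phi a /\ forall x : R, F x = (F a + phi x * (x - a)%R)%C) ->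
  0 < eps ->
  exists M0, forall M, (M0 <= M)%nat ->
    Cmod (CInt (fun x : R => (F x * dirichlet (PI / p) M x)%C) (c - p) (c + INR n * (2 * p) + p)
      - RtoC (2 * p) * sum_n (fun j => F (c + INR j * (2 * p))) n) <= eps.
Proof.
  intros Hp Hc HF HD. revert eps. induction n as [|n IH]; intros eps He.
  - destruct (HD c) as [phi [H1 H2]]. rewrite sum_O. simpl INR. rewrite Rmult_0_l, Rplus_0_r.
    now apply dirichlet_sampling with phi.
  - destruct (IH (eps / 2)) as [M1 H1]; [lra|].
    set (a := c + INR (S n) * (2 * p)).
    destruct (HD a) as [phi [Hphi Ephi]].
    destruct (dirichlet_sampling F phi p a (eps / 2)) as [M2 H2]; auto; try lra.
    { unfold a. rewrite Rmult_plus_distr_l, cis_plus, Hc.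
      replace (PI / p * (INR (S n) * (2 * p))) with (IZR (Z.of_nat (S n)) * (2 * PI))
        by (rewrite <- INR_IZR_INZ; field; lra).
      rewrite cis_2PI_Z. ring. }
    exists (max M1 M2). intros M HM. specialize (H1 M ltac:(lia)). specialize (H2 M ltac:(lia)).
    pose proof (pos_INR n).
    rewrite sum_Sn. fold a.
    rewrite (CInt_Chasles _ (c - p) (c + INR n * (2 * p) + p) (a + p)).
    + replace (c + INR n * (2 * p) + p) with (a - p) in * by (unfold a; rewrite S_INR; ring).
      change (plus ?x ?y) with (x + y)%C in *.
      set (s := sum_n _ _) in *. set (A := CInt _ (c - p) (a - p)) in *. set (B := CInt _ (a - p) (a + p)) in *.
      replace (A + B - RtoC (2 * p) * (s + F a))%C
        with ((A - RtoC (2 * p) * s) + (B - RtoC (2 * p) * F a))%C by ring.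
      eapply Rle_trans; [apply Cmod_triangle|]. lra.
    + unfold a. rewrite S_INR. nra.
    + intros x _. apply continuous_Cmult; auto. apply continuous_dirichlet.
Qed.

(** * Discretization error on a bounded interval *)

(** The holomorphic extension of [cis (om * x)]. Its modulus at height [y] is [exp (- (om * y))],
    which is why positive powers move upwards. *)
Definition wave (om : R) (z : C) : C := Cexp (Ci * om * z).

Lemma wave_eq (om x y : R) : wave om (x, y) = (RtoC (exp (- (om * y))) * cis (om * x))%C.
Proof.
  unfold wave. rewrite <- Cexp_cis. f_equal. apply injective_projections; simpl; ring.
Qed.

Lemma cdiff_wave (om : R) (z : C) : cdiff (wave om) z.
Proof.
  apply (cdiff_comp Cexp); [apply cdiff_Cexp|].
  apply cdiff_mult; [apply cdiff_const|apply cdiff_id].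
Qed.

(** Goursat trades the real segment for the top side, where the kernel is geometrically small, and
    two vertical sides of length [d]. Only the upper half plane is treated; the lower one follows on
    replacing [F z] by [F (- z)]. *)
Lemma half_plane_bound (F : C -> C) (om X d s B : R) (m : R -> R) (M : nat) :
  0 < om -> 0 < X -> 0 < d -> cis (om * X) = RtoC (-1) ->
  (forall x y, - X <= x <= X -> 0 <= y <= d -> cdiff F (x, y)) ->
  (forall y, 0 <= y <= d -> Cmod (F (X, y)) <= s) ->
  (forall y, 0 <= y <= d -> Cmod (F (- X, y)) <= s) ->
  (forall x, - X <= x <= X -> Cmod (F (x, d)) <= m x) -> is_RInt m (- X) X B ->
  Cmod (CInt (fun x : R => (F (RtoC x) * geo (cis (om * x)) M)%C) (- X) X)
    <= exp (- (om * d)) / (1 - exp (- (om * d))) * B + 2 * d * s.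
Proof.
  intros Hom HX Hd Hcis HF Hs1 Hs2 Hm HB.
  set (G := fun z => (F z * geo (wave om z) M)%C).
  assert (HGd : forall x y, - X <= x <= X -> 0 <= y <= d -> cdiff G (x, y)).
  { intros x y Hx Hy. apply cdiff_mult; auto. apply cdiff_geo, cdiff_wave. }
  assert (Hex : exp (- (om * d)) < 1).
  { rewrite <- exp_0. apply exp_increasing. nra. }
  pose proof (goursat G (- X) X 0 d ltac:(lra) ltac:(lra) HGd) as E.
  unfold rect_int in E.
  set (I0 := CInt (fun x => G (x, 0)) (- X) X) in *.
  set (I1 := CInt (fun x => G (x, d)) (- X) X) in *.
  set (V1 := CInt (fun y => G (X, y)) 0 d) in *. set (V2 := CInt (fun y => G (- X, y)) 0 d) in *.
  assert (E0 : CInt (fun x : R => (F (RtoC x) * geo (cis (om * x)) M)%C) (- X) X = I0).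
  { apply (RInt_ext (V := C_R_CompleteNormedModule)). intros x _. unfold G.
    rewrite wave_eq, Rmult_0_r, Ropp_0, exp_0.
    now rewrite Cmult_1_l. }
  rewrite E0. replace I0 with (I1 + (- (Ci * (V1 - V2))))%C.
  2:{ replace I0 with (I1 + - (Ci * (V1 - V2)) + (I0 - I1 + Ci * (V1 - V2)))%C by ring. rewrite E. ring. }
  (* On both vertical sides [wave om] equals [- exp (- (om * y))], a real number in [[-1, 0)]. *)
  assert (Hneg : forall y, 0 <= y <= d -> Cmod (geo (wave om (X, y)) M) <= 1
     /\ Cmod (geo (wave om (- X, y)) M) <= 1).
  { intros y Hy. rewrite !wave_eq. rewrite Hcis.
    replace (cis (om * - X)) with (RtoC (-1)).
    - rewrite <- RtoC_mult. replace (exp (- (om * y)) * -1) with (- exp (- (om * y))) by ring.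
      assert (0 <= exp (- (om * y)) <= 1).
      { split; [apply Rlt_le, exp_pos|]. rewrite <- exp_0. apply exp_le_compat. nra. }
      split; now apply Cmod_geo_neg_le.
    - replace (om * - X) with (- (om * X)) by ring.
      pose proof (cis_opp (om * X)) as H. rewrite Hcis in H.
      replace (cis (- (om * X))) with (- (RtoC (-1) * cis (- (om * X))))%C by ring. rewrite H.
      now rewrite <- RtoC_opp. }
  eapply Rle_trans; [apply Cmod_triangle|]. rewrite Cmod_opp, Cmod_mult, Cmod_Ci.
  pose proof (Cmod_triangle V1 (- V2)) as HV. rewrite Cmod_opp in HV.
  assert (Cmod V1 <= (d - 0) * s).
  { apply Cmod_CInt_le_const; [lra| |].
    - intros y Hy. apply continuous_vertical, cdiff_continuous, HGd; lra.
    - intros y Hy. unfold G. rewrite Cmod_mult.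
      pose proof (proj1 (Hneg y Hy)). pose proof (Hs1 y Hy).
      pose proof (Cmod_ge_0 (F (X, y))). pose proof (Cmod_ge_0 (geo (wave om (X, y)) M)). nra. }
  assert (Cmod V2 <= (d - 0) * s).
  { apply Cmod_CInt_le_const; [lra| |].
    - intros y Hy. apply continuous_vertical, cdiff_continuous, HGd; lra.
    - intros y Hy. unfold G. rewrite Cmod_mult.
      pose proof (proj2 (Hneg y Hy)). pose proof (Hs2 y Hy).
      pose proof (Cmod_ge_0 (F (- X, y))). pose proof (Cmod_ge_0 (geo (wave om (- X, y)) M)). nra. }
  assert (Cmod I1 <= exp (- (om * d)) / (1 - exp (- (om * d))) * B).
  { apply (Cmod_CInt_le (fun x => G (x, d)) (fun x => exp (- (om * d)) / (1 - exp (- (om * d))) * m x) (- X) X); [lra| | |].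
    - intros x Hx. unfold G. rewrite Cmod_mult, Rmult_comm.
      apply Rmult_le_compat; auto using Cmod_ge_0. apply Cmod_geo_le; auto.
      rewrite wave_eq, Cmod_mult, Cmod_cis, Cmod_R, Rmult_1_r, Rabs_pos_eq; [lra|].
      apply Rlt_le, exp_pos.
    - apply CInt_correct; [lra|]. intros x Hx.
      apply continuous_horizontal, cdiff_continuous, HGd; lra.
    - now apply (is_RInt_scal (V := R_NormedModule)). }
  change (Cmod (V1 - V2)) with (Cmod (V1 + - V2)). lra.
Qed.

Lemma cdiff_real_slope (F : C -> C) (a : R) : cdiff F (RtoC a) ->
  exists phi : R -> C, Ccontinuous phi a /\
    forall x : R, F (RtoC x) = (F (RtoC a) + phi x * (x - a)%R)%C.
Proof.
  intros [phi [H1 H2]]. exists (fun x => phi (RtoC x)). split.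
  - apply (continuous_horizontal phi a 0 H1).
  - intros x. rewrite (H2 (RtoC x)). now rewrite RtoC_minus.
Qed.

(** The bounds on the two shifted integrals do not depend on [M], so one [M] adapted to [eps]
    suffices. The lower side is bounded at [(- x, - d)] because the lower half plane is reached
    through the reflection [z -> - z]. *)
Lemma trapezoid_bounded (F : C -> C) (h d s B : R) (m : R -> R) (L : nat) : 0 < h -> 0 < d ->
  let X := (INR L + 1 / 2) * h in
  (forall x y, - d <= y <= d -> cdiff F (x, y)) ->
  (forall y, - d <= y <= d -> Cmod (F (X, y)) <= s /\ Cmod (F (- X, y)) <= s) ->
  (forall x, - X <= x <= X -> Cmod (F (x, d)) <= m x /\ Cmod (F (- x, - d)) <= m x) ->
  is_RInt m (- X) X B ->
  Cmod (CInt (fun x => F (RtoC x)) (- X) X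
    - RtoC h * sum_n (fun j => F (RtoC ((INR j - INR L) * h))) (L + L))
    <= 2 * (exp (- (2 * PI * d / h)) / (1 - exp (- (2 * PI * d / h))) * B + 2 * d * s).
Proof.
  intros Hh Hd X HF Hs Hm HB. pose proof PI_RGT_0 as HPI.
  pose proof (pos_INR L) as HL.
  assert (HX : 0 < X) by (unfold X; nra).
  set (Fr := fun x : R => F (RtoC x)).
  assert (Hc : forall x : R, Ccontinuous Fr x).
  { intros x. apply (continuous_horizontal F x 0), cdiff_continuous, HF. lra. }
  set (Fm := fun z => F (- z)%C).
  assert (Hopp : forall x y, (- (x, y))%C = (- x, - y)) by reflexivity.
  assert (HFm : forall x y, - d <= y <= d -> cdiff Fm (x, y)).
  { intros x y Hy. apply (cdiff_comp F (fun z => - z)%C).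
    - rewrite Hopp. apply HF. lra.
    - apply cdiff_ext with (fun z => RtoC (-1) * z)%C.
      + intros w. replace (RtoC (-1)) with (- (1))%C by now rewrite <- RtoC_opp. ring.
      + apply cdiff_mult; [apply cdiff_const|apply cdiff_id]. }
  set (om := PI / (h / 2)).
  assert (Hom : 0 < om) by (apply Rdiv_lt_0_compat; lra).
  assert (Homd : om * d = 2 * PI * d / h) by (unfold om; field; lra).
  assert (HomX : cis (om * X) = RtoC (-1)).
  { replace (om * X) with (IZR (Z.of_nat L) * (2 * PI) + PI).
    - rewrite cis_plus, cis_2PI_Z. unfold cis. rewrite cos_PI, sin_PI.
      change ((-1, 0)%R : C) with (RtoC (-1)). ring.
    - rewrite <- INR_IZR_INZ. unfold om, X. field. lra. }
  (* The leftmost of the [2 * L + 1] nodes; half a step to its left lies the cut [- X], so the cells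
     of the nodes tile [[- X, X]] exactly. *)
  set (c := - (INR L * h)).
  assert (Hcc : cis (om * c) = 1).
  { replace (om * c) with (IZR (- Z.of_nat L) * (2 * PI)); [apply cis_2PI_Z|].
    rewrite opp_IZR, <- INR_IZR_INZ. unfold om, c. field. lra. }
  set (bound := exp (- (2 * PI * d / h)) / (1 - exp (- (2 * PI * d / h))) * B + 2 * d * s).
  apply le_epsilon. intros eps He.
  destruct (dirichlet_sampling_sum Fr (h / 2) c eps (L + L)) as [M HM]; auto; try lra.
  { intros a. apply cdiff_real_slope, (HF a 0). lra. }
  specialize (HM M (le_n M)). fold om in HM.
  replace (c - h / 2) with (- X) in HM by (unfold c, X; field).
  replace (c + INR (L + L) * (2 * (h / 2)) + h / 2) with X in HM
    by (unfold c, X; rewrite plus_INR; field).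
  replace (2 * (h / 2)) with h in HM by field.
  replace (sum_n (fun j => Fr (c + INR j * h)) (L + L))
    with (sum_n (fun j => F (RtoC ((INR j - INR L) * h))) (L + L)) in HM.
  2:{ apply sum_n_ext. intros j. unfold Fr, c. f_equal. f_equal. ring. }
  set (Sm := (RtoC h * sum_n (fun j => F (RtoC ((INR j - INR L) * h))) (L + L))%C) in *.
  set (P1 := CInt (fun x : R => (F (RtoC x) * geo (cis (om * x)) M)%C) (- X) X).
  set (P2 := CInt (fun x : R => (Fm (RtoC x) * geo (cis (om * x)) M)%C) (- X) X).
  assert (HP1 : Cmod P1 <= bound).
  { unfold bound. rewrite <- Homd. apply half_plane_bound with m; auto.
    - intros x y _ Hy. apply HF; lra. - intros y Hy. apply Hs; lra.
    - intros y Hy. apply Hs; lra. - intros x Hx. now apply Hm. }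
  assert (HP2 : Cmod P2 <= bound).
  { unfold bound. rewrite <- Homd. apply half_plane_bound with m; auto.
    - intros x y _ Hy. apply HFm; lra. - intros y Hy. unfold Fm. rewrite Hopp. apply Hs; lra.
    - intros y Hy. unfold Fm. rewrite Hopp, Ropp_involutive. apply Hs; lra.
    - intros x Hx. unfold Fm. rewrite Hopp. now apply Hm. }
  assert (Hg : forall x : R, Ccontinuous (fun x : R => geo (cis (om * x)) M) x).
  { intros x. apply continuous_geo, continuous_cis, continuous_scale. }
  assert (Ho : forall x : R, continuous (fun t : R => - t) x).
  { intros x. apply (continuous_opp (V := R_NormedModule)), continuous_id. }
  assert (HFmc : forall x : R, Ccontinuous (fun x : R => Fm (RtoC x)) x).
  { intros x. apply (continuous_horizontal Fm x 0), cdiff_continuous, HFm. lra. }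
  (* The three summands of the kernel give the integral itself and the two errors; the negative
     frequencies become [P2] after the change [x -> - x]. *)
  assert (E : CInt (fun x : R => (Fr x * dirichlet om M x)%C) (- X) X = (CInt Fr (- X) X + P1 + P2)%C).
  { apply CInt_unique.
    unfold P2. rewrite <- (CInt_reflect (fun x : R => (Fm (RtoC x) * geo (cis (om * x)) M)%C)); [|lra|intros x; now apply continuous_Cmult].
    apply (is_RInt_ext (V := C_R_CompleteNormedModule)
      (fun x : R => Fr x + F (RtoC x) * geo (cis (om * x)) M + Fm (RtoC (- x)) * geo (cis (om * - x)) M)%C).
    { intros x _. unfold dirichlet, Fm, Fr. rewrite RtoC_opp.
      replace (- - RtoC x)%C with (RtoC x) by ring. replace (om * - x) with (- (om * x)) by ring. Cring. }
    apply is_CInt_plus; [apply is_CInt_plus|]; apply CInt_correct; try lra; intros x _.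
    - apply Hc.
    - now apply continuous_Cmult.
    - apply continuous_Cmult.
      + now apply (continuous_comp (fun t : R => - t) (fun x : R => Fm (RtoC x))).
      + now apply (continuous_comp (fun t : R => - t) (fun x : R => geo (cis (om * x)) M)). }
  rewrite E in HM.
  change (CInt (fun x => F (RtoC x)) (- X) X) with (CInt Fr (- X) X).
  replace (CInt Fr (- X) X - Sm)%C with ((CInt Fr (- X) X + P1 + P2 - Sm) + (- P1 + - P2))%C by ring.
  eapply Rle_trans; [apply Cmod_triangle|].
  pose proof (Cmod_triangle (- P1) (- P2)) as HT. rewrite !Cmod_opp in HT. lra.
Qed.

(** * Truncation and the limit over the whole line *)

Lemma exp_decay_small (c eps : R) : 0 < c -> 0 < eps ->
  exists X0, 0 < X0 /\ forall X, X0 <= X -> exp (- (c * X)) <= eps.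
Proof.
  (* Beyond this point [c * X >= / eps], and [exp t >= 1 + t] finishes. *)
  intros Hc He. exists (/ (c * eps)).
  assert (H0 : 0 < / (c * eps)) by (apply Rinv_0_lt_compat; nra).
  split; auto. intros X HX.
  assert (Hx : / eps <= c * X).
  { apply Rmult_le_compat_l with (r := c) in HX; [|lra].
    replace (c * / (c * eps)) with (/ eps) in HX by (field; lra). exact HX. }
  pose proof (Rinv_0_lt_compat _ He).
  pose proof (exp_ineq1_le (c * X)).
  rewrite exp_Ropp. rewrite <- (Rinv_inv eps). apply Rinv_le_contravar; lra.
Qed.

Lemma CInt_exp_bound (f : R -> C) (B c u v : R) : c <> 0 -> u <= v ->
  (forall x : R, Ccontinuous f x) -> (forall x, Cmod (f x) <= B * exp (c * x)) ->
  Cmod (CInt f u v) <= B / c * (exp (c * v) - exp (c * u)).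
Proof.
  intros Hc Huv Hf HB.
  apply (Cmod_CInt_le f (fun x => B * exp (c * x)) u v); auto.
  - now apply CInt_correct.
  - replace (B / c * (exp (c * v) - exp (c * u)))
      with (minus (G := R_AbelianGroup) (B / c * exp (c * v)) (B / c * exp (c * u)))
      by (unfold minus, plus, opp; simpl; ring).
    apply (is_RInt_derive (V := R_CompleteNormedModule) (fun x => B / c * exp (c * x))).
    + intros x _. auto_derive; auto. field. auto.
    + intros x _. apply (continuous_scal_r B (fun x => exp (c * x))).
      apply (continuous_comp (fun t => c * t) exp); [apply continuous_scale|apply continuous_exp].
Qed.

(** The limit comes with an explicit tail bound on every interval. That one estimate serves both to
    cut the line in the quadrature and to obtain convergence of the improper integral at its two
    ends. *)
Lemma line_integral_exists (f : R -> C) (B al be : R) : 0 < al -> 0 < be -> 0 <= B ->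
  (forall x : R, Ccontinuous f x) ->
  (forall x, Cmod (f x) <= B * exp (al * x)) -> (forall x, Cmod (f x) <= B * exp (- be * x)) ->
  exists I : C, forall u v, u <= v ->
    Cmod (CInt f u v - I) <= B / al * exp (al * u) + B / be * exp (- be * v).
Proof.
  intros Hal Hbe HB0 Hf Ha Hb.
  assert (Hl : forall u v, u <= v -> Cmod (CInt f u v) <= B / al * exp (al * v)).
  { intros u v Huv. eapply Rle_trans; [apply (CInt_exp_bound f B al); auto; apply Rgt_not_eq; lra|].
    apply Rmult_le_compat_l; [|pose proof (exp_pos (al * u)); lra].
    apply Rmult_le_pos; [lra|]. apply Rlt_le, Rinv_0_lt_compat; lra. }
  assert (Hr : forall u v, u <= v -> Cmod (CInt f u v) <= B / be * exp (- be * u)).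
  { intros u v Huv. eapply Rle_trans; [apply (CInt_exp_bound f B (- be)); auto; apply Rlt_not_eq; lra|].
    replace (B / - be * (exp (- be * v) - exp (- be * u)))
      with (B / be * (exp (- be * u) - exp (- be * v))) by (field; lra).
    apply Rmult_le_compat_l; [|pose proof (exp_pos (- be * v)); lra].
    apply Rmult_le_pos; [lra|]. apply Rlt_le, Rinv_0_lt_compat; lra. }
  assert (Hext : forall w u v z, w <= u -> u <= v -> v <= z ->
    Cmod (CInt f u v - CInt f w z) <= B / al * exp (al * u) + B / be * exp (- be * v)).
  { intros w u v z H1 H2 H3.
    rewrite (CInt_Chasles f w u z), (CInt_Chasles f u v z); auto; try lra.
    replace (CInt f u v - (CInt f w u + (CInt f u v + CInt f v z)))%C
      with (- CInt f w u + - CInt f v z)%C by ring.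
    eapply Rle_trans; [apply Cmod_triangle|]. rewrite !Cmod_opp.
    apply Rplus_le_compat; auto. }
  (* Symmetric integer intervals reduce existence to two real Cauchy sequences; [Hext] then compares
     any interval with a larger symmetric one. *)
  set (S := fun n => CInt f (- INR n) (INR n)).
  set (E := fun X => B / al * exp (- (al * X)) + B / be * exp (- (be * X))).
  assert (HE : forall eps, 0 < eps -> exists X0, 0 < X0 /\ forall X, X0 <= X -> E X <= eps).
  { intros eps He.
    assert (Hq : forall c, 0 < c -> 0 <= B / c).
    { intros c Hc. apply Rmult_le_pos; auto. now apply Rlt_le, Rinv_0_lt_compat. }
    destruct (exp_decay_small al (eps / 2 / (B / al + 1))) as [X1 [P1 H1]]; auto.
    { pose proof (Hq al Hal). apply Rdiv_lt_0_compat; lra. }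
    destruct (exp_decay_small be (eps / 2 / (B / be + 1))) as [X2 [P2 H2]]; auto.
    { pose proof (Hq be Hbe). apply Rdiv_lt_0_compat; lra. }
    assert (Hz : forall b e, 0 <= b -> 0 <= e -> e <= eps / 2 / (b + 1) -> b * e <= eps / 2).
    { intros b e Hb0 He0 Hbe0. apply Rle_trans with ((b + 1) * (eps / 2 / (b + 1))); [nra|].
      apply Req_le. field. lra. }
    exists (Rmax X1 X2). split; [eapply Rlt_le_trans; [exact P1|apply Rmax_l]|]. intros X HX.
    assert (X1 <= X) by (eapply Rle_trans; [apply Rmax_l|exact HX]).
    assert (X2 <= X) by (eapply Rle_trans; [apply Rmax_r|exact HX]).
    unfold E. replace eps with (eps / 2 + eps / 2) by field.
    apply Rplus_le_compat; apply Hz; auto; apply Rlt_le, exp_pos. }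
  assert (Hcauchy : forall eps : posreal, exists N : nat, forall n m : nat,
    (N <= n)%nat -> (N <= m)%nat -> Cmod (S n - S m) < eps).
  { intros eps. destruct (HE (eps / 2)) as [X0 [_ HX0]]; [pose proof (cond_pos eps); lra|].
    destruct (INR_unbounded X0) as [N HN]. exists N.
    assert (Hw : forall n m, (N <= n)%nat -> (n <= m)%nat -> Cmod (S n - S m) < eps).
    { intros n m Hn Hm. apply le_INR in Hn, Hm. pose proof (pos_INR n).
      eapply Rle_lt_trans; [apply Hext; lra|].
      specialize (HX0 (INR n) ltac:(lra)). unfold E in HX0.
      replace (al * - INR n) with (- (al * INR n)) by ring.
      replace (- be * INR n) with (- (be * INR n)) by ring. pose proof (cond_pos eps); lra. }
    intros n m Hn Hm. destruct (Nat.le_ge_cases n m); [auto|]. rewrite Cmod_sub_comm. auto. }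
  assert (Hc1 : ex_finite_lim_seq (fun n => fst (S n))).
  { apply ex_lim_seq_cauchy_corr. intros eps. destruct (Hcauchy eps) as [N HN]. exists N.
    intros n m Hn Hm. eapply Rle_lt_trans; [apply (Rabs_fst_le (S n - S m)%C)|auto]. }
  assert (Hc2 : ex_finite_lim_seq (fun n => snd (S n))).
  { apply ex_lim_seq_cauchy_corr. intros eps. destruct (Hcauchy eps) as [N HN]. exists N.
    intros n m Hn Hm. eapply Rle_lt_trans; [apply (Rabs_snd_le (S n - S m)%C)|auto]. }
  destruct Hc1 as [l1 H1], Hc2 as [l2 H2]. exists ((l1, l2) : C). intros u v Huv.
  apply le_epsilon. intros eps He.
  apply is_lim_seq_spec in H1. apply is_lim_seq_spec in H2.
  assert (He2 : 0 < eps / 2) by lra.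
  destruct (H1 (mkposreal _ He2)) as [N1 HN1]. destruct (H2 (mkposreal _ He2)) as [N2 HN2].
  simpl in HN1, HN2.
  destruct (INR_unbounded (Rabs u + Rabs v)) as [N3 HN3].
  set (n := max N1 (max N2 N3)).
  specialize (HN1 n ltac:(lia)). specialize (HN2 n ltac:(lia)).
  assert (Hn : Rabs u + Rabs v < INR n) by (eapply Rlt_le_trans; [exact HN3|apply le_INR; lia]).
  assert (Hd : Cmod (S n - (l1, l2)) <= eps).
  { eapply Rle_trans; [apply Cmod_le_abs|]. simpl. unfold Rminus in *. lra. }
  replace (CInt f u v - (l1, l2))%C with ((CInt f u v - S n) + (S n - (l1, l2)))%C by ring.
  eapply Rle_trans; [apply Cmod_triangle|]. apply Rplus_le_compat; auto.
  assert (H3 : - Rabs u <= u <= Rabs u) by (apply Rabs_le_between; lra).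
  assert (H4 : - Rabs v <= v <= Rabs v) by (apply Rabs_le_between; lra).
  pose proof (Rabs_pos u). pose proof (Rabs_pos v). apply Hext; lra.
Qed.

Lemma sum_n_head (f : nat -> C) (n : nat) :
  sum_n f (S n) = (f O + sum_n (fun j => f (S j)) n)%C.
Proof.
  induction n as [|n IH].
  - rewrite sum_Sn, !sum_O. reflexivity.
  - rewrite sum_Sn, IH, (sum_Sn (fun j => f (S j))). change (plus ?x ?y) with (x + y)%C. Cring.
Qed.

Definition trap_sum (f : R -> C) (h : R) (M N : nat) : C :=
  (RtoC h * sum_n (fun j => f ((INR j - INR M) * h)%R) (M + N))%C.

Lemma trap_sum_right (f : R -> C) (h : R) (M N : nat) :
  trap_sum f h M (S N) = (trap_sum f h M N + RtoC h * f (INR (S N) * h)%R)%C.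
Proof.
  unfold trap_sum. rewrite Nat.add_succ_r, sum_Sn. change (plus ?x ?y) with (x + y)%C.
  replace (INR (S (M + N)) - INR M) with (INR (S N)) by (rewrite !S_INR, plus_INR; ring). ring.
Qed.

Lemma trap_sum_left (f : R -> C) (h : R) (M N : nat) :
  trap_sum f h (S M) N = (trap_sum f h M N + RtoC h * f (- (INR (S M) * h))%R)%C.
Proof.
  unfold trap_sum. rewrite Nat.add_succ_l, sum_n_head. cbv beta.
  replace ((INR 0 - INR (S M)) * h) with (- (INR (S M) * h)) by (change (INR 0) with 0; ring).
  rewrite (sum_n_ext (fun j => f ((INR (S j) - INR (S M)) * h)) (fun j => f ((INR j - INR M) * h))); [ring|].
  intros j. f_equal. rewrite !S_INR. ring.
Qed.

(** A right-endpoint rectangle lies below the integral of the decreasing function [exp (- (c * t))]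
    over one step. The right-hand side is that integral, so the bounds telescope over the nodes. *)
Lemma exp_step_bound (c h : R) (n : nat) : 0 < c -> 0 < h ->
  h * exp (- (c * (INR (S n) * h))) <= / c * (exp (- (c * (INR n * h))) - exp (- (c * (INR (S n) * h)))).
Proof.
  intros Hc Hh. rewrite S_INR.
  replace (- (c * (INR n * h))) with (- (c * ((INR n + 1) * h)) + c * h) by ring.
  rewrite exp_plus. pose proof (exp_ineq1_le (c * h)) as H.
  pose proof (exp_pos (- (c * ((INR n + 1) * h)))) as Hp.
  set (e := exp (- (c * ((INR n + 1) * h)))) in *.
  apply Rmult_le_reg_l with c; auto. rewrite <- Rmult_assoc, <- (Rmult_assoc c (/ c)), Rinv_r by lra. nra.
Qed.

(** Extra nodes are added one at a time, first on the right and then on the left. The inductions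
    retain the negative end of the telescoping difference, which is dropped only at the end. *)
Lemma truncation_bound (f : R -> C) (B al be h : R) (M N p r : nat) :
  0 < al -> 0 < be -> 0 < h -> 0 <= B ->
  (forall x, Cmod (f x) <= B * exp (al * x)) -> (forall x, Cmod (f x) <= B * exp (- be * x)) ->
  Cmod (trap_sum f h (p + M) (r + N) - trap_sum f h M N)
    <= B / al * exp (- (al * (INR M * h))) + B / be * exp (- (be * (INR N * h))).
Proof.
  intros Hal Hbe Hh HB0 Ha Hb.
  assert (Hr : Cmod (trap_sum f h M (r + N) - trap_sum f h M N)
     <= B / be * (exp (- (be * (INR N * h))) - exp (- (be * (INR (r + N) * h))))).
  { induction r as [|r IH].
    - rewrite Nat.add_0_l. replace (trap_sum f h M N - trap_sum f h M N)%C with (RtoC 0) by ring.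
      rewrite Cmod_0. right. ring.
    - rewrite Nat.add_succ_l, trap_sum_right.
      replace (trap_sum f h M (r + N) + RtoC h * f (INR (S (r + N)) * h)%R - trap_sum f h M N)%C
        with ((trap_sum f h M (r + N) - trap_sum f h M N) + RtoC h * f (INR (S (r + N)) * h)%R)%C by ring.
      eapply Rle_trans; [apply Cmod_triangle|]. rewrite Cmod_mult, Cmod_R, Rabs_pos_eq by lra.
      pose proof (exp_step_bound be h (r + N) Hbe Hh) as H1.
      pose proof (Hb (INR (S (r + N)) * h)) as H2.
      replace (- be * (INR (S (r + N)) * h)) with (- (be * (INR (S (r + N)) * h))) in H2 by ring.
      set (e1 := exp (- (be * (INR (S (r + N)) * h)))) in *.
      set (e0 := exp (- (be * (INR (r + N) * h)))) in *.
      assert (h * (B * e1) <= B / be * (e0 - e1)).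
      { apply Rmult_le_compat_l with (r := B) in H1; auto. unfold Rdiv. nra. }
      assert (h * Cmod (f (INR (S (r + N)) * h)) <= h * (B * e1)) by (apply Rmult_le_compat_l; lra).
      lra. }
  assert (Hl : Cmod (trap_sum f h (p + M) (r + N) - trap_sum f h M (r + N))
     <= B / al * (exp (- (al * (INR M * h))) - exp (- (al * (INR (p + M) * h))))).
  { clear Hr. set (N' := (r + N)%nat). induction p as [|p IH].
    - rewrite Nat.add_0_l. replace (trap_sum f h M N' - trap_sum f h M N')%C with (RtoC 0) by ring.
      rewrite Cmod_0. right. ring.
    - rewrite Nat.add_succ_l, trap_sum_left.
      replace (trap_sum f h (p + M) N' + RtoC h * f (- (INR (S (p + M)) * h))%R - trap_sum f h M N')%C
        with ((trap_sum f h (p + M) N' - trap_sum f h M N') + RtoC h * f (- (INR (S (p + M)) * h))%R)%C by ring.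
      eapply Rle_trans; [apply Cmod_triangle|]. rewrite Cmod_mult, Cmod_R, Rabs_pos_eq by lra.
      pose proof (exp_step_bound al h (p + M) Hal Hh) as H1.
      pose proof (Ha (- (INR (S (p + M)) * h))) as H2.
      replace (al * - (INR (S (p + M)) * h)) with (- (al * (INR (S (p + M)) * h))) in H2 by ring.
      set (e1 := exp (- (al * (INR (S (p + M)) * h)))) in *.
      set (e0 := exp (- (al * (INR (p + M) * h)))) in *.
      assert (h * (B * e1) <= B / al * (e0 - e1)).
      { apply Rmult_le_compat_l with (r := B) in H1; auto. unfold Rdiv. nra. }
      assert (h * Cmod (f (- (INR (S (p + M)) * h))) <= h * (B * e1)) by (apply Rmult_le_compat_l; lra).
      lra. }
  replace (trap_sum f h (p + M) (r + N) - trap_sum f h M N)%C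
    with ((trap_sum f h (p + M) (r + N) - trap_sum f h M (r + N)) + (trap_sum f h M (r + N) - trap_sum f h M N))%C by ring.
  eapply Rle_trans; [apply Cmod_triangle|].
  assert (0 <= B / al) by (apply Rmult_le_pos; auto; now apply Rlt_le, Rinv_0_lt_compat).
  assert (0 <= B / be) by (apply Rmult_le_pos; auto; now apply Rlt_le, Rinv_0_lt_compat).
  pose proof (exp_pos (- (al * (INR (p + M) * h)))). pose proof (exp_pos (- (be * (INR (r + N) * h)))).
  nra.
Qed.

Lemma is_RInt_exp_abs (A mu X : R) : 0 < mu -> 0 < X ->
  is_RInt (fun x => A * exp (- (mu * Rabs x))) (- X) X (2 * A / mu * (1 - exp (- (mu * X)))).
Proof.
  intros Hmu HX.
  replace (2 * A / mu * (1 - exp (- (mu * X)))) with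
    (plus (G := R_AbelianGroup) (A / mu * (1 - exp (- (mu * X)))) (A / mu * (1 - exp (- (mu * X)))))
    by (unfold plus; simpl; field; lra).
  apply (is_RInt_Chasles (V := R_NormedModule)) with 0.
  - apply (is_RInt_ext (V := R_NormedModule) (fun x => A * exp (mu * x))).
    { rewrite Rmin_left, Rmax_right by lra. intros x Hx. rewrite Rabs_left by lra. f_equal. f_equal. ring. }
    replace (A / mu * (1 - exp (- (mu * X))))
      with (minus (G := R_AbelianGroup) (A / mu * exp (mu * 0)) (A / mu * exp (mu * - X))).
    + apply (is_RInt_derive (V := R_CompleteNormedModule) (fun x => A / mu * exp (mu * x))).
      * intros x _. auto_derive; auto. field. lra.
      * intros x _. apply (continuous_scal_r A (fun x => exp (mu * x))).
        apply (continuous_comp (fun t => mu * t) exp); [apply continuous_scale|apply continuous_exp].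
    + unfold minus, plus, opp; simpl. rewrite Rmult_0_r, exp_0.
      replace (mu * - X) with (- (mu * X)) by ring. ring.
  - apply (is_RInt_ext (V := R_NormedModule) (fun x => A * exp (- mu * x))).
    { rewrite Rmin_left, Rmax_right by lra. intros x Hx. rewrite Rabs_pos_eq by lra. f_equal. f_equal. ring. }
    replace (A / mu * (1 - exp (- (mu * X))))
      with (minus (G := R_AbelianGroup) (- A / mu * exp (- mu * X)) (- A / mu * exp (- mu * 0))).
    + apply (is_RInt_derive (V := R_CompleteNormedModule) (fun x => - A / mu * exp (- mu * x))).
      * intros x _. auto_derive; auto. field. lra.
      * intros x _. apply (continuous_scal_r A (fun x => exp (- mu * x))).
        apply (continuous_comp (fun t => - mu * t) exp); [apply continuous_scale|apply continuous_exp].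
    + unfold minus, plus, opp; simpl. rewrite Rmult_0_r, exp_0.
      replace (- mu * X) with (- (mu * X)) by ring. field. lra.
Qed.

(** A long symmetric sum over [-L..L] stands between the integral and the truncated sum. Three
    errors arise: the tail of the integral, the discretization on [[- X, X]], and the omitted nodes;
    whatever depends on [L] vanishes as [L] grows. *)
Lemma trapezoid_closed_strip (F : C -> C) (I : C) (d h A B al be mu : R) (M N : nat) :
  0 < d -> 0 < h -> 0 < mu -> mu <= al -> mu <= be -> 0 <= A -> 0 <= B ->
  (forall x y, - d <= y <= d -> cdiff F (x, y)) ->
  (forall x y, - d <= y <= d -> Cmod (F (x, y)) <= A * exp (- (mu * Rabs x))) ->
  (forall x : R, Cmod (F (RtoC x)) <= B * exp (al * x)) ->
  (forall x : R, Cmod (F (RtoC x)) <= B * exp (- be * x)) ->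
  (forall u v, u <= v -> Cmod (CInt (fun x => F (RtoC x)) u v - I)
      <= B / al * exp (al * u) + B / be * exp (- be * v)) ->
  Cmod (I - trap_sum (fun x => F (RtoC x)) h M N)
    <= 4 * A / mu * (exp (- (2 * PI * d / h)) / (1 - exp (- (2 * PI * d / h))))
       + (B / al * exp (- (al * (INR M * h))) + B / be * exp (- (be * (INR N * h)))).
Proof.
  intros Hd Hh Hmu Hal Hbe HA0 HB0 HF HA Ha Hb HI. pose proof PI_RGT_0 as HPI.
  set (Q := exp (- (2 * PI * d / h)) / (1 - exp (- (2 * PI * d / h)))).
  assert (HQ : 0 <= Q).
  { assert (exp (- (2 * PI * d / h)) < 1).
    { rewrite <- exp_0. apply exp_increasing. assert (0 < 2 * PI * d / h); [|lra].
      apply Rdiv_lt_0_compat; auto. nra. }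
    apply Rmult_le_pos; [apply Rlt_le, exp_pos|]. apply Rlt_le, Rinv_0_lt_compat. lra. }
  assert (Hq : forall c, 0 < c -> 0 <= B / c).
  { intros c Hc. apply Rmult_le_pos; auto. now apply Rlt_le, Rinv_0_lt_compat. }
  set (f := fun x : R => F (RtoC x)) in *.
  apply le_epsilon. intros eps He.
  (* Collects the coefficients of [e]: four vertical sides of length [d], then the two tails of the
     integral; the 1 keeps it positive. *)
  set (C0 := 4 * d * A + B / al + B / be + 1).
  pose proof (Hq al ltac:(lra)) as Hqa. pose proof (Hq be ltac:(lra)) as Hqb.
  assert (HC0 : 0 < C0) by (unfold C0; nra).
  destruct (exp_decay_small mu (eps / C0)) as [X0 [_ HX0]]; auto.
  { now apply Rdiv_lt_0_compat. }
  destruct (INR_unbounded (X0 / h)) as [L0 HL0].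
  (* Including [M + N] makes the natural subtractions [L - M] and [L - N] below exact. *)
  set (L := (L0 + (M + N))%nat).
  set (X := (INR L + 1 / 2) * h).
  assert (HX0X : X0 <= X).
  { unfold X. assert (INR L0 <= INR L) by (apply le_INR; lia).
    assert (X0 / h * h = X0) by (field; lra). nra. }
  assert (HX : 0 < X) by (unfold X; pose proof (pos_INR L); nra).
  assert (Hev : exp (- (mu * X)) <= eps / C0) by auto.
  set (e := exp (- (mu * X))) in *.
  assert (He0 : 0 < e) by apply exp_pos.
  assert (Hmain : Cmod (CInt f (- X) X - trap_sum f h L L) <= 2 * (Q * (2 * A / mu * (1 - e)) + 2 * d * (A * e))).
  { apply (trapezoid_bounded F h d (A * e) _ (fun x => A * exp (- (mu * Rabs x)))); auto.
    - intros y Hy. split; (eapply Rle_trans; [apply HA; auto|]); fold X;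
        rewrite ?Rabs_Ropp, Rabs_pos_eq by lra; unfold e; lra.
    - intros x Hx. split; [apply HA; lra|]. eapply Rle_trans; [apply HA; lra|]. rewrite Rabs_Ropp. lra.
    - now apply is_RInt_exp_abs. }
  pose proof (HI (- X) X ltac:(lra)) as HIX.
  assert (Htr : Cmod (trap_sum f h L L - trap_sum f h M N)
     <= B / al * exp (- (al * (INR M * h))) + B / be * exp (- (be * (INR N * h)))).
  { replace (trap_sum f h L L) with (trap_sum f h ((L - M) + M) ((L - N) + N)).
    - apply truncation_bound; auto; lra.
    - f_equal; unfold L; lia. }
  replace (I - trap_sum f h M N)%C with
    (- (CInt f (- X) X - I) + (CInt f (- X) X - trap_sum f h L L) + (trap_sum f h L L - trap_sum f h M N))%C by ring.
  eapply Rle_trans; [apply Cmod_triangle|].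
  pose proof (Cmod_triangle (- (CInt f (- X) X - I)) (CInt f (- X) X - trap_sum f h L L)) as H3.
  rewrite Cmod_opp in H3.
  assert (E1 : exp (al * - X) <= e) by (apply exp_le_compat; nra).
  assert (E2 : exp (- be * X) <= e) by (apply exp_le_compat; nra).
  assert (E3 : C0 * e <= eps).
  { apply Rmult_le_compat_l with (r := C0) in Hev; [|lra].
    replace (C0 * (eps / C0)) with eps in Hev by (field; lra). exact Hev. }
  assert (E4 : B / al * exp (al * - X) <= B / al * e) by now apply Rmult_le_compat_l.
  assert (E5 : B / be * exp (- be * X) <= B / be * e) by now apply Rmult_le_compat_l.
  assert (HAm : 0 <= 2 * A / mu) by (apply Rmult_le_pos; [lra|now apply Rlt_le, Rinv_0_lt_compat]).
  assert (E6 : Q * (2 * A / mu * (1 - e)) <= Q * (2 * A / mu)).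
  { apply Rmult_le_compat_l; auto. nra. }
  replace (4 * A / mu * Q) with (2 * (Q * (2 * A / mu))) by (field; lra).
  assert (Ex : C0 * e = 4 * d * (A * e) + B / al * e + B / be * e + e) by (unfold C0; ring).
  lra.
Qed.

(** The hypotheses are given on the open strip only, so the closed result is applied to widths
    increasing to [d]; its bound is continuous in the width. *)
Lemma trapezoid_strip (F : C -> C) (I : C) (d h A B al be mu : R) (M N : nat) :
  0 < d -> 0 < h -> 0 < mu -> mu <= al -> mu <= be -> 0 <= A -> 0 <= B ->
  (forall x y, - d < y < d -> cdiff F (x, y)) ->
  (forall x y, - d < y < d -> Cmod (F (x, y)) <= A * exp (- (mu * Rabs x))) ->
  (forall x : R, Cmod (F (RtoC x)) <= B * exp (al * x)) ->
  (forall x : R, Cmod (F (RtoC x)) <= B * exp (- be * x)) ->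
  (forall u v, u <= v -> Cmod (CInt (fun x => F (RtoC x)) u v - I)
      <= B / al * exp (al * u) + B / be * exp (- be * v)) ->
  Cmod (I - trap_sum (fun x => F (RtoC x)) h M N)
    <= 4 * A / mu * (exp (- (2 * PI * d / h)) / (1 - exp (- (2 * PI * d / h))))
       + (B / al * exp (- (al * (INR M * h))) + B / be * exp (- (be * (INR N * h)))).
Proof.
  intros Hd Hh Hmu Hal Hbe HA0 HB0 HF HA Ha Hb HI. pose proof PI_RGT_0 as HPI.
  set (tr := B / al * exp (- (al * (INR M * h))) + B / be * exp (- (be * (INR N * h)))).
  set (g := fun t => 4 * A / mu * (exp (- (2 * PI * t / h)) / (1 - exp (- (2 * PI * t / h)))) + tr).
  (* The divisor is [n + 2], so already the first width, [d / 2], is positive. *)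
  set (dn := fun n => d + - (d * / (INR (S n) + 1))).
  assert (Hdn : forall n, 0 < dn n < d).
  { intros n. unfold dn. pose proof (pos_INR n). rewrite S_INR.
    assert (0 < / (INR n + 1 + 1) < 1).
    { split; [apply Rinv_0_lt_compat; lra|]. rewrite <- Rinv_1. apply Rinv_lt_contravar; lra. }
    nra. }
  assert (Hlim : is_lim_seq dn d).
  { unfold dn. replace (Finite d) with (Finite (d + - (d * 0))) by (f_equal; ring).
    apply is_lim_seq_plus'; [apply is_lim_seq_const|].
    apply (is_lim_seq_opp (fun n => d * / (INR (S n) + 1)) (d * 0)).
    apply (is_lim_seq_scal_l (fun n => / (INR (S n) + 1)) d 0).
    apply (is_lim_seq_incr_1 (fun n => / (INR n + 1))).
    replace (Finite 0) with (Rbar_inv p_infty) by reflexivity.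
    apply is_lim_seq_inv; [|discriminate].
    apply (is_lim_seq_plus _ _ p_infty 1); [apply is_lim_seq_INR|apply is_lim_seq_const|reflexivity]. }
  assert (Hg : continuity_pt g d).
  { apply continuity_pt_filterlim, (ex_derive_continuous (V := R_NormedModule)).
    unfold g. auto_derive. apply Rgt_not_eq.
    assert (exp (- (2 * PI * d / h)) < 1); [|unfold Rdiv in *; lra].
    rewrite <- exp_0. apply exp_increasing. assert (0 < 2 * PI * d / h); [|lra].
    apply Rdiv_lt_0_compat; auto. nra. }
  apply (is_lim_seq_le (fun _ => Cmod (I - trap_sum (fun x => F (RtoC x)) h M N)) (fun n => g (dn n))
    (Cmod (I - trap_sum (fun x => F (RtoC x)) h M N)) (g d)).
  - intros n. specialize (Hdn n). unfold g, tr. apply trapezoid_closed_strip; auto; try lra.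
    + intros x y Hy. apply HF; lra.
    + intros x y Hy. apply HA; lra.
  - apply is_lim_seq_const.
  - now apply is_lim_seq_continuous.
Qed.

(** * Principal logarithm, square root and inverse hyperbolic sine *)

Lemma Cmod_atan (x y : R) : x <> 0 -> Cmod (x, y) = Rabs x * sqrt (1 + (y / x)²).
Proof.
  intros Hx. unfold Cmod; simpl fst; simpl snd. rewrite <- sqrt_Rsqr_abs, <- sqrt_mult_alt by apply Rle_0_sqr.
  f_equal. unfold Rsqr. field. auto.
Qed.

Lemma cis_Carg (z : C) : z <> 0 -> (RtoC (Cmod z) * cis (Carg z))%C = z.
Proof.
  intros Hz. destruct z as [x y]. unfold Carg; simpl fst; simpl snd; cbv zeta.
  assert (Hs : forall t : R, 0 < sqrt (1 + t²)).
  { intros t. apply sqrt_lt_R0. pose proof (Rle_0_sqr t). lra. }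
  destruct (Rlt_dec 0 x) as [Hx|Hx]; [|destruct (Rlt_dec x 0) as [Hx'|Hx']].
  - rewrite Cmod_atan, Rabs_pos_eq by lra. specialize (Hs (y / x)).
    unfold cis. rewrite cos_atan, sin_atan.
    apply injective_projections; simpl; field; lra.
  - rewrite Cmod_atan, Rabs_left by lra. specialize (Hs (y / x)).
    destruct (Rle_dec 0 y) as [Hy|Hy]; unfold cis.
    + rewrite neg_cos, neg_sin, cos_atan, sin_atan.
      apply injective_projections; simpl; field; lra.
    + rewrite cos_minus, sin_minus, cos_PI, sin_PI, cos_atan, sin_atan.
      apply injective_projections; simpl; field; lra.
  - assert (x = 0) by lra. subst x.
    assert (E : Cmod (0, y) = Rabs y).
    { unfold Cmod; simpl. rewrite <- sqrt_Rsqr_abs. f_equal. unfold Rsqr. ring. }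
    rewrite E. destruct (Rlt_dec 0 y) as [Hy|Hy]; [|destruct (Rlt_dec y 0) as [Hy'|Hy']]; unfold cis.
    + rewrite cos_PI2, sin_PI2, Rabs_pos_eq by lra. apply injective_projections; simpl; ring.
    + rewrite cos_neg, sin_neg, cos_PI2, sin_PI2, Rabs_left by lra. apply injective_projections; simpl; ring.
    + exfalso. apply Hz. apply injective_projections; simpl; lra.
Qed.

Lemma Cexp_Clog (z : C) : z <> 0 -> Cexp (Clog z) = z.
Proof.
  intros Hz. unfold Clog. rewrite Cexp_cis, exp_ln by now apply Cmod_gt_0. now apply cis_Carg.
Qed.

Lemma Cmod_Cpow (z : C) (p : R) : z <> 0 -> Cmod (Defs.Cpow z (RtoC p)) = exp (p * ln (Cmod z)).
Proof.
  intros Hz. unfold Defs.Cpow. destruct (Ceq_dec z 0); [congruence|].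
  rewrite Cmod_Cexp. f_equal. unfold Clog, RtoC, Cmult; simpl. ring.
Qed.

(** The value [PI] is reached only on the negative real axis. Strictness off that axis is what makes
    the real part of the square root positive. *)
Lemma Carg_bounds (z : C) : - PI < Carg z <= PI /\ (0 < fst z \/ snd z <> 0 -> Carg z < PI).
Proof.
  destruct z as [x y]. unfold Carg; simpl fst; simpl snd; cbv zeta. pose proof PI_RGT_0.
  pose proof (atan_bound (y / x)) as Hb.
  destruct (Rlt_dec 0 x) as [Hx|Hx]; [lra|destruct (Rlt_dec x 0) as [Hx'|Hx']].
  - destruct (Rle_dec 0 y) as [Hy|Hy].
    + assert (y / x <= 0).
      { unfold Rdiv. pose proof (Rinv_lt_0_compat x Hx'). nra. }
      assert (atan (y / x) <= 0).
      { rewrite <- atan_0. destruct (Req_dec (y / x) 0) as [->|]; [lra|]. left. apply atan_increasing. lra. }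
      split; [lra|]. intros [|Hy0]; [lra|].
      assert (y / x < 0). { unfold Rdiv. pose proof (Rinv_lt_0_compat x Hx'). nra. }
      assert (atan (y / x) < 0); [|lra]. rewrite <- atan_0. now apply atan_increasing.
    + assert (0 < y / x). { unfold Rdiv. pose proof (Rinv_lt_0_compat x Hx'). nra. }
      assert (0 < atan (y / x)); [|lra]. rewrite <- atan_0. now apply atan_increasing.
  - destruct (Rlt_dec 0 y); [lra|]. destruct (Rlt_dec y 0); lra.
Qed.

Lemma Csqrt_eq (z : C) : z <> 0 ->
  Csqrt z = (RtoC (exp (ln (Cmod z) / 2)) * cis (Carg z / 2))%C.
Proof.
  intros Hz. unfold Csqrt, Defs.Cpow. destruct (Ceq_dec z 0); [congruence|].
  rewrite <- Cexp_cis. f_equal. unfold Clog, RtoC, Cmult; apply injective_projections; simpl; field.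
Qed.

Lemma Csqrt_sqr (z : C) : (Csqrt z * Csqrt z)%C = z.
Proof.
  destruct (Ceq_dec z 0) as [->|Hz].
  - unfold Csqrt, Defs.Cpow. destruct (Ceq_dec 0 0); [ring|congruence].
  - rewrite Csqrt_eq by auto.
    transitivity (RtoC (exp (ln (Cmod z) / 2) * exp (ln (Cmod z) / 2)) * (cis (Carg z / 2) * cis (Carg z / 2)))%C.
    + rewrite RtoC_mult. ring.
    + rewrite <- exp_plus, <- cis_plus.
      replace (ln (Cmod z) / 2 + ln (Cmod z) / 2) with (ln (Cmod z)) by field.
      replace (Carg z / 2 + Carg z / 2) with (Carg z) by field.
      rewrite exp_ln by now apply Cmod_gt_0. now apply cis_Carg.
Qed.

Lemma Re_Csqrt_nonneg (z : C) : 0 <= fst (Csqrt z).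
Proof.
  destruct (Ceq_dec z 0) as [->|Hz].
  - unfold Csqrt, Defs.Cpow. destruct (Ceq_dec 0 0); [simpl; lra|congruence].
  - rewrite Csqrt_eq by auto. simpl. rewrite Rmult_0_l, Rminus_0_r.
    apply Rmult_le_pos; [apply Rlt_le, exp_pos|]. destruct (Carg_bounds z) as [H _].
    apply cos_ge_0; lra.
Qed.

Lemma Re_Csqrt_pos (z : C) : 0 < fst z \/ snd z <> 0 -> 0 < fst (Csqrt z).
Proof.
  intros H. assert (Hz : z <> 0) by (intros ->; simpl in H; lra).
  rewrite Csqrt_eq by auto. simpl. rewrite Rmult_0_l, Rminus_0_r.
  apply Rmult_lt_0_compat; [apply exp_pos|]. destruct (Carg_bounds z) as [H1 H2]. specialize (H2 H).
  apply cos_gt_0; lra.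
Qed.

(** From [(s - s0) * (s + s0) = z - z0] and [Re s >= 0], whence [Cmod (s + s0) >= Re s0]. Continuity
    of the root thus follows without continuity of the argument. *)
Lemma Csqrt_lipschitz (z z0 : C) : 0 < fst (Csqrt z0) ->
  Cmod (Csqrt z - Csqrt z0) <= Cmod (z - z0) / fst (Csqrt z0).
Proof.
  intros H0. set (s := Csqrt z). set (s0 := Csqrt z0) in *.
  assert (E : ((s - s0) * (s + s0))%C = (z - z0)%C).
  { unfold s, s0. rewrite <- (Csqrt_sqr z) at 3. rewrite <- (Csqrt_sqr z0) at 3. ring. }
  rewrite <- E, Cmod_mult.
  assert (Hs : fst s0 <= Cmod (s + s0)).
  { eapply Rle_trans; [|apply Rabs_fst_le]. simpl. pose proof (Re_Csqrt_nonneg z). fold s in H.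
    rewrite Rabs_pos_eq; lra. }
  apply Rmult_le_reg_r with (fst s0); auto. unfold Rdiv. rewrite Rmult_assoc, Rinv_l, Rmult_1_r by lra.
  apply Rmult_le_compat_l; auto. apply Cmod_ge_0.
Qed.

Lemma cdiff_Csqrt (g : C -> C) (z : C) : 0 < fst (g z) \/ snd (g z) <> 0 -> cdiff g z ->
  cdiff (fun w => Csqrt (g w)) z.
Proof.
  intros Hs Hg. pose proof (Re_Csqrt_pos _ Hs) as H0.
  apply (cdiff_inverse (fun u => (u * u)%C) (fun w => Csqrt (g w)) g); auto.
  - apply continuous_C_eps. intros eps He.
    assert (He' : 0 < eps * fst (Csqrt (g z))) by nra.
    generalize (proj1 (continuous_C_eps _ _) (cdiff_continuous g z Hg) _ He').
    apply filter_imp. intros w Hw. eapply Rle_lt_trans; [now apply Csqrt_lipschitz|].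
    apply Rmult_lt_reg_r with (fst (Csqrt (g z))); auto.
    unfold Rdiv. rewrite Rmult_assoc, Rinv_l by lra. lra.
  - intros w. apply Csqrt_sqr.
  - exists (fun u => (u + Csqrt (g z))%C). split; [|split].
    + apply continuous_Cplus; [apply continuous_id|apply continuous_const].
    + intros E. apply (f_equal fst) in E. simpl in E. lra.
    + intros u. ring.
Qed.

(** In the right half plane the argument is [atan (y / x)], and this branch persists nearby. *)
Lemma continuous_Clog (g : C -> C) (z : C) : 0 < fst (g z) -> ccontinuous g z ->
  ccontinuous (fun w => Clog (g w)) z.
Proof.
  intros H0 Hg.
  pose proof (continuous_C_fst g z Hg) as H1. pose proof (continuous_C_snd g z Hg) as H2.
  apply continuous_C_pair; simpl.
  - apply (continuous_comp (fun w => Cmod (g w)) ln); [now apply continuous_Cmod|].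
    apply continuity_pt_filterlim. apply derivable_continuous_pt. eexists. apply derivable_pt_lim_ln.
    apply Cmod_gt_0. intros E. rewrite E in H0. simpl in H0. lra.
  - apply continuous_ext_loc with (fun w => atan (snd (g w) * / fst (g w))).
    + assert (Hl : locally (T := C_UniformSpace) z (fun w => 0 < fst (g w))) by exact (H1 (fun t => 0 < t) (open_gt 0 _ H0)).
      revert Hl. apply filter_imp.
      intros w Hw. unfold Carg. cbv zeta. destruct (Rlt_dec 0 (fst (g w))) as [_|n]; [reflexivity|contradiction].
    + apply (continuous_comp (fun w => snd (g w) * / fst (g w)) atan).
      * apply (continuous_mult (K := R_AbsRing)); auto.
        apply (continuous_comp (fun w => fst (g w)) Rinv); auto. apply continuous_Rinv. lra.
      * apply (ex_derive_continuous (V := R_NormedModule)). eexists.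
        apply is_derive_atan.
Qed.

(** [w + s] has the inverse [s - w], because [s * s - w * w = 1]. *)
Lemma Casinh_arg_neq_0 (w : C) : (w + Csqrt (w * w + 1))%C <> 0.
Proof.
  intros E. set (s := Csqrt (w * w + 1)) in *.
  assert (Es : (s * s)%C = (w * w + 1)%C) by apply Csqrt_sqr.
  assert (H : ((w + s) * (s - w))%C = 1).
  { replace ((w + s) * (s - w))%C with (s * s - w * w)%C by ring. rewrite Es. ring. }
  rewrite E, Cmult_0_l in H. apply (f_equal fst) in H. simpl in H. lra.
Qed.

Lemma slit_sqr_plus_1 (w : C) : 0 < fst w -> 0 < fst (w * w + 1)%C \/ snd (w * w + 1)%C <> 0.
Proof.
  destruct w as [u v]; simpl. intros Hu. destruct (Req_dec v 0) as [->|Hv].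
  - left. nra.
  - right. nra.
Qed.

(** The hyperbolic cosine of [psiC 3 zeta]; it is the denominator of the derivative of arcsinh after
    exp. *)
Definition cosh_asinh (zeta : C) : C := Csqrt (Cexp zeta * Cexp zeta + 1).

Lemma Re_Cexp_pos (zeta : C) : - (PI / 2) < snd zeta < PI / 2 -> 0 < fst (Cexp zeta).
Proof. intros H. simpl. apply Rmult_lt_0_compat; [apply exp_pos|]. apply cos_gt_0; lra. Qed.

Lemma Re_cosh_asinh_pos (zeta : C) : - (PI / 2) < snd zeta < PI / 2 -> 0 < fst (cosh_asinh zeta).
Proof. intros H. apply Re_Csqrt_pos, slit_sqr_plus_1. now apply Re_Cexp_pos. Qed.

Lemma cdiff_cosh_asinh (zeta : C) : - (PI / 2) < snd zeta < PI / 2 -> cdiff cosh_asinh zeta.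
Proof.
  intros H. apply (cdiff_Csqrt (fun z => (Cexp z * Cexp z + 1)%C)).
  - apply slit_sqr_plus_1. now apply Re_Cexp_pos.
  - apply cdiff_plus; [|apply cdiff_const]. apply cdiff_mult; apply cdiff_Cexp.
Qed.

(** The exponential of [psiC 3] is [Cexp z + cosh_asinh z] everywhere, so the inverse function rule
    applies; both summands have positive real part in the strip, which gives continuity of the
    logarithm. *)
Lemma cdiff_psi3 (zeta : C) : - (PI / 2) < snd zeta < PI / 2 -> cdiff (psiC 3) zeta.
Proof.
  intros H. assert (Hd : cdiff (fun z => (Cexp z + cosh_asinh z)%C) zeta).
  { apply cdiff_plus; [apply cdiff_Cexp|now apply cdiff_cosh_asinh]. }
  apply (cdiff_inverse Cexp (psiC 3) (fun z => (Cexp z + cosh_asinh z)%C)); auto.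
  - apply (continuous_Clog (fun z => (Cexp z + cosh_asinh z)%C)); [|now apply cdiff_continuous].
    pose proof (Re_Cexp_pos zeta H). pose proof (Re_cosh_asinh_pos zeta H).
    change (0 < fst (Cexp zeta) + fst (cosh_asinh zeta)). lra.
  - intros w. apply Cexp_Clog, Casinh_arg_neq_0.
  - destruct (Cexp_slope (psiC 3 zeta)) as [P [H1 [H2 H3]]]. exists P. split; [|split]; auto.
    rewrite H2. apply Cexp_neq_0.
Qed.

(** With [w = Cexp zeta], [s = cosh_asinh zeta] and [z = psiC 3 zeta]: [Cexp z = w + s] and
    [Cexp (- z) = s - w]. Half their difference and half their sum give [w = sinh z] and
    [s = cosh z], split into parts. Positivity of [Re w] then forces [a > 0]. *)
Lemma psi3_hyperbolic (zeta : C) : - (PI / 2) < snd zeta < PI / 2 ->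
  let a := fst (psiC 3 zeta) in let b := snd (psiC 3 zeta) in
  Cexp zeta = (sinh a * cos b, cosh a * sin b) /\
  cosh_asinh zeta = (cosh a * cos b, sinh a * sin b) /\
  0 < a /\ - (PI / 2) < b < PI / 2.
Proof.
  intros H a b. set (w := Cexp zeta) in *. set (s := cosh_asinh zeta) in *. set (z := psiC 3 zeta) in *.
  assert (Hw : 0 < fst w) by now apply Re_Cexp_pos.
  assert (Hs : 0 < fst s) by now apply Re_cosh_asinh_pos.
  assert (E1 : Cexp z = (w + s)%C) by apply Cexp_Clog, Casinh_arg_neq_0.
  assert (Hprod : ((w + s) * (s - w))%C = 1).
  { replace ((w + s) * (s - w))%C with (s * s - w * w)%C by ring.
    replace (s * s)%C with (w * w + 1)%C by (symmetry; apply Csqrt_sqr). ring. }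
  assert (E2 : Cexp (- z) = (s - w)%C).
  { pose proof (Cexp_opp z) as H1.
    replace (Cexp (- z)) with ((w + s) * (s - w) * Cexp (- z))%C by (rewrite Hprod; ring).
    replace ((w + s) * (s - w) * Cexp (- z))%C with ((Cexp z * Cexp (- z)) * (s - w))%C by (rewrite E1; ring).
    rewrite H1. ring. }
  assert (Hb : - (PI / 2) < b < PI / 2).
  { unfold b, z. change (snd (psiC 3 zeta)) with (Carg (w + s)%C). unfold Carg. cbv zeta.
    assert (0 < fst (w + s)%C) by (change (0 < fst w + fst s); lra).
    destruct (Rlt_dec 0 (fst (w + s)%C)); [|contradiction]. pose proof (atan_bound (snd (w + s)%C / fst (w + s)%C)). lra. }
  clearbody w s.
  pose proof (f_equal fst E1) as F1. pose proof (f_equal snd E1) as F2.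
  pose proof (f_equal fst E2) as F3. pose proof (f_equal snd E2) as F4.
  change (exp a * cos b = fst w + fst s) in F1. change (exp a * sin b = snd w + snd s) in F2.
  change (exp (- a) * cos (- b) = fst s - fst w) in F3. change (exp (- a) * sin (- b) = snd s - snd w) in F4.
  rewrite cos_neg in F3. rewrite sin_neg in F4.
  assert (Ew : w = (sinh a * cos b, cosh a * sin b)).
  { apply injective_projections; simpl; unfold sinh, cosh; lra. }
  assert (Es : s = (cosh a * cos b, sinh a * sin b)).
  { apply injective_projections; simpl; unfold sinh, cosh; lra. }
  repeat split; auto; try lra.
  assert (Hc : 0 < cos b) by (apply cos_gt_0; lra).
  assert (Hsh : 0 < sinh a * cos b) by (rewrite Ew in Hw; exact Hw).
  assert (0 < sinh a) by nra. unfold sinh in *.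
  destruct (Rle_lt_dec a 0) as [Ha|]; auto. exfalso.
  pose proof (exp_le_compat a (- a) ltac:(lra)). lra.
Qed.

Lemma psi3_real (x : R) : psiC 3 (RtoC x) = RtoC (psiR 3 x) /\
  cosh_asinh (RtoC x) = RtoC (sqrt (exp x * exp x + 1)).
Proof.
  assert (Hv : 0 < exp x * exp x + 1) by (pose proof (exp_pos x); nra).
  assert (Es : cosh_asinh (RtoC x) = RtoC (sqrt (exp x * exp x + 1))).
  { unfold cosh_asinh. rewrite Cexp_RtoC, <- RtoC_mult, <- RtoC_plus.
    set (v := exp x * exp x + 1) in *.
    assert (Hn : RtoC v <> 0) by (intros E; apply RtoC_inj in E; lra).
    rewrite Csqrt_eq by auto. rewrite Cmod_R, Rabs_pos_eq by lra.
    replace (Carg (RtoC v)) with 0.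
    - replace (0 / 2) with 0 by field. rewrite cis_0, Cmult_1_r. f_equal.
      replace (ln v / 2) with (/ 2 * ln v) by field. change (Rpower v (/ 2) = sqrt v). now apply Rpower_sqrt.
    - unfold Carg; simpl. destruct (Rlt_dec 0 v); [|contradiction].
      unfold Rdiv. now rewrite Rmult_0_l, atan_0. }
  split; auto.
  unfold psiC, psiR; simpl. unfold Casinh. change (Csqrt (Cexp (RtoC x) * Cexp (RtoC x) + 1)) with (cosh_asinh (RtoC x)).
  rewrite Es, Cexp_RtoC, <- RtoC_plus. set (v := exp x + sqrt (exp x * exp x + 1)).
  assert (0 < v) by (unfold v; pose proof (exp_pos x); pose proof (sqrt_pos (exp x * exp x + 1)); lra).
  unfold Clog. rewrite Cmod_R, Rabs_pos_eq by lra.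
  apply injective_projections; simpl; auto.
  unfold Carg; simpl. destruct (Rlt_dec 0 v); [|contradiction]. unfold Rdiv. now rewrite Rmult_0_l, atan_0.
Qed.

(** * Elementary inequalities for the inverse hyperbolic sine *)

Lemma le_of_derive_nonneg (f df : R -> R) (x : R) : 0 <= x ->
  (forall t, 0 <= t <= x -> is_derive f t (df t)) ->
  (forall t, 0 <= t <= x -> 0 <= df t) -> f 0 <= f x.
Proof.
  intros Hx Hd Hp.
  destruct (MVT_gen f 0 x df) as [c [Hc E]].
  - rewrite Rmin_left, Rmax_right by lra. intros t Ht. apply Hd. lra.
  - rewrite Rmin_left, Rmax_right by lra. intros t Ht. apply continuity_pt_filterlim.
    apply (ex_derive_continuous (V := R_NormedModule)). eexists. now apply Hd.
  - rewrite Rmin_left, Rmax_right in Hc by lra. pose proof (Hp c Hc). nra.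
Qed.

Lemma mult_cos_le_sin (b : R) : 0 <= b <= PI / 2 -> b * cos b <= sin b.
Proof.
  intros Hb. pose proof PI_RGT_0.
  pose proof (le_of_derive_nonneg (fun t => sin t - t * cos t) (fun t => t * sin t) b (proj1 Hb)) as H1.
  simpl in H1. rewrite sin_0, cos_0 in H1.
  assert (0 - 0 * 1 <= sin b - b * cos b); [|lra]. apply H1.
  - intros t Ht. auto_derive; auto. ring.
  - intros t Ht. apply Rmult_le_pos; [lra|]. apply sin_ge_0; lra.
Qed.

(** A form of [Rabs b <= Rabs (tan b)]: replace [cos b ^ 2] by [1 - sin b ^ 2] in
    [b ^ 2 * cos b ^ 2 <= sin b ^ 2]. *)
Lemma sqr_le_sin_sqr (b : R) : - (PI / 2) < b < PI / 2 -> b ^ 2 <= sin b ^ 2 * (1 + b ^ 2).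
Proof.
  intros Hb.
  assert (H : forall t, 0 <= t < PI / 2 -> t ^ 2 <= sin t ^ 2 * (1 + t ^ 2)).
  { intros t Ht. pose proof (mult_cos_le_sin t ltac:(lra)). pose proof (cos_ge_0 t ltac:(lra) ltac:(lra)).
    pose proof (sin2_cos2 t) as E. unfold Rsqr in E.
    assert ((t * cos t) ^ 2 <= sin t ^ 2) by (apply pow_incr; split; [apply Rmult_le_pos; lra|lra]). nra. }
  destruct (Rle_dec 0 b); [apply H; lra|].
  pose proof (H (- b) ltac:(lra)) as H1. rewrite sin_neg in H1.
  replace ((- b) ^ 2) with (b ^ 2) in H1 by ring. replace ((- sin b) ^ 2) with (sin b ^ 2) in H1 by ring. exact H1.
Qed.

Lemma sin_sqr_le (b : R) : sin b ^ 2 <= b ^ 2.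
Proof.
  assert (H : forall t, 0 <= t -> - t <= sin t <= t).
  { intros t Ht. split.
    - pose proof (le_of_derive_nonneg (fun t => sin t + t) (fun t => cos t + 1) t Ht) as H1.
      simpl in H1. rewrite sin_0 in H1. assert (0 + 0 <= sin t + t); [|lra]. apply H1.
      + intros s Hs. auto_derive; auto. ring. + intros s Hs. pose proof (COS_bound s). lra.
    - pose proof (le_of_derive_nonneg (fun t => t - sin t) (fun t => 1 - cos t) t Ht) as H1.
      simpl in H1. rewrite sin_0 in H1. assert (0 - 0 <= t - sin t); [|lra]. apply H1.
      + intros s Hs. auto_derive; auto. ring. + intros s Hs. pose proof (COS_bound s). lra. }
  destruct (Rle_dec 0 b).
  - pose proof (H b ltac:(lra)). nra.
  - pose proof (H (- b) ltac:(lra)) as H1. rewrite sin_neg in H1. nra.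
Qed.

Lemma cos_ge_half (b : R) : b ^ 2 <= 1 -> 1 / 2 <= cos b.
Proof.
  intros Hb. replace b with (2 * (b / 2)) by field. rewrite cos_2a_sin.
  pose proof (sin_sqr_le (b / 2)). nra.
Qed.

Lemma exp_opp_mult (a : R) : exp a * exp (- a) = 1.
Proof. rewrite <- exp_plus, Rplus_opp_r. apply exp_0. Qed.

Lemma cosh_sqr (a : R) : cosh a ^ 2 = 1 + sinh a ^ 2.
Proof. unfold cosh, sinh. pose proof (exp_opp_mult a). nra. Qed.

Lemma cosh_ge_1 (a : R) : 1 <= cosh a.
Proof.
  pose proof (cosh_sqr a). assert (0 < cosh a); [|nra].
  unfold cosh. pose proof (exp_pos a). pose proof (exp_pos (- a)). lra.
Qed.

Lemma is_derive_sinh (a : R) : is_derive sinh a (cosh a).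
Proof. unfold sinh, cosh. auto_derive; auto. field. Qed.

Lemma sinh_ge (a : R) : 0 <= a -> a <= sinh a.
Proof.
  intros Ha. pose proof (le_of_derive_nonneg (fun t => sinh t - t) (fun t => cosh t - 1) a Ha) as H.
  simpl in H. rewrite sinh_0 in H. assert (0 - 0 <= sinh a - a); [|lra]. apply H.
  - intros t _. apply (is_derive_minus (V := R_NormedModule)); [apply is_derive_sinh|apply (is_derive_id (K := R_AbsRing))].
  - intros t _. pose proof (cosh_ge_1 t). lra.
Qed.

Lemma sinh_le_mult_cosh (a : R) : 0 <= a -> sinh a <= a * cosh a.
Proof.
  intros Ha. pose proof (le_of_derive_nonneg (fun t => t * cosh t - sinh t) (fun t => t * sinh t) a Ha) as H.
  simpl in H. rewrite sinh_0, Rmult_0_l in H. assert (0 - 0 <= a * cosh a - sinh a); [|lra]. apply H.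
  - intros t _. unfold cosh, sinh. auto_derive; auto. field.
  - intros t Ht. apply Rmult_le_pos; [lra|]. pose proof (sinh_ge t ltac:(lra)). lra.
Qed.

(** Written with exponentials, this is [1 + 2 * a <= exp (2 * a)]. *)
Lemma mult_cosh_le (a : R) : 0 <= a -> a * cosh a <= (1 + a) * sinh a.
Proof.
  intros Ha. unfold cosh, sinh. pose proof (exp_opp_mult a) as E.
  pose proof (exp_ineq1_le (2 * a)) as H. replace (2 * a) with (a + a) in H at 2 by ring.
  rewrite exp_plus in H. pose proof (exp_pos a). pose proof (exp_pos (- a)) as Hp.
  assert (exp (- a) * (1 + 2 * a) <= exp a).
  { replace (exp a) with (exp (- a) * (exp a * exp a)) by (rewrite <- Rmult_assoc, (Rmult_comm (exp (- a))), E; ring).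
    apply Rmult_le_compat_l; lra. }
  nra.
Qed.

(** The Padé bound [exp x <= (2 + x) / (2 - x)], cleared of its denominator. The gap has derivative
    [1 - exp t * (1 - t)], nonnegative since [1 - t <= exp (- t)]. *)
Lemma exp_pade (x : R) : 0 <= x -> exp x * (2 - x) <= 2 + x.
Proof.
  intros Hx. pose proof (le_of_derive_nonneg (fun t => 2 + t - exp t * (2 - t)) (fun t => 1 - exp t * (1 - t)) x Hx) as H.
  simpl in H. rewrite exp_0 in H. assert (2 + 0 - 1 * (2 - 0) <= 2 + x - exp x * (2 - x)); [|lra]. apply H.
  - intros t _. auto_derive; auto. ring.
  - intros t _. pose proof (exp_ineq1_le (- t)). pose proof (exp_opp_mult t). pose proof (exp_pos t). nra.
Qed.

(** The Padé bounds on [exp a] and [exp (- a)] give [sinh a <= 4 * a / (4 - a ^ 2)]; comparison with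
    the quadratic reduces to [2 - a - a ^ 2 / 2 >= 0]. *)
Lemma sinh_le_quadratic (a : R) : 0 <= a <= 1 -> sinh a <= a + a ^ 2 / 2.
Proof.
  intros Ha. unfold sinh. pose proof (exp_pade a (proj1 Ha)) as H. pose proof (exp_opp_mult a) as E.
  pose proof (exp_pos a). pose proof (exp_pos (- a)).
  assert (H2 : 2 - a <= exp (- a) * (2 + a)) by nra.
  assert (H3 : (exp a - exp (- a)) * ((2 - a) * (2 + a)) <= (2 + a) ^ 2 - (2 - a) ^ 2) by nra.
  assert (H4 : (exp a - exp (- a)) * (4 - a ^ 2) <= 2 * (a + a ^ 2 / 2) * (4 - a ^ 2)).
  { replace ((2 - a) * (2 + a)) with (4 - a ^ 2) in H3 by ring.
    assert (0 <= a ^ 2 * (2 - a - a ^ 2 / 2)) by (apply Rmult_le_pos; nra). nra. }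
  assert (H5 : exp a - exp (- a) <= 2 * (a + a ^ 2 / 2)) by (apply Rmult_le_reg_r with (4 - a ^ 2); [nra|exact H4]).
  lra.
Qed.

(** For [u = r ^ 2] the last factor is [S ^ 2], so this says [2 * c * r ^ 2 <= (1 + c) * S]. The gap
    is the quadratic [A * u ^ 2 - 2 * B * u + D]: all its terms are nonnegative if [B <= 0];
    otherwise [2 * c ^ 2 < 1], which makes [A] positive and [A * D - B ^ 2] nonnegative. *)
Lemma discriminant_bound (u c : R) : 0 <= u -> 0 < c <= 1 ->
  4 * c ^ 2 * u ^ 2 <= (1 + c) ^ 2 * ((1 - u) ^ 2 + 4 * u * c ^ 2).
Proof.
  intros Hu Hc.
  pose (A := (1 - c) * (1 + 3 * c)). pose (B := (1 + c) ^ 2 * (1 - 2 * c ^ 2)). pose (D := (1 + c) ^ 2).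
  assert (Hq : (1 + c) ^ 2 * ((1 - u) ^ 2 + 4 * u * c ^ 2) - 4 * c ^ 2 * u ^ 2 = A * u ^ 2 - 2 * B * u + D)
    by (unfold A, B, D; ring).
  assert (HA0 : 0 <= A) by (unfold A; nra). assert (HD : 0 < D) by (unfold D; nra).
  apply Rminus_le_0. rewrite Hq.
  destruct (Rle_dec B 0) as [HB|HB].
  { assert (0 <= A * u ^ 2) by (apply Rmult_le_pos; [exact HA0|apply pow2_ge_0]).
    assert (0 <= - B * u) by (apply Rmult_le_pos; lra). lra. }
  assert (Hc2 : 2 * c ^ 2 < 1).
  { apply Rnot_le_lt. intros Hn. apply HB. unfold B. assert (0 <= (1 + c) ^ 2) by nra. nra. }
  assert (HA : 0 < A) by (unfold A; nra).
  assert (HAD : 0 <= A * D - B ^ 2).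
  { replace (A * D - B ^ 2) with ((1 + c) ^ 2 * (4 * c ^ 3 * (2 - 2 * c ^ 2 - c ^ 3))) by (unfold A, B, D; ring).
    assert (0 < c ^ 3) by (apply pow_lt; lra). assert (c ^ 3 <= 1) by nra.
    repeat apply Rmult_le_pos; nra. }
  assert (0 <= A * (A * u ^ 2 - 2 * B * u + D)).
  { replace (A * (A * u ^ 2 - 2 * B * u + D)) with ((A * u - B) ^ 2 + (A * D - B ^ 2)) by ring.
    apply Rplus_le_le_0_compat; [apply pow2_ge_0|exact HAD]. }
  apply Rmult_le_reg_l with A; [exact HA|now rewrite Rmult_0_r].
Qed.

(** Rests on [a <= sinh a] and the tangent inequality for [b]. It bounds the modulus of
    [z / (1 + z)] by [sqrt 2 * r], the source of [c_ad] when [al >= 1]. *)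
Lemma asinh_upper (a b r : R) : 0 < a -> - (PI / 2) < b < PI / 2 ->
  r ^ 2 = sinh a ^ 2 + sin b ^ 2 -> a ^ 2 + b ^ 2 <= 2 * r ^ 2 * ((1 + a) ^ 2 + b ^ 2).
Proof.
  intros Ha Hb Er. rewrite Er. pose proof (sinh_ge a ltac:(lra)). pose proof (sqr_le_sin_sqr b Hb).
  assert (a ^ 2 <= sinh a ^ 2) by nra. pose proof (pow2_ge_0 (sin b)). pose proof (pow2_ge_0 b).
  assert (1 + b ^ 2 <= (1 + a) ^ 2 + b ^ 2) by nra.
  apply Rle_trans with (2 * (sinh a ^ 2 + sin b ^ 2) * (1 + b ^ 2)); [nra|].
  apply Rmult_le_compat_l; nra.
Qed.

(* For [z = a + ib = arcsinh (exp (x + iy))]: [r = |sinh z| = exp x], [S = |cosh z|^2], [c = cos y]. *)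
Section Asinh.
Variables a b r c S : R.
Hypotheses (Ha : 0 < a) (Hb : - (PI / 2) < b < PI / 2) (Hr : 0 < r) (Hc : 0 < c <= 1).
Hypothesis Er : r ^ 2 = sinh a ^ 2 + sin b ^ 2.
Hypothesis Ec : c * r = sinh a * cos b.
Hypothesis ES : S = sinh a ^ 2 + cos b ^ 2.

Let cos_sqr : cos b ^ 2 = 1 - sin b ^ 2.
Proof. pose proof (sin2_cos2 b) as H. unfold Rsqr in H. simpl. lra. Qed.

Let S_pos : 0 < S.
Proof.
  pose proof (sinh_ge a ltac:(lra)). rewrite ES. assert (0 <= cos b ^ 2) by (apply pow2_ge_0). nra.
Qed.

(** The square of the modulus of [1 + w * w], for [w] of modulus [r] and real part [c * r]. *)
Let S_sqr : S ^ 2 = (1 - r ^ 2) ^ 2 + 4 * r ^ 2 * c ^ 2.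
Proof.
  replace (4 * r ^ 2 * c ^ 2) with (4 * (c * r) ^ 2) by ring. rewrite Ec, ES, Er.
  replace (4 * (sinh a * cos b) ^ 2) with (4 * sinh a ^ 2 * cos b ^ 2) by ring. rewrite cos_sqr. ring.
Qed.

(** The two squares differ by [(1 - u) ^ 2 * (1 - c ^ 2)] with [u = r ^ 2]. *)
Lemma cosh_asinh_lower : (1 + r ^ 2) * c <= S.
Proof.
  assert (((1 + r ^ 2) * c) ^ 2 <= S ^ 2).
  { rewrite S_sqr. set (u := r ^ 2).
    replace ((1 - u) ^ 2 + 4 * u * c ^ 2) with (((1 + u) * c) ^ 2 + (1 - u) ^ 2 * (1 - c ^ 2)) by ring.
    assert (0 <= (1 - u) ^ 2 * (1 - c ^ 2)) by (apply Rmult_le_pos; [apply pow2_ge_0|nra]). lra. }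
  apply Rsqr_incr_0_var; [unfold Rsqr; nra|lra].
Qed.

(* [S >= (1 + r^2) c] suffices when [|z| < 1]; when [|z| >= 1] it does not, and the exact value
   [S_sqr] is needed. *)
Lemma asinh_ratio : ((1 + a) ^ 2 + b ^ 2) * r ^ 2 * c <= 2 * (1 + c) * (a ^ 2 + b ^ 2) * S.
Proof.
  set (Z := a ^ 2 + b ^ 2).
  assert (HZ : 0 < Z) by (unfold Z; nra).
  assert (H1 : (1 + a) ^ 2 + b ^ 2 <= 2 * (1 + Z)) by (unfold Z; pose proof (pow2_ge_0 (1 - a)); pose proof (pow2_ge_0 b); lra).
  assert (Hrc : 0 < r ^ 2 * c) by (apply Rmult_lt_0_compat; [apply pow_lt|]; lra).
  apply Rle_trans with (2 * (1 + Z) * (r ^ 2 * c)); [nra|].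
  destruct (Rle_dec 1 Z) as [H|H].
  - assert (H2 : 2 * c * r ^ 2 <= (1 + c) * S).
    { apply Rsqr_incr_0_var; [|nra]. unfold Rsqr.
      pose proof (discriminant_bound (r ^ 2) c ltac:(nra) Hc) as H3. rewrite <- S_sqr in H3. nra. }
    apply Rle_trans with (2 * Z * (2 * c * r ^ 2)); [nra|].
    replace (2 * (1 + c) * Z * S) with (2 * Z * ((1 + c) * S)) by ring. apply Rmult_le_compat_l; nra.
  - assert (Ha1 : 0 <= a <= 1) by (unfold Z in H; nra).
    assert (Hb1 : b ^ 2 <= 1) by (unfold Z in H; nra).
    pose proof (cos_ge_half b Hb1) as Hcos. pose proof (sinh_le_quadratic a Ha1) as Hs.
    pose proof (sinh_ge a ltac:(lra)) as Hs2. pose proof (sin_sqr_le b) as Hsin.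
    pose proof cosh_asinh_lower as HL.
    (* [r ^ 2 - Z] is at most [sinh a ^ 2 - a ^ 2], hence at most [a ^ 2 * sinh a] by the quadratic
       bound. Since [cos b >= 1 / 2], [sinh a <= 2 * c * r], and [2 * r <= 1 + r ^ 2] concludes. *)
    assert (H2 : r ^ 2 <= Z + c * Z * (1 + r ^ 2)).
    { assert (H3 : a ^ 2 * sinh a <= c * Z * (1 + r ^ 2)).
      { apply Rle_trans with (2 * (c * r) * Z).
        - rewrite Ec. apply Rle_trans with (2 * (sinh a * (1 / 2)) * a ^ 2); [lra|].
          apply Rmult_le_compat; unfold Z; nra.
        - assert (0 <= c * Z * (1 - r) ^ 2) by (apply Rmult_le_pos; [nra|apply pow2_ge_0]). nra. }
      rewrite Er at 1.
      assert (sinh a ^ 2 - a ^ 2 <= a ^ 2 * sinh a) by nra. unfold Z at 1. lra. }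
    assert (H4 : (1 + Z) * r ^ 2 <= (1 + c) * Z * (1 + r ^ 2)) by nra.
    apply Rle_trans with (2 * (1 + c) * Z * ((1 + r ^ 2) * c)); [nra|].
    apply Rmult_le_compat_l; [nra|exact HL].
Qed.

End Asinh.

(** Bounds the real part of [z] below by [x - ln 2 / 2]; hence the factor [2 ^ (be / 2)] in front of
    the decay of [exp (- be * z)]. *)
Lemma exp_asinh_lower (a b r : R) : 0 < a -> r ^ 2 = sinh a ^ 2 + sin b ^ 2 -> r ^ 2 <= 2 * exp a ^ 2.
Proof.
  intros Ha Er. rewrite Er. pose proof (SIN_bound b). pose proof (exp_ineq1_le a). pose proof (exp_opp_mult a).
  pose proof (exp_pos (- a)). unfold sinh.
  assert (((exp a - exp (- a)) / 2) ^ 2 <= exp a ^ 2) by nra. nra.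
Qed.

(** * Decay of the transformed integrands *)

Lemma ln_Cmod_sqr (z : C) : z <> 0 -> ln (fst z ^ 2 + snd z ^ 2) = 2 * ln (Cmod z).
Proof.
  intros Hz. apply Cmod_gt_0 in Hz. rewrite <- Cmod_sqr. simpl. rewrite Rmult_1_r, ln_mult by auto. ring.
Qed.

Lemma cos_strip (y d : R) : 0 < d < PI / 2 -> - d < y < d -> 0 < cos d <= cos y /\ cos y <= 1.
Proof.
  intros Hd Hy. pose proof (COS_bound y). split; [split|lra].
  - apply cos_gt_0; lra.
  - destruct (Rle_dec 0 y); [apply cos_decr_1; lra|].
    rewrite <- (cos_neg y). apply cos_decr_1; lra.
Qed.

(* Logarithm of the decay rate of the transformed integrands: [al * x] on the left, [- be * x] on the right. *)
Definition decay (al be x : R) : R := al * Rmin x 0 - be * Rmax x 0.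

Lemma decay_le_left (al be x : R) : 0 < al -> 0 < be -> decay al be x <= al * x.
Proof. intros. unfold decay, Rmin, Rmax. destruct (Rle_dec x 0); nra. Qed.

Lemma decay_le_right (al be x : R) : 0 < al -> 0 < be -> decay al be x <= - be * x.
Proof. intros. unfold decay, Rmin, Rmax. destruct (Rle_dec x 0); nra. Qed.

Lemma decay_le_abs (al be x : R) : 0 < al -> 0 < be -> decay al be x <= - (Rmin al be * Rabs x).
Proof.
  intros. pose proof (Rmin_l al be). pose proof (Rmin_r al be). unfold decay.
  destruct (Rle_dec x 0).
  - rewrite Rmin_left, Rmax_right, Rabs_left1 by lra. nra.
  - rewrite Rmin_right, Rmax_left, Rabs_pos_eq by lra. nra.
Qed.

Lemma Rmin_Rmax_0 (x : R) : x = Rmin x 0 + Rmax x 0.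
Proof. unfold Rmin, Rmax. destruct (Rle_dec x 0); ring. Qed.

Lemma ln_one_plus_exp (x c S : R) : 0 < c -> (1 + exp x ^ 2) * c <= S ->
  2 * Rmax x 0 + ln c <= ln S.
Proof.
  intros Hc H. pose proof (exp_pos x).
  assert (H2 : exp (2 * Rmax x 0) <= 1 + exp x ^ 2).
  { replace (exp x ^ 2) with (exp (2 * x)) by (replace (2 * x) with (x + x) by ring; rewrite exp_plus; ring).
    pose proof (exp_pos (2 * x)). unfold Rmax. destruct (Rle_dec x 0); [|lra].
    rewrite Rmult_0_r, exp_0. lra. }
  pose proof (exp_pos (2 * Rmax x 0)).
  rewrite <- (ln_exp (2 * Rmax x 0)), <- ln_mult by auto. apply ln_le; nra.
Qed.

(** With [r = exp x] and [c = cos y], the two squares differ by [(1 - r ^ 2) ^ 2 * (1 - c ^ 2)]. *)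
Lemma Cmod_one_plus_Cexp_sqr (x y : R) : 0 < cos y ->
  (1 + exp x ^ 2) * cos y <= Cmod (1 + Cexp (x, y) * Cexp (x, y)).
Proof.
  intros Hc. pose proof (exp_pos x). set (r := exp x) in *.
  pose proof (COS_bound y) as Hb. pose proof (sin2_cos2 y) as E. unfold Rsqr in E.
  apply Rsqr_incr_0_var; [|apply Cmod_ge_0].
  replace ((Cmod (1 + Cexp (x, y) * Cexp (x, y)))²) with (Cmod (1 + Cexp (x, y) * Cexp (x, y)) ^ 2)
    by (unfold Rsqr; ring).
  rewrite Cmod_sqr. simpl. fold r. unfold Rsqr. set (c := cos y) in *. set (s := sin y) in *.
  assert (Es : s * s = 1 - c * c) by lra.
  replace ((1 + (r * c * (r * c) - r * s * (r * s))) * ((1 + (r * c * (r * c) - r * s * (r * s))) * 1) +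
    (0 + (r * c * (r * s) + r * s * (r * c))) * ((0 + (r * c * (r * s) + r * s * (r * c))) * 1))
    with ((1 + r * r * (c * c - s * s)) ^ 2 + 4 * (r ^ 2) ^ 2 * (c * c) * (s * s)) by ring.
  rewrite Es.
  assert (0 <= (1 - r ^ 2) ^ 2 * (1 - c * c)) by (apply Rmult_le_pos; [apply pow2_ge_0|nra]).
  match goal with |- ?a <= ?b => replace b with (a + (1 - r ^ 2) ^ 2 * (1 - c * c)) by ring end. lra.
Qed.

(** The derivative raises the exponent [al - 1] to [al], and [al * x - (al + be) * Rmax x 0] is
    exactly the decay rate. *)
Lemma E2_decay (al be x y : R) : 0 < al -> 0 < be -> 0 < cos y ->
  Cmod (E_fun 2 al be (Cexp (x, y))) * Cmod (Cexp (x, y))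
    <= exp (- (al + be) / 2 * ln (cos y) + decay al be x).
Proof.
  intros Hal Hbe Hc. unfold E_fun; simpl Nat.eqb; cbv iota. set (w := Cexp (x, y)).
  pose proof (Cmod_one_plus_Cexp_sqr x y Hc) as HS. fold w in HS.
  assert (HS0 : 0 < Cmod (1 + w * w)).
  { eapply Rlt_le_trans; [|exact HS]. pose proof (exp_pos x). nra. }
  rewrite Cmod_mult, !Cmod_Cpow; [|now apply Cmod_gt_0|apply Cexp_neq_0].
  assert (Hw : Cmod w = exp x) by apply Cmod_Cexp. rewrite Hw, ln_exp, <- !exp_plus.
  apply exp_le_compat. pose proof (ln_one_plus_exp x (cos y) _ Hc HS) as H1.
  unfold decay. pose proof (Rmin_Rmax_0 x). nra.
Qed.

(** In logarithmic form the remaining estimates become linear in the logarithms of the moduli. *)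
Lemma E3_log (al be x : R) (z w s : C) : z <> 0 -> (1 + z)%C <> 0 -> s <> 0 ->
  Cmod w = exp x ->
  Cmod (E_fun 3 al be z) * Cmod (w / s)
    = exp ((al - 1) * (ln (Cmod z) - ln (Cmod (1 + z))) - be * fst z + (x - ln (Cmod s))).
Proof.
  intros Hz Hz1 Hs Hw. unfold E_fun; simpl Nat.eqb; cbv iota.
  assert (Hq : (z / (1 + z))%C <> 0).
  { apply Cmod_gt_0. rewrite Cmod_div by auto. apply Rdiv_lt_0_compat; now apply Cmod_gt_0. }
  pose proof (proj1 (Cmod_gt_0 _) Hz). pose proof (proj1 (Cmod_gt_0 _) Hz1). pose proof (proj1 (Cmod_gt_0 _) Hs).
  rewrite Cmod_mult, Cmod_Cpow, Cmod_Cexp by auto. rewrite !Cmod_div by auto. rewrite ln_div by auto.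
  rewrite Hw. replace (exp x / Cmod s) with (exp (x - ln (Cmod s))).
  - rewrite <- !exp_plus. f_equal. simpl. ring.
  - unfold Rminus. rewrite exp_plus, exp_Ropp, exp_ln by auto. reflexivity.
Qed.

(** The factor [exp (- be * z)] contributes [be / 2 * ln 2], the power of [z / (1 + z)] contributes
    [c_ad], and the lower bound on the hyperbolic cosine contributes the power of [cos d]. *)
Lemma E3_decay (al be d x y : R) : 0 < al -> 0 < be -> 0 < d < PI / 2 -> - d < y < d ->
  Cmod (E_fun 3 al be (psiC 3 (x, y))) * Cmod (Cexp (x, y) / cosh_asinh (x, y))
    <= exp (be / 2 * ln 2 + ln (c_ad al d) - (al + be) / 2 * ln (cos d) + decay al be x).
Proof.
  intros Hal Hbe Hd Hy.
  destruct (cos_strip y d Hd Hy) as [[Hcd Hcdy] Hc1].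
  pose proof (psi3_hyperbolic (x, y) ltac:(simpl; lra)) as HH. cbv zeta in HH.
  set (z := psiC 3 (x, y)) in *. destruct HH as [Ew [Es [Ha Hb]]].
  set (a := fst z) in *. set (b := snd z) in *.
  set (r := exp x). set (c := cos y) in *. set (S := sinh a ^ 2 + cos b ^ 2).
  assert (Hr : 0 < r) by apply exp_pos.
  assert (Hc : 0 < c <= 1) by lra.
  assert (Er : r ^ 2 = sinh a ^ 2 + sin b ^ 2).
  { pose proof (Cmod_Cexp (x, y)) as E. simpl in E. unfold r. rewrite <- E, Cmod_sqr, Ew. simpl fst; simpl snd.
    pose proof (cosh_sqr a). pose proof (sin2_cos2 b) as Eb. unfold Rsqr in Eb.
    replace ((sinh a * cos b) ^ 2 + (cosh a * sin b) ^ 2)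
      with (sinh a ^ 2 * (cos b * cos b) + cosh a ^ 2 * (sin b * sin b)) by ring.
    rewrite H. replace (cos b * cos b) with (1 - sin b * sin b) by lra. ring. }
  assert (Ec : c * r = sinh a * cos b).
  { apply (f_equal fst) in Ew. simpl in Ew. unfold c, r. lra. }
  assert (HS2 : fst (cosh_asinh (x, y)) ^ 2 + snd (cosh_asinh (x, y)) ^ 2 = S).
  { rewrite Es. simpl fst; simpl snd. unfold S.
    pose proof (cosh_sqr a). pose proof (sin2_cos2 b) as Eb. unfold Rsqr in Eb.
    replace ((cosh a * cos b) ^ 2 + (sinh a * sin b) ^ 2)
      with (cosh a ^ 2 * (cos b * cos b) + sinh a ^ 2 * (sin b * sin b)) by ring.
    rewrite H. replace (sin b * sin b) with (1 - cos b * cos b) by lra. ring. }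
  assert (Hs0 : cosh_asinh (x, y) <> 0).
  { intros E. pose proof (Re_cosh_asinh_pos (x, y) ltac:(simpl; lra)) as H. rewrite E in H. simpl in H. lra. }
  assert (Hz0 : z <> 0) by (intros E; unfold a in Ha; rewrite E in Ha; simpl in Ha; lra).
  assert (Hz1 : (1 + z)%C <> 0).
  { intros E. apply (f_equal fst) in E. change (1 + a = 0) in E. lra. }
  rewrite (E3_log al be x); auto; [|apply Cmod_Cexp]. fold a.
  pose proof (ln_Cmod_sqr _ Hz0) as L1. fold a b in L1.
  pose proof (ln_Cmod_sqr _ Hz1) as L2. change (ln ((1 + a) ^ 2 + (0 + b) ^ 2) = 2 * ln (Cmod (1 + z))) in L2.
  rewrite Rplus_0_l in L2.
  pose proof (ln_Cmod_sqr _ Hs0) as L3. rewrite HS2 in L3.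
  assert (HZ : 0 < a ^ 2 + b ^ 2) by nra. assert (HZ1 : 0 < (1 + a) ^ 2 + b ^ 2) by nra.
  assert (I1 : (1 + r ^ 2) * c <= S) by (now apply (cosh_asinh_lower a b)).
  assert (I2 : a ^ 2 + b ^ 2 <= 2 * r ^ 2 * ((1 + a) ^ 2 + b ^ 2)) by (now apply asinh_upper).
  assert (I3 : ((1 + a) ^ 2 + b ^ 2) * r ^ 2 * c <= 2 * (1 + c) * (a ^ 2 + b ^ 2) * S) by (now apply asinh_ratio).
  pose proof (exp_asinh_lower a b r Ha Er) as I4.
  assert (HS0 : 0 < S) by (eapply Rlt_le_trans; [|exact I1]; nra).
  set (l1 := ln (Cmod z)) in *. set (l2 := ln (Cmod (1 + z))) in *. set (l3 := ln (Cmod (cosh_asinh (x, y)))) in *.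
  pose proof (ln_one_plus_exp x c S (proj1 Hc) I1) as J1. rewrite L3 in J1.
  assert (Lr : ln (r ^ 2) = 2 * x).
  { simpl. rewrite Rmult_1_r, ln_mult by auto. unfold r. rewrite ln_exp. ring. }
  assert (Hr2 : 0 < r ^ 2) by now apply pow_lt.
  assert (J2 : 2 * l1 <= ln 2 + 2 * Rmin x 0 + 2 * l2).
  { rewrite <- L1, <- L2. unfold Rmin. destruct (Rle_dec x 0).
    - rewrite <- Lr, <- !ln_mult by nra. apply ln_le; auto.
    - rewrite Rmult_0_r, Rplus_0_r, <- ln_mult by lra. apply ln_le; nra. }
  assert (J3 : 2 * l2 + 2 * x + ln c <= ln 2 + ln (1 + c) + 2 * l1 + 2 * l3).
  { rewrite <- L1, <- L2, <- L3, <- Lr.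
    rewrite <- !ln_mult; try nra.
    - apply ln_le; [|exact I3]. repeat apply Rmult_lt_0_compat; lra. }
  assert (J4 : - be * a <= be / 2 * ln 2 - be * Rmax x 0).
  { assert (2 * Rmax x 0 <= ln 2 + 2 * a); [|nra].
    assert (0 < ln 2) by (rewrite <- ln_1; apply ln_increasing; lra).
    unfold Rmax. destruct (Rle_dec x 0); [lra|].
    rewrite <- Lr. replace (2 * a) with (ln (exp a ^ 2)).
    - pose proof (exp_pos a). rewrite <- ln_mult; [|lra|now apply pow_lt]. now apply ln_le.
    - simpl. rewrite Rmult_1_r, ln_mult by apply exp_pos. rewrite ln_exp. ring. }
  assert (J5 : ln (cos d) <= ln c) by now apply ln_le.
  assert (J6 : ln (cos d) <= 0) by (rewrite <- ln_1; apply ln_le; lra).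
  apply exp_le_compat. unfold decay. pose proof (Rmin_Rmax_0 x) as Ex.
  set (t := Rmin x 0) in *. set (m := Rmax x 0) in *.
  assert (J7 : x - l3 <= t - ln c / 2) by lra.
  (* For [al < 1] the exponent [al - 1] is negative, so [(1 + z) / z] must be bounded above:
     [asinh_ratio] does so at the price of [1 - al] powers of [w / cosh z], where [w = Cexp (x, y)],
     leaving exactly [al] of them. For [al >= 1] [asinh_upper] is used. In both cases a surplus
     power of [1 / cos d >= 1] is added. *)
  unfold c_ad. destruct (Rlt_dec al 1) as [Hal1|Hal1]; unfold Rpower; rewrite ln_exp.
  - assert (J8 : ln (1 + c) - ln c <= ln (1 + 1 / cos d)).
    { rewrite <- ln_div by lra. apply ln_le; [apply Rdiv_lt_0_compat; lra|].
      replace ((1 + c) / c) with (1 + / c) by (field; lra).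
      assert (/ c <= / cos d) by (apply Rinv_le_contravar; lra). lra. }
    rewrite ln_mult; [|lra|pose proof (Rinv_0_lt_compat _ Hcd); lra].
    assert (G1 : (1 - al) * (l2 - l1) <= (1 - al) * ((ln 2 + ln (1 + 1 / cos d)) / 2 - (x - l3)))
      by (apply Rmult_le_compat_l; lra).
    assert (G2 : al * (x - l3) <= al * (t - ln (cos d) / 2)) by (apply Rmult_le_compat_l; lra).
    assert (G3 : be / 2 * ln (cos d) <= 0) by nra.
    lra.
  - assert (G1 : (al - 1) * (l1 - l2) <= (al - 1) * (ln 2 / 2 + t)) by (apply Rmult_le_compat_l; lra).
    assert (G3 : (al + be - 1) / 2 * ln (cos d) <= 0) by nra.
    lra.
Qed.

(** On the real axis [a / (1 + a)] lies between [tanh a / 2] and [tanh a]. The power [al - 1]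
    therefore costs nothing for [al >= 1] and [2 ^ (1 - al)] for [al < 1]; the absolute value in the
    exponent merges both cases. *)
Lemma E3_decay_real (al be x : R) : 0 < al -> 0 < be ->
  Cmod (E_fun 3 al be (psiC 3 (RtoC x))) * Cmod (Cexp (RtoC x) / cosh_asinh (RtoC x))
    <= exp ((1 - al + Rabs (1 - al)) / 2 * ln 2 + decay al be x).
Proof.
  intros Hal Hbe. pose proof PI_RGT_0.
  pose proof (psi3_hyperbolic (RtoC x) ltac:(simpl; lra)) as HH. cbv zeta in HH.
  destruct (psi3_real x) as [E _]. rewrite E in *. set (a := psiR 3 x) in *.
  change (fst (RtoC a)) with a in HH. change (snd (RtoC a)) with 0 in HH.
  rewrite cos_0, sin_0, !Rmult_1_r, !Rmult_0_r in HH. destruct HH as [Ew [Es [Ha _]]].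
  change ((sinh a, 0) : C) with (RtoC (sinh a)) in Ew. change ((cosh a, 0) : C) with (RtoC (cosh a)) in Es.
  rewrite Cexp_RtoC in *. apply RtoC_inj in Ew. rewrite Es.
  pose proof (cosh_ge_1 a) as Hch. pose proof (mult_cosh_le a ltac:(lra)) as I1.
  pose proof (sinh_le_mult_cosh a ltac:(lra)) as I2. pose proof (exp_pos x) as Hx.
  rewrite (E3_log al be x).
  2: intros F; apply RtoC_inj in F; lra.
  2: rewrite <- RtoC_plus; intros F; apply RtoC_inj in F; lra.
  2: intros F; apply RtoC_inj in F; lra.
  2: rewrite Cmod_R, Rabs_pos_eq; lra.
  rewrite <- RtoC_plus, !Cmod_R, !Rabs_pos_eq by lra. change (fst (RtoC a)) with a.
  set (l1 := ln a). set (l2 := ln (1 + a)). set (l3 := ln (cosh a)).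
  assert (Lx : ln (sinh a) = x) by (rewrite <- Ew; apply ln_exp).
  assert (J1 : l1 + l3 <= l2 + x).
  { unfold l1, l2, l3. rewrite <- Lx, <- !ln_mult by lra. apply ln_le; [|lra]. apply Rmult_lt_0_compat; lra. }
  assert (J2 : l2 + x <= ln 2 + l1 + l3).
  { unfold l1, l2, l3. rewrite <- Lx, <- !ln_mult by lra.
    apply ln_le; [apply Rmult_lt_0_compat; lra|].
    assert (a * sinh a <= a * cosh a) by (apply Rmult_le_compat_l; [lra|unfold sinh, cosh; pose proof (exp_pos (- a)); lra]). lra. }
  assert (J3 : Rmax x 0 <= l3).
  { unfold Rmax, l3. destruct (Rle_dec x 0).
    - rewrite <- ln_1. apply ln_le; lra.
    - rewrite <- Lx at 1. apply ln_le; [lra|]. unfold sinh, cosh. pose proof (exp_pos (- a)). lra. }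
  assert (J4 : Rmax x 0 <= a).
  { apply Rmax_lub; [|lra]. rewrite <- Lx. apply Rle_trans with (ln (exp a)); [|rewrite ln_exp; lra]. apply ln_le; [lra|].
    unfold sinh. pose proof (exp_pos a). pose proof (exp_pos (- a)). lra. }
  assert (Hl2 : 0 < ln 2) by (rewrite <- ln_1; apply ln_increasing; lra).
  apply exp_le_compat. unfold decay. pose proof (Rmin_Rmax_0 x) as Ex.
  set (t := Rmin x 0) in *. set (m := Rmax x 0) in *.
  assert (G0 : be * m <= be * a) by (apply Rmult_le_compat_l; lra).
  assert (G2 : al * (x - l3) <= al * t) by (apply Rmult_le_compat_l; lra).
  destruct (Rle_dec 1 al) as [H1|H1].
  - rewrite Rabs_left1 by lra.
    assert (G1 : (al - 1) * (l1 - l2) <= (al - 1) * (x - l3)) by (apply Rmult_le_compat_l; lra).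
    replace ((1 - al + - (1 - al)) / 2 * ln 2) with 0 by field. lra.
  - rewrite Rabs_pos_eq by lra.
    assert (G1 : (1 - al) * (l2 - l1) <= (1 - al) * (ln 2 - (x - l3))) by (apply Rmult_le_compat_l; lra).
    replace ((1 - al + (1 - al)) / 2 * ln 2) with ((1 - al) * ln 2) by field. lra.
Qed.

(** * Quadrature after the change of variables *)

Lemma step_identities (d mu n : R) : 0 < d -> 0 < mu -> 0 < n ->
  let h := sqrt (2 * PI * d / (mu * n)) in
  0 < h /\ mu * n * h = sqrt (2 * PI * d * mu * n) /\ 2 * PI * d / h = sqrt (2 * PI * d * mu * n).
Proof.
  intros Hd Hmu Hn h. pose proof PI_RGT_0 as HPI.
  assert (Hp : 0 < 2 * PI * d) by nra. assert (Hm : 0 < mu * n) by nra.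
  assert (Hh : 0 < h) by (apply sqrt_lt_R0, Rdiv_lt_0_compat; auto).
  assert (Hh2 : h * h = 2 * PI * d / (mu * n)).
  { apply sqrt_sqrt, Rlt_le, Rdiv_lt_0_compat; auto. }
  assert (E : mu * n * h = sqrt (2 * PI * d * mu * n)).
  { symmetry. apply sqrt_lem_1; [nra|nra|].
    replace (mu * n * h * (mu * n * h)) with (mu * n * (mu * n) * (h * h)) by ring. rewrite Hh2. field. lra. }
  repeat split; auto. rewrite <- E.
  replace (2 * PI * d) with (mu * n * (h * h)) by (rewrite Hh2; field; lra). field. lra.
Qed.

Lemma ceilZ_ge (x : R) : x <= INR (Z.to_nat (ceilZ x)).
Proof.
  assert (H : x <= IZR (ceilZ x)).
  { unfold ceilZ. rewrite minus_IZR. destruct (archimed (- x)). lra. }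
  destruct (Z_le_gt_dec 0 (ceilZ x)) as [Hz|Hz].
  - rewrite INR_IZR_INZ, Z2Nat.id by auto. exact H.
  - apply Z.gt_lt, IZR_lt in Hz. pose proof (pos_INR (Z.to_nat (ceilZ x))). lra.
Qed.

(** The ceilings are chosen for these inequalities: both truncation tails are then at most
    [exp (- (mu * n * h))]. *)
Lemma MN_spec (al be : R) (n : nat) : 0 < al -> 0 < be ->
  Rmin al be * INR n <= al * INR (fst (MN al be n)) /\
  Rmin al be * INR n <= be * INR (snd (MN al be n)).
Proof.
  intros Hal Hbe. unfold MN. destruct (Rle_dec al be) as [H|H]; simpl.
  - rewrite Rmin_left by lra. split; [lra|].
    pose proof (ceilZ_ge (al * INR n / be)) as Hc. apply Rmult_le_compat_l with (r := be) in Hc; [|lra].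
    replace (be * (al * INR n / be)) with (al * INR n) in Hc by (field; lra). exact Hc.
  - rewrite Rmin_right by lra. split; [|lra].
    pose proof (ceilZ_ge (be * INR n / al)) as Hc. apply Rmult_le_compat_l with (r := al) in Hc; [|lra].
    replace (al * (be * INR n / al)) with (be * INR n) in Hc by (field; lra). exact Hc.
Qed.

(** [CInt] is total, so an equality of values would not show integrability; the conclusion is
    therefore an [is_CInt], as the improper integral requires. *)
Lemma is_CInt_substitution (f F : C -> C) (psi dpsi : R -> R) (u v : R) :
  (forall x, is_derive psi x (dpsi x)) -> (forall x, continuous dpsi x) ->
  (forall x, F (RtoC x) = (f (RtoC (psi x)) * RtoC (dpsi x))%C) ->
  (forall a, Rmin (psi u) (psi v) <= a <= Rmax (psi u) (psi v) -> Ccontinuous (fun t => f (RtoC t)) a) ->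
  (forall x, Ccontinuous (fun t => f (RtoC t)) (psi x)) ->
  is_CInt (fun t => f (RtoC t)) (psi u) (psi v) (CInt (fun x => F (RtoC x)) u v).
Proof.
  intros Hd Hdc HF Hf Hfp.
  assert (E : CInt (fun x => F (RtoC x)) u v = CInt (fun t => f (RtoC t)) (psi u) (psi v)).
  { apply CInt_unique.
    apply (is_RInt_ext (V := C_R_CompleteNormedModule)
      (fun y => scal (V := C_R_NormedModule) (dpsi y) (f (RtoC (psi y))))).
    - intros x _. rewrite HF. unfold scal; simpl; unfold prod_scal, scal; simpl; unfold mult; simpl.
      apply injective_projections; simpl; ring.
    - apply (is_RInt_comp (V := C_R_CompleteNormedModule) (fun t => f (RtoC t)) psi dpsi u v).
      + intros x _. apply Hfp.
      + intros x _. split; auto. }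
  rewrite E. apply (RInt_correct (V := C_R_CompleteNormedModule)).
  apply (ex_RInt_continuous (V := C_R_CompleteNormedModule)). exact Hf.
Qed.

(** Common to both transformations. The right inverse [chi] of [psi] turns the endpoints of an
    integral over the half line into endpoints on the real line. *)
Lemma transformed_quadrature (f F : C -> C) (psi dpsi chi : R -> R) (d A B al be : R) (n : nat) :
  0 < d -> 0 < al -> 0 < be -> 0 <= A -> 0 <= B -> (0 < n)%nat ->
  (forall x, is_derive psi x (dpsi x)) -> (forall x, continuous dpsi x) ->
  (forall x y, x <= y -> psi x <= psi y) -> (forall x, 0 < psi x) ->
  (forall a, 0 < a -> psi (chi a) = a) ->
  (forall x, F (RtoC x) = (f (RtoC (psi x)) * RtoC (dpsi x))%C) ->
  (forall x, Ccontinuous (fun t => f (RtoC t)) (psi x)) ->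
  (forall x y, - d < y < d -> cdiff F (x, y)) ->
  (forall x y, - d < y < d -> Cmod (F (x, y)) <= A * exp (decay al be x)) ->
  (forall x, Cmod (F (RtoC x)) <= B * exp (decay al be x)) ->
  let mu := Rmin al be in
  let h := sqrt (2 * PI * d / (mu * INR n)) in
  exists I : C,
    is_RInt_gen (V := C_R_CompleteNormedModule) (fun t : R => f (RtoC t))
      (at_right 0) (Rbar_locally p_infty) I /\
    Cmod (I - trap_sum (fun x => F (RtoC x)) h (fst (MN al be n)) (snd (MN al be n)))
      <= 2 / mu * (2 * A / (1 - exp (- sqrt (2 * PI * d * mu))) + B) * exp (- sqrt (2 * PI * d * mu * INR n)).
Proof.
  intros Hd Hal Hbe HA HB Hn Hpsi Hdpsi Hmono Hpos Hchi HFf Hfc HFd HFA HFB mu h.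
  pose proof PI_RGT_0 as HPI.
  assert (Hmu : 0 < mu) by (unfold mu; now apply Rmin_glb_lt).
  assert (Hmual : mu <= al) by apply Rmin_l. assert (Hmube : mu <= be) by apply Rmin_r.
  assert (Hn1 : 1 <= INR n) by (change 1 with (INR 1); apply le_INR; lia).
  set (Fr := fun x : R => F (RtoC x)).
  assert (HFr : forall x : R, Ccontinuous Fr x).
  { intros x. apply (continuous_horizontal F x 0), cdiff_continuous, HFd. lra. }
  assert (HBl : forall x, Cmod (Fr x) <= B * exp (al * x)).
  { intros x. eapply Rle_trans; [apply HFB|]. apply Rmult_le_compat_l; auto.
    apply exp_le_compat. now apply decay_le_left. }
  assert (HBr : forall x, Cmod (Fr x) <= B * exp (- be * x)).
  { intros x. eapply Rle_trans; [apply HFB|]. apply Rmult_le_compat_l; auto.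
    apply exp_le_compat. now apply decay_le_right. }
  destruct (line_integral_exists Fr B al be Hal Hbe HB HFr HBl HBr) as [I HI].
  exists I. split.
  - intros P HP. apply locally_Cmod in HP. destruct HP as [eps [He HP]].
    assert (Hqa : 0 <= B / al) by (apply Rmult_le_pos; auto; now apply Rlt_le, Rinv_0_lt_compat).
    assert (Hqb : 0 <= B / be) by (apply Rmult_le_pos; auto; now apply Rlt_le, Rinv_0_lt_compat).
    set (C0 := B / al + B / be + 1).
    assert (HC0 : 0 < C0) by (unfold C0; lra).
    destruct (exp_decay_small mu (eps / 2 / C0)) as [T [HT HTe]]; auto.
    { apply Rdiv_lt_0_compat; lra. }
    specialize (HTe T (Rle_refl T)). set (e := exp (- (mu * T))) in *.
    assert (He0 : C0 * e <= eps / 2).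
    { apply Rmult_le_compat_l with (r := C0) in HTe; [|lra].
      replace (C0 * (eps / 2 / C0)) with (eps / 2) in HTe by (field; lra). exact HTe. }
    (* By monotonicity of [psi], these neighbourhoods force [chi a <= - T] and [T <= chi b], which
       makes both tails small; monotonicity of [chi] itself does not enter. *)
    apply Filter_prod with (fun a => 0 < a < psi (- T)) (fun b => psi T < b).
    + exists (mkposreal _ (Hpos (- T))). intros a Ha Ha0. split; auto.
      unfold ball in Ha; simpl in Ha; unfold AbsRing_ball, minus, plus, opp, abs in Ha; simpl in Ha.
      rewrite Ropp_0, Rplus_0_r, Rabs_pos_eq in Ha; lra.
    + exists (psi T). auto.
    + intros a b [Ha0 Ha] Hb. simpl fst; simpl snd.
      pose proof (Hpos T) as HpT.
      assert (Hu : chi a <= - T).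
      { apply Rnot_lt_le. intros Hlt. pose proof (Hmono _ _ (Rlt_le _ _ Hlt)) as H. rewrite Hchi in H; lra. }
      assert (Hv : T <= chi b).
      { apply Rnot_lt_le. intros Hlt. pose proof (Hmono _ _ (Rlt_le _ _ Hlt)) as H. rewrite Hchi in H; lra. }
      exists (CInt Fr (chi a) (chi b)). split.
      * assert (H : is_CInt (fun t => f (RtoC t)) (psi (chi a)) (psi (chi b)) (CInt Fr (chi a) (chi b))).
        { apply is_CInt_substitution with dpsi; auto.
          intros t [Ht _]. rewrite <- (Hchi t); auto.
          eapply Rlt_le_trans; [|exact Ht]. apply Rmin_glb_lt; auto. }
        rewrite !Hchi in H by lra. exact H.
      * apply HP. eapply Rle_lt_trans; [apply HI; lra|].
        assert (E1 : B / al * exp (al * chi a) <= B / al * e).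
        { apply Rmult_le_compat_l; auto. apply exp_le_compat. nra. }
        assert (E2 : B / be * exp (- be * chi b) <= B / be * e).
        { apply Rmult_le_compat_l; auto. apply exp_le_compat. nra. }
        assert (0 < e) by apply exp_pos.
        assert (C0 * e = B / al * e + B / be * e + e) by (unfold C0; ring). lra.
  - destruct (step_identities d mu (INR n) Hd Hmu ltac:(lra)) as [Hh [Eh1 Eh2]]. fold h in Hh, Eh1, Eh2.
    destruct (MN_spec al be n Hal Hbe) as [HM HN]. fold mu in HM, HN.
    set (M := fst (MN al be n)) in *. set (N := snd (MN al be n)) in *.
    set (kap := sqrt (2 * PI * d * mu * INR n)) in *. set (kap1 := sqrt (2 * PI * d * mu)) in *.
    assert (Hk0 : 0 < 2 * PI * d * mu) by (repeat (apply Rmult_lt_0_compat; [|lra]); lra).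
    assert (Hk1 : 0 < kap1) by now apply sqrt_lt_R0.
    assert (Hk : kap1 <= kap).
    { apply sqrt_le_1_alt. nra. }
    pose proof (trapezoid_strip F I d h A B al be mu M N Hd Hh Hmu Hmual Hmube HA HB HFd) as HT.
    assert (HAabs : forall x y, - d < y < d -> Cmod (F (x, y)) <= A * exp (- (mu * Rabs x))).
    { intros x y Hy. eapply Rle_trans; [now apply HFA|]. apply Rmult_le_compat_l; auto.
      apply exp_le_compat. now apply decay_le_abs. }
    specialize (HT HAabs HBl HBr HI). rewrite Eh2 in HT.
    eapply Rle_trans; [exact HT|].
    set (q := exp (- kap)) in *. set (q1 := exp (- kap1)).
    assert (Hq : 0 < q) by apply exp_pos.
    assert (Hqq : q <= q1) by (apply exp_le_compat; lra).
    assert (Hq1 : q1 < 1) by (unfold q1; rewrite <- exp_0; apply exp_increasing; lra).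
    assert (EM : exp (- (al * (INR M * h))) <= q).
    { apply exp_le_compat. rewrite <- Eh1. nra. }
    assert (EN : exp (- (be * (INR N * h))) <= q).
    { apply exp_le_compat. rewrite <- Eh1. nra. }
    assert (Hdiv : forall c, mu <= c -> 0 <= B / c <= B / mu).
    { intros c Hc. split.
      - apply Rmult_le_pos; auto. apply Rlt_le, Rinv_0_lt_compat; lra.
      - apply Rmult_le_compat_l; auto. apply Rinv_le_contravar; lra. }
    pose proof (Hdiv al Hmual). pose proof (Hdiv be Hmube).
    assert (T1 : B / al * exp (- (al * (INR M * h))) <= B / mu * q).
    { apply Rmult_le_compat; try lra. apply Rlt_le, exp_pos. }
    assert (T2 : B / be * exp (- (be * (INR N * h))) <= B / mu * q).
    { apply Rmult_le_compat; try lra. apply Rlt_le, exp_pos. }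
    (* Since [n >= 1], [q <= q1], and the denominator may be replaced by one independent of [n]. *)
    assert (T3 : 4 * A / mu * (q / (1 - q)) <= 4 * A / mu * (q / (1 - q1))).
    { apply Rmult_le_compat_l.
      - apply Rmult_le_pos; [lra|]. now apply Rlt_le, Rinv_0_lt_compat.
      - apply Rmult_le_compat_l; [lra|]. apply Rinv_le_contravar; lra. }
    replace (2 / mu * (2 * A / (1 - q1) + B) * q) with (4 * A / mu * (q / (1 - q1)) + (B / mu * q + B / mu * q))
      by (field; lra).
    lra.
Qed.

(** * The two transformations and the final estimate *)

Definition dpsi (i : nat) (zeta : C) : C :=
  if Nat.eqb i 2 then Cexp zeta else (Cexp zeta / cosh_asinh zeta)%C.

Definition dpsiR (i : nat) (x : R) : R :=
  if Nat.eqb i 2 then exp x else exp x / sqrt (exp x * exp x + 1).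

Definition chiR (i : nat) (a : R) : R := if Nat.eqb i 2 then ln a else ln (sinh a).

Lemma exp_sqr_plus_1_pos (x : R) : 0 < exp x * exp x + 1.
Proof. pose proof (exp_pos x). nra. Qed.

Lemma is_derive_psiR (i : nat) (x : R) : is_derive (psiR i) x (dpsiR i x).
Proof.
  unfold psiR, dpsiR. destruct (Nat.eqb i 2).
  - auto_derive; auto. ring.
  - pose proof (exp_sqr_plus_1_pos x) as Hv. pose proof (exp_pos x). pose proof (sqrt_lt_R0 _ Hv).
    auto_derive; [repeat split; lra|]. field. lra.
Qed.

Lemma continuous_dpsiR (i : nat) (x : R) : continuous (dpsiR i) x.
Proof.
  apply (ex_derive_continuous (V := R_NormedModule)). unfold dpsiR. destruct (Nat.eqb i 2).
  - auto_derive. auto.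
  - pose proof (exp_sqr_plus_1_pos x) as Hv. pose proof (sqrt_lt_R0 _ Hv).
    auto_derive. repeat split; lra.
Qed.

Lemma psiR_mono (i : nat) (x y : R) : x <= y -> psiR i x <= psiR i y.
Proof.
  intros H. pose proof (exp_le_compat x y H) as He. pose proof (exp_pos x).
  unfold psiR. destruct (Nat.eqb i 2); auto.
  apply ln_le; [pose proof (sqrt_pos (exp x * exp x + 1)); lra|].
  apply Rplus_le_compat; auto. apply sqrt_le_1_alt. nra.
Qed.

Lemma psiR_pos (i : nat) (x : R) : 0 < psiR i x.
Proof.
  unfold psiR. destruct (Nat.eqb i 2); [apply exp_pos|]. pose proof (exp_pos x).
  rewrite <- ln_1. apply ln_increasing; [lra|].
  assert (1 < sqrt (exp x * exp x + 1)); [|lra].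
  rewrite <- sqrt_1 at 1. apply sqrt_lt_1_alt. nra.
Qed.

Lemma psiR_chiR (i : nat) (a : R) : 0 < a -> psiR i (chiR i a) = a.
Proof.
  intros Ha. unfold psiR, chiR. destruct (Nat.eqb i 2); [now apply exp_ln|].
  pose proof (sinh_ge a ltac:(lra)). rewrite exp_ln by lra.
  replace (sinh a * sinh a + 1) with (cosh a * cosh a) by (pose proof (cosh_sqr a); lra).
  pose proof (cosh_ge_1 a). rewrite sqrt_square by lra.
  replace (sinh a + cosh a) with (exp a) by (unfold sinh, cosh; field). apply ln_exp.
Qed.

Lemma psiC_RtoC (i : nat) (x : R) : i = 2%nat \/ i = 3%nat ->
  psiC i (RtoC x) = RtoC (psiR i x) /\ dpsi i (RtoC x) = RtoC (dpsiR i x).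
Proof.
  intros [-> | ->]; unfold dpsi, dpsiR; simpl Nat.eqb; cbv iota.
  - split; apply Cexp_RtoC.
  - destruct (psi3_real x) as [E1 E2]. split; auto. rewrite E2, Cexp_RtoC, <- RtoC_div; auto.
    pose proof (sqrt_lt_R0 _ (exp_sqr_plus_1_pos x)). lra.
Qed.

Lemma cdiff_psiC (i : nat) (zeta : C) : i = 2%nat \/ i = 3%nat ->
  - (PI / 2) < snd zeta < PI / 2 -> cdiff (psiC i) zeta /\ cdiff (dpsi i) zeta.
Proof.
  intros [-> | ->] H.
  - split; apply cdiff_Cexp.
  - split; [now apply cdiff_psi3|].
    apply (cdiff_mult Cexp (fun z => (/ cosh_asinh z)%C)); [apply cdiff_Cexp|].
    apply cdiff_inv; [|now apply cdiff_cosh_asinh].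
    intros E. pose proof (Re_cosh_asinh_pos zeta H) as Hp. rewrite E in Hp. simpl in Hp. lra.
Qed.

Theorem theorem4 (d : R) (i : nat) (f : C -> C) (K al be : R) (n : nat) :
  0 < d -> d < PI / 2 ->
  (i = 2%nat \/ i = 3%nat) ->
  (forall z, psi_image i d z -> ex_derive (K := C_AbsRing) (V := C_NormedModule) f z) ->
  0 < K -> 0 < al -> 0 < be ->
  (forall z, psi_image i d z -> Cmod (f z) <= K * Cmod (E_fun i al be z)) ->
  (0 < n)%nat ->
  let mu := Rmin al be in
  let h := sqrt (2 * PI * d / (mu * INR n)) in
  let M := fst (MN al be n) in
  let N := snd (MN al be n) in
  exists I : C,
    is_RInt_gen (V := C_R_CompleteNormedModule) (fun t : R => f (RtoC t))
      (at_right 0) (Rbar_locally p_infty) I /\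
    Cmod (Cminus I (sinc_sum i f h M N)) <= C_const i K al be d * exp (- sqrt (2 * PI * d * mu * INR n)).
Proof.
  intros Hd Hd2 Hi Hf HK Hal Hbe HfE Hn mu h M N.
  assert (Himg : forall x y, - d < y < d -> psi_image i d (psiC i (x, y))).
  { intros x y Hy. exists (x, y). split; auto. unfold strip; simpl. now apply Rabs_def1. }
  assert (Himr : forall x, psi_image i d (RtoC (psiR i x))).
  { intros x. rewrite <- (proj1 (psiC_RtoC i x Hi)). apply Himg. lra. }
  set (F := fun zeta => (f (psiC i zeta) * dpsi i zeta)%C).
  assert (HFr : forall x : R, F (RtoC x) = (f (RtoC (psiR i x)) * RtoC (dpsiR i x))%C).
  { intros x. unfold F. destruct (psiC_RtoC i x Hi) as [-> ->]. reflexivity. }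
  assert (HFd : forall x y, - d < y < d -> cdiff F (x, y)).
  { intros x y Hy. destruct (cdiff_psiC i (x, y) Hi) as [H1 H2]; [simpl; lra|].
    apply cdiff_mult; auto. apply cdiff_comp; auto. now apply ex_derive_cdiff, Hf, Himg. }
  assert (Hfc : forall x, Ccontinuous (fun t => f (RtoC t)) (psiR i x)).
  { intros x. apply (continuous_horizontal f (psiR i x) 0), cdiff_continuous, ex_derive_cdiff, Hf, Himr. }
  assert (HFE : forall x y, - d < y < d ->
    Cmod (F (x, y)) <= K * (Cmod (E_fun i al be (psiC i (x, y))) * Cmod (dpsi i (x, y)))).
  { intros x y Hy. unfold F. rewrite Cmod_mult, <- Rmult_assoc.
    apply Rmult_le_compat_r; [apply Cmod_ge_0|]. now apply HfE, Himg. }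
  destruct (cos_strip 0 d ltac:(lra) ltac:(lra)) as [[Hcd _] _].
  (* [A0] bounds the transformed integrand on the whole strip and [B0] on the real line, both
     relative to [K] and the decay. *)
  set (A0 := if Nat.eqb i 2 then / Rpower (cos d) ((al + be) / 2)
             else Rpower 2 (be / 2) * c_ad al d / Rpower (cos d) ((al + be) / 2)).
  set (B0 := if Nat.eqb i 2 then 1 else Rpower 2 ((1 - al + Rabs (1 - al)) / 2)).
  assert (Hcad : 0 < c_ad al d) by (unfold c_ad; destruct (Rlt_dec al 1); apply exp_pos).
  assert (Hpc : 0 < Rpower (cos d) ((al + be) / 2)) by apply exp_pos.
  assert (HA : forall x y, - d < y < d -> Cmod (F (x, y)) <= K * A0 * exp (decay al be x)).
  { intros x y Hy. eapply Rle_trans; [now apply HFE|]. rewrite Rmult_assoc.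
    apply Rmult_le_compat_l; [lra|]. unfold A0, dpsi.
    destruct (cos_strip y d ltac:(lra) Hy) as [[_ Hcy] Hc1].
    destruct Hi as [-> | ->]; simpl Nat.eqb; cbv iota.
    - eapply Rle_trans; [apply (E2_decay al be x y); lra|].
      rewrite exp_plus. apply Rmult_le_compat_r; [apply Rlt_le, exp_pos|].
      unfold Rpower. rewrite <- exp_Ropp. apply exp_le_compat.
      pose proof (ln_le _ _ Hcd Hcy). nra.
    - eapply Rle_trans; [apply (E3_decay al be d x y); lra|]. apply Req_le.
      unfold Rminus. now rewrite !exp_plus, exp_Ropp, exp_ln. }
  assert (HB : forall x, Cmod (F (RtoC x)) <= K * B0 * exp (decay al be x)).
  { intros x. eapply Rle_trans; [apply (HFE x 0); lra|]. rewrite Rmult_assoc.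
    apply Rmult_le_compat_l; [lra|]. unfold B0, dpsi.
    destruct Hi as [-> | ->]; simpl Nat.eqb; cbv iota.
    - eapply Rle_trans; [apply (E2_decay al be x 0); rewrite ?cos_0; lra|].
      rewrite cos_0, ln_1. right. rewrite Rmult_1_l. f_equal. ring.
    - eapply Rle_trans; [apply (E3_decay_real al be x); lra|].
      rewrite exp_plus. apply Req_le. reflexivity. }
  assert (HA0 : 0 <= A0).
  { unfold A0. destruct (Nat.eqb i 2); [now apply Rlt_le, Rinv_0_lt_compat|].
    apply Rlt_le, Rdiv_lt_0_compat; auto. apply Rmult_lt_0_compat; auto. apply exp_pos. }
  assert (HB0 : 0 <= B0) by (unfold B0; destruct (Nat.eqb i 2); [lra|apply Rlt_le, exp_pos]).
  destruct (transformed_quadrature f F (psiR i) (dpsiR i) (chiR i) d (K * A0) (K * B0) al be n)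
    as [I [HI1 HI2]]; auto using is_derive_psiR, continuous_dpsiR, psiR_mono, psiR_pos, psiR_chiR.
  1, 2: apply Rmult_le_pos; lra.
  exists I. split; auto.
  replace (sinc_sum i f h M N) with (trap_sum (fun x => F (RtoC x)) h M N).
  2:{ unfold trap_sum, sinc_sum. f_equal. apply sum_n_ext. intros j. cbv zeta. rewrite HFr.
      f_equal. f_equal. symmetry. apply is_derive_unique, is_derive_psiR. }
  eapply Rle_trans; [exact HI2|]. apply Req_le. f_equal.
  pose proof PI_RGT_0.
  assert (Hmu : 0 < mu) by (unfold mu; now apply Rmin_glb_lt).
  assert (Hk : exp (- sqrt (2 * PI * d * mu)) < 1).
  { rewrite <- exp_0. apply exp_increasing. apply Ropp_lt_gt_0_contravar.
    apply sqrt_lt_R0. repeat (apply Rmult_lt_0_compat; [|lra]); lra. }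
  unfold C_const, A0, B0. fold mu. cbv zeta. destruct (Nat.eqb i 2).
  - field. lra.
  (* The extra factor 2 in the constant comes from the two half planes of the discretization
     error. *)
  - replace (Rpower 2 (1 + be / 2)) with (2 * Rpower 2 (be / 2)) by (rewrite Rpower_plus, Rpower_1; lra).
    field. lra.
Qed.
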